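(* Let $\mathrm{k}$ be an algebraically closed field. For each $n\ge 2$, there are two closed subsets $U,S\subset \mathrm{Bir}(\mathbb{P}^n)$, canonically homeomorphic to $\mathbb{A}^1$ and $\mathbb{A}^1\times(\mathbb{A}^1\setminus\{0\})$ respectively, such that, identifying points of $U$ and $S$ with points of $\mathbb{A}^1$ and $\mathbb{A}^1\times(\mathbb{A}^1\setminus\{0\})$ via these homeomorphisms, the following holds: (1) The set of algebraic elements of $\mathrm{Bir}(\mathbb{P}^n)$ lying in $U$ is equal to the set of unipotent elements of $\mathrm{Bir}(\mathbb{P}^n)$ lying in $U$, and corresponds to the elements $t\in\mathbb{A}^1$ that belong to the subgroup of $(\mathrm{k},+)$ generated by $1$. (2) The set of algebraic elements of $\mathrm{Bir}(\mathbb{P}^n)$ lying in $S$ is equal to the set of semi-simple elements of $\mathrm{Bir}(\mathbb{P}^n)$ lying in $S$, and corresponds to the elements $(a,\xi)\in\mathbb{A}^1\times(\mathbb{A}^1\setminus\{0\})$ such that $a=\xi^k$ for some $k\in\mathbb{Z}$. In particular, for each $n\ge 2$, the set $\mathrm{Bir}(\mathbb{P}^n)_{\mathrm{alg}}$ of algebraic elements of $\mathrm{Bir}(\mathbb{P}^n)$ is not closed in $\mathrm{Bir}(\mathbb{P}^n)$. Moreover, if $\mathrm{char}(\mathrm{k})=0$, the set of unipotent elements of $\mathrm{Bir}(\mathbb{P}^n)$ is not closed in $\mathrm{Bir}(\mathbb{P}^n)$.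
   Context: The ground field $\mathrm{k}$ is a fixed algebraically closed field; $\mathbb{A}^1,\mathbb{P}^n$ are over $\mathrm{k}$, points are $\mathrm{k}$-points, and varieties carry the Zariski topology. For an irreducible algebraic variety $X$, $\mathrm{Bir}(X)$ is the group of birational transformations of $X$. Morphisms to $\mathrm{Bir}(X)$: let $A$ be an irreducible algebraic variety and $f$ an $A$-birational map of the $A$-variety $A\times X$ inducing an isomorphism $V_1\to V_2$ between open subsets of $A\times X$ whose projections to $A$ are surjective. Then $f$ is given by $(a,x)\mapsto(a,p_2(f(a,x)))$ with $p_2$ the second projection, and each $a\in A$ gives an element $f_a\colon x\mapsto p_2(f(a,x))$ of $\mathrm{Bir}(X)$. The map $a\mapsto f_a$ is called a morphism from $A$ to $\mathrm{Bir}(X)$. Zariski topology: a subset $F\subseteq\mathrm{Bir}(X)$ is closed if for every algebraic variety $A$ and every morphism $A\to\mathrm{Bir}(X)$ the preimage of $F$ is closed in $A$. Algebraic subgroups: a subgroup $G\subset\mathrm{Bir}(\mathbb{P}^n)$ is an algebraic subgroup if it is the image of an algebraic group $H$ under a group homomorphism $H\to\mathrm{Bir}(\mathbb{P}^n)$ whose restriction to each irreducible component $A$ of $H$ is a morphism from $A$ to $\mathrm{Bir}(\mathbb{P}^n)$, i.e. is of the form $a\mapsto f_a$ for an $A$-birational map $f$ of $A\times\mathbb{P}^n$ inducing an isomorphism between open subsets of $A\times\mathbb{P}^n$ whose projections to $A$ are surjective. Such a $G$ carries a unique structure of algebraic group for which the morphisms $A\to\mathrm{Bir}(\mathbb{P}^n)$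 with image in $G$ are exactly the morphisms of varieties $A\to G$, and with this structure it is an affine algebraic group. An element $\varphi\in\mathrm{Bir}(\mathbb{P}^n)$ is algebraic if it is contained in an algebraic subgroup $G$ of $\mathrm{Bir}(\mathbb{P}^n)$. It is then called unipotent (resp. semi-simple) if it is a unipotent (resp. semi-simple) element of the affine algebraic group $G$; this does not depend on the choice of $G$. Unipotent and semi-simple elements of $\mathrm{Bir}(\mathbb{P}^n)$ are thus in particular algebraic. ''Canonically homeomorphic'' means that the homeomorphisms $\mathbb{A}^1\to U$ and $\mathbb{A}^1\times(\mathbb{A}^1\setminus\{0\})\to S$ are given by morphisms to $\mathrm{Bir}(\mathbb{P}^n)$, i.e. by maps of the form $a\mapsto f_a$ for an $A$-birational map $f$ of $A\times\mathbb{P}^n$ inducing an isomorphism between open subsets of $A\times\mathbb{P}^n$ whose projections to $A$ are surjective, where $A=\mathbb{A}^1$, respectively $A=\mathbb{A}^1\times(\mathbb{A}^1\setminus\{0\})$. *)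

(* Defs.v *)
From HB Require Import structures.
From mathcomp Require Import all_boot all_order all_algebra.
From mathcomp Require Import mpoly.
From mathcomp Require Import all_classical topology.

Set Implicit Arguments.
Unset Strict Implicit.
Unset Printing Implicit Defensive.

Import GRing.Theory.

Local Open Scope classical_set_scope.
Local Open Scope ring_scope.
Local Open Scope quotient_scope.

(* Varieties over an algebraically closed field k are treated classically, as
   topological spaces with a sheaf of k-valued functions. The sheaf is encoded
   by its germs: [regular_at x f] says that the (total) function f is regular
   on some neighbourhood of x, the values of f far from x being irrelevant; the
   sections over an open set U are the f such that [regular_at x f] for all
   x in U, so that the gluing axiom holds by construction. *)
HB.mixin Record isFunSpace (k : fieldType) T & Topological T := {
  regular_at : T -> (T -> k) -> Prop;
  regular_near : forall x f, regular_at x f -> \forall y \near x, regular_at y f;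
  regular_eq_near : forall x f g, (\forall y \near x, f y = g y) ->
    regular_at x f -> regular_at x g;
  regular_cst : forall x c, regular_at x (fun=> c);
  regularD : forall x f g, regular_at x f -> regular_at x g ->
    regular_at x (fun y => f y + g y);
  regularM : forall x f g, regular_at x f -> regular_at x g ->
    regular_at x (fun y => f y * g y);
  regular_neq0 : forall x f, regular_at x f -> f x != 0 ->
    \forall y \near x, f y != 0;
  regularV : forall x f, regular_at x f -> f x != 0 ->
    regular_at x (fun y => (f y)^-1)
}.

#[short(type="funSpaceType")]
HB.structure Definition FunSpace (k : fieldType) :=
  {T of isFunSpace k T & Topological T}.

Section RegularMap.
Variables (k : fieldType) (X Y : funSpaceType k).

Definition regmap_at (f : X -> Y) (x : X) : Prop :=
  {for x, continuous f} /\
  forall g : Y -> k, regular_at (f x) g -> regular_at x (g \o f).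

Definition regmap_on (U : set X) (f : X -> Y) : Prop :=
  forall x, U x -> regmap_at f x.

End RegularMap.

Section Isomorphism.
Variables (k : fieldType) (X Y : funSpaceType k).

Record open_iso (U : set X) (V : set Y) (f : X -> Y) (g : Y -> X) : Prop :=
  OpenIso {
    open_iso_dom : open U;
    open_iso_cod : open V;
    open_iso_fun : forall x, U x -> V (f x);
    open_iso_inv : forall y, V y -> U (g y);
    open_iso_funK : forall x, U x -> g (f x) = x;
    open_iso_invK : forall y, V y -> f (g y) = y;
    open_iso_reg : regmap_on U f;
    open_iso_inv_reg : regmap_on V g
  }.

Definition isomorphic : Prop := exists f g, open_iso setT setT f g.

End Isomorphism.

Section FractionSpace.
Variables (k : fieldType) (T : topologicalType).
Variable fr : T -> (T -> k) -> (T -> k) -> Prop.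
Hypothesis fr_near : forall x P Q, fr x P Q -> \forall y \near x, fr y P Q.
Hypothesis fr_neq0 : forall x P Q, fr x P Q -> Q x != 0 ->
  \forall y \near x, Q y != 0.
Hypothesis fr_cst : forall x c, fr x (fun=> c) (fun=> 1).
Hypothesis frD : forall x P Q P' Q', fr x P Q -> fr x P' Q' ->
  fr x (fun y => P y * Q' y + P' y * Q y) (fun y => Q y * Q' y).
Hypothesis frM : forall x P Q P' Q', fr x P Q -> fr x P' Q' ->
  fr x (fun y => P y * P' y) (fun y => Q y * Q' y).
Hypothesis frV : forall x P Q, fr x P Q -> fr x Q P.

(* The functions which near x are fractions P / Q with Q x != 0, where
   [fr x P Q] tells which numerators and denominators are allowed at x. *)
Definition fraction_at (x : T) (f : T -> k) : Prop :=
  exists P Q, [/\ fr x P Q, Q x != 0 & \forall y \near x, f y = P y / Q y].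

Lemma fraction_near x f : fraction_at x f -> \forall y \near x, fraction_at y f.
Proof.
move=> [P [Q [PQ Qx fPQ]]]; near=> y; exists P, Q; split.
- by near: y; exact: fr_near.
- by near: y; exact: fr_neq0 PQ Qx.
- by near: y; apply: (near_join fPQ).
Unshelve. all: by end_near. Qed.

Lemma fraction_eq_near x f g : (\forall y \near x, f y = g y) ->
  fraction_at x f -> fraction_at x g.
Proof.
move=> fg [P [Q [PQ Qx fPQ]]]; exists P, Q; split=> //.
by near=> y; rewrite -(near fg y) // (near fPQ y).
Unshelve. all: by end_near. Qed.

Lemma fraction_cst x c : fraction_at x (fun=> c).
Proof.
exists (fun=> c), (fun=> 1); split; [exact: fr_cst|exact: oner_neq0|].
by near=> y; rewrite divr1.
Unshelve. all: by end_near. Qed.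

Lemma fractionD x f g : fraction_at x f -> fraction_at x g ->
  fraction_at x (fun y => f y + g y).
Proof.
move=> [P [Q [PQ Qx fPQ]]] [P' [Q' [PQ' Qx' fPQ']]].
exists (fun y => P y * Q' y + P' y * Q y), (fun y => Q y * Q' y).
split; [exact: frD|by rewrite mulf_neq0|].
near=> y; rewrite (near fPQ y) // (near fPQ' y) // addf_div //.
- by near: y; exact: fr_neq0 PQ Qx.
- by near: y; exact: fr_neq0 PQ' Qx'.
Unshelve. all: by end_near. Qed.

Lemma fractionM x f g : fraction_at x f -> fraction_at x g ->
  fraction_at x (fun y => f y * g y).
Proof.
move=> [P [Q [PQ Qx fPQ]]] [P' [Q' [PQ' Qx' fPQ']]].
exists (fun y => P y * P' y), (fun y => Q y * Q' y).
split; [exact: frM|by rewrite mulf_neq0|].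
by near=> y; rewrite (near fPQ y) // (near fPQ' y) // mulf_div.
Unshelve. all: by end_near. Qed.

Lemma fraction_num_neq0 (x : T) (f P Q : T -> k) : (\forall y \near x, f y = P y / Q y) ->
  f x != 0 -> P x != 0.
Proof.
move=> /nbhs_singleton -> ; apply: contra_neq => ->; exact: mul0r.
Qed.

Lemma fraction_neq0 x f : fraction_at x f -> f x != 0 ->
  \forall y \near x, f y != 0.
Proof.
move=> [P [Q [PQ Qx fPQ]]] fx; have Px := fraction_num_neq0 fPQ fx.
near=> y; rewrite (near fPQ y) // mulf_neq0 ?invr_eq0 //.
- by near: y; exact: fr_neq0 (frV PQ) Px.
- by near: y; exact: fr_neq0 PQ Qx.
Unshelve. all: by end_near. Qed.

Lemma fractionV x f : fraction_at x f -> f x != 0 ->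
  fraction_at x (fun y => (f y)^-1).
Proof.
move=> [P [Q [PQ Qx fPQ]]] fx; have Px := fraction_num_neq0 fPQ fx.
exists Q, P; split=> //; first exact: frV.
by near=> y; rewrite (near fPQ y) // invf_div.
Unshelve. all: by end_near. Qed.

End FractionSpace.

Section NonVanishingTopology.
Variables (k : fieldType) (T : Type) (N : set (T -> k)).
Hypothesis N1 : N (fun=> 1).
Hypothesis NM : forall P Q, N P -> N Q -> N (fun x => P x * Q x).

(* The closed sets are the common zero loci of the subsets of N. *)
Definition zariski_open : set_system T :=
  [set W | exists2 E, E `<=` N & W = ~` [set x | forall P, E P -> P x = 0]].

Lemma zariski_openP W : zariski_open W <->
  forall x, W x -> exists P, [/\ N P, P x != 0 & forall y, P y != 0 -> W y].
Proof.
split=> [[E EN ->] x /= /existsNP[P /not_implyP[EP /eqP Px]]|WP].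
  exists P; split=> //; first exact: EN.
  by move=> y /eqP Py; move=> /(_ _ EP).
exists [set P | N P /\ forall y, P y != 0 -> W y]; first by move=> P [].
apply/seteqP; split=> [x Wx /= h|x /= /existsNP[P /not_implyP[[_ PW] /eqP]]].
  have [P [NP /eqP Px PW]] := WP _ Wx; exact/Px/h.
exact: PW.
Qed.

Lemma zariski_openT : zariski_open setT.
Proof.
by apply/zariski_openP => x _; exists (fun=> 1); split=> //; exact: oner_neq0.
Qed.

Lemma zariski_openI : setI_closed zariski_open.
Proof.
move=> V W /zariski_openP hV /zariski_openP hW; apply/zariski_openP => x [Vx Wx].
have [P [NP Px PV]] := hV _ Vx; have [Q [NQ Qx QW]] := hW _ Wx.
exists (fun x => P x * Q x); split; [exact: NM|by rewrite mulf_neq0|].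
by move=> y; rewrite mulf_eq0 negb_or => /andP[/PV ? /QW].
Qed.

Lemma zariski_open_bigU (I : Type) (f : I -> set T) :
  (forall i, zariski_open (f i)) -> zariski_open (\bigcup_i f i).
Proof.
move=> fo; apply/zariski_openP => x [i _ fx].
have /zariski_openP/(_ _ fx)[P [NP Px Pf]] := fo i.
by exists P; split=> // y /Pf; exists i.
Qed.

End NonVanishingTopology.

Section AffineSpace.
Variables (k : fieldType) (n : nat).

Definition affine_space : Type := 'rV[k]_n.
HB.instance Definition _ := Choice.on affine_space.

Definition polyfun (p : {mpoly k[n]}) (x : affine_space) : k :=
  p.@[fun i => (x : 'rV[k]_n) ord0 i].

Lemma polyfun1 : range polyfun (fun=> 1).
Proof. by exists 1 => //; apply/funext => x; rewrite /polyfun meval1. Qed.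

Lemma polyfunM P Q :
  range polyfun P -> range polyfun Q -> range polyfun (fun x => P x * Q x).
Proof.
move=> [p _ <-] [q _ <-]; exists (p * q) => //.
by apply/funext => x; rewrite /polyfun mevalM.
Qed.

Lemma polyfunD P Q :
  range polyfun P -> range polyfun Q -> range polyfun (fun x => P x + Q x).
Proof.
move=> [p _ <-] [q _ <-]; exists (p + q) => //.
by apply/funext => x; rewrite /polyfun mevalD.
Qed.

HB.instance Definition _ := isOpenTopological.Build affine_space
  (zariski_openT polyfun1) (zariski_openI polyfunM)
  (@zariski_open_bigU _ _ (range polyfun)).

Definition affine_fraction (x : affine_space) (P Q : affine_space -> k) :=
  range polyfun P /\ range polyfun Q.

Lemma affine_fraction_near x P Q :
  affine_fraction x P Q -> \forall y \near x, affine_fraction y P Q.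
Proof. by move=> PQ; near=> y. Unshelve. all: by end_near. Qed.

Lemma affine_fraction_neq0 x P Q : affine_fraction x P Q -> Q x != 0 ->
  \forall y \near x, Q y != 0.
Proof.
move=> [_ NQ] Qx; exists [set y | Q y != 0]; split=> //.
by apply/zariski_openP => y Qy; exists Q.
Qed.

Lemma affine_fraction_cst x c : affine_fraction x (fun=> c) (fun=> 1).
Proof.
split; last exact: polyfun1.
by exists c%:MP => //; apply/funext => y; rewrite /polyfun mevalC.
Qed.

Lemma affine_fractionD x P Q P' Q' :
  affine_fraction x P Q -> affine_fraction x P' Q' ->
  affine_fraction x (fun y => P y * Q' y + P' y * Q y) (fun y => Q y * Q' y).
Proof.
by move=> [? ?] [? ?]; split; first apply: polyfunD; exact: polyfunM.
Qed.

Lemma affine_fractionM x P Q P' Q' :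
  affine_fraction x P Q -> affine_fraction x P' Q' ->
  affine_fraction x (fun y => P y * P' y) (fun y => Q y * Q' y).
Proof. by move=> [? ?] [? ?]; split; exact: polyfunM. Qed.

Lemma affine_fractionV x P Q : affine_fraction x P Q -> affine_fraction x Q P.
Proof. by case. Qed.

HB.instance Definition _ := isFunSpace.Build k affine_space
  (fraction_near affine_fraction_near affine_fraction_neq0)
  (@fraction_eq_near _ _ _)
  (fraction_cst affine_fraction_cst)
  (fractionD affine_fraction_neq0 affine_fractionD)
  (fractionM affine_fractionM)
  (fraction_neq0 affine_fraction_neq0 affine_fractionV)
  (fractionV affine_fractionV).

End AffineSpace.

Section ProjectiveSpace.
Variables (k : fieldType) (n : nat).

(* The points are the lines of k^(n+1). *)
Definition proj_space : Type := {L : {vspace 'rV[k]_n.+1} | \dim L == 1%N}.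
HB.instance Definition _ := Choice.on proj_space.

(* The homogeneous coordinates of L are those of the vector [vpick L], which
   spans L; the zero locus of a homogeneous polynomial, and the quotient of two
   homogeneous polynomials of the same degree, do not depend on this choice. *)
Definition hpolyfun (p : {mpoly k[n.+1]}) (L : proj_space) : k :=
  p.@[fun i => vpick (val L) ord0 i].

Definition homogeneous (d : nat) : set (proj_space -> k) :=
  [set hpolyfun p | p in [set p | p \is d.-homog]].

Definition homogeneous_any : set (proj_space -> k) :=
  [set P | exists d, homogeneous d P].

Lemma homogeneous_cst c : homogeneous 0 (fun=> c).
Proof.
exists c%:MP; last by apply/funext => x; rewrite /hpolyfun mevalC.
by rewrite /= -[c%:MP]mulr1 mul_mpolyC; apply/dhomogZ/dhomog1.
Qed.

Lemma homogeneousM d e P Q : homogeneous d P -> homogeneous e Q ->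
  homogeneous (d + e) (fun x => P x * Q x).
Proof.
move=> [p hp <-] [q hq <-]; exists (p * q); first exact: dhomogM.
by apply/funext => x; rewrite /hpolyfun mevalM.
Qed.

Lemma homogeneousD d P Q : homogeneous d P -> homogeneous d Q ->
  homogeneous d (fun x => P x + Q x).
Proof.
move=> [p hp <-] [q hq <-]; exists (p + q); first exact: dhomogD.
by apply/funext => x; rewrite /hpolyfun mevalD.
Qed.

Lemma homogeneous_any1 : homogeneous_any (fun=> 1).
Proof. by exists 0%N; exact: homogeneous_cst. Qed.

Lemma homogeneous_anyM P Q : homogeneous_any P -> homogeneous_any Q ->
  homogeneous_any (fun x => P x * Q x).
Proof. by move=> [d hP] [e hQ]; exists (d + e)%N; exact: homogeneousM. Qed.

HB.instance Definition _ := isOpenTopological.Build proj_space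
  (zariski_openT homogeneous_any1) (zariski_openI homogeneous_anyM)
  (@zariski_open_bigU _ _ homogeneous_any).

Definition proj_fraction (x : proj_space) (P Q : proj_space -> k) :=
  exists d, homogeneous d P /\ homogeneous d Q.

Lemma proj_fraction_near x P Q :
  proj_fraction x P Q -> \forall y \near x, proj_fraction y P Q.
Proof. by move=> PQ; near=> y. Unshelve. all: by end_near. Qed.

Lemma proj_fraction_neq0 x P Q : proj_fraction x P Q -> Q x != 0 ->
  \forall y \near x, Q y != 0.
Proof.
move=> [d [_ NQ]] Qx; exists [set y | Q y != 0]; split=> //.
by apply/zariski_openP => y Qy; exists Q; split=> //; exists d.
Qed.

Lemma proj_fraction_cst x c : proj_fraction x (fun=> c) (fun=> 1).
Proof. by exists 0%N; split; exact: homogeneous_cst. Qed.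

Lemma proj_fractionD x P Q P' Q' :
  proj_fraction x P Q -> proj_fraction x P' Q' ->
  proj_fraction x (fun y => P y * Q' y + P' y * Q y) (fun y => Q y * Q' y).
Proof.
move=> [d [? ?]] [e [? ?]]; exists (d + e)%N.
split; last exact: homogeneousM.
by apply: homogeneousD; [|rewrite addnC]; exact: homogeneousM.
Qed.

Lemma proj_fractionM x P Q P' Q' :
  proj_fraction x P Q -> proj_fraction x P' Q' ->
  proj_fraction x (fun y => P y * P' y) (fun y => Q y * Q' y).
Proof.
by move=> [d [? ?]] [e [? ?]]; exists (d + e)%N; split; exact: homogeneousM.
Qed.

Lemma proj_fractionV x P Q : proj_fraction x P Q -> proj_fraction x Q P.
Proof. by move=> [d []]; exists d. Qed.

HB.instance Definition _ := isFunSpace.Build k proj_space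
  (fraction_near proj_fraction_near proj_fraction_neq0)
  (@fraction_eq_near _ _ _)
  (fraction_cst proj_fraction_cst)
  (fractionD proj_fraction_neq0 proj_fractionD)
  (fractionM proj_fractionM)
  (fraction_neq0 proj_fraction_neq0 proj_fractionV)
  (fractionV proj_fractionV).

End ProjectiveSpace.

(* Subsets carry the induced topology of [set_type]; a function is regular at
   a point if it extends, near this point, to a regular function. *)
Section Subspace.
Variables (k : fieldType) (X : funSpaceType k) (Z : set X).

Definition sub_regular_at (z : Z) (f : Z -> k) : Prop :=
  exists2 g : X -> k, regular_at (\val z) g & \forall y \near z, f y = g (\val y).

Lemma sub_near (z : Z) (D : set X) :
  (\forall y \near \val z, D y) -> \forall y \near z, D (\val y).
Proof. by move=> h; exact: (@initial_continuous _ _ (@set_val X Z)). Qed.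

Lemma sub_regular_near z f :
  sub_regular_at z f -> \forall y \near z, sub_regular_at y f.
Proof.
move=> [g gz fg]; near=> y; exists g.
  by near: y; apply: (@sub_near z (fun y => regular_at y g)); exact: regular_near.
by near: y; apply: (near_join fg).
Unshelve. all: by end_near. Qed.

Lemma sub_regular_eq_near z f g : (\forall y \near z, f y = g y) ->
  sub_regular_at z f -> sub_regular_at z g.
Proof.
move=> fg [h hz fh]; exists h => //.
by near=> y; rewrite -(near fg y) // (near fh y).
Unshelve. all: by end_near. Qed.

Lemma sub_regular_cst z c : sub_regular_at z (fun=> c).
Proof.
exists (fun=> c); first exact: regular_cst.
by near=> y. Unshelve. all: by end_near. Qed.

Lemma sub_regularD z f g : sub_regular_at z f -> sub_regular_at z g ->
  sub_regular_at z (fun y => f y + g y).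
Proof.
move=> [f' rf ff'] [g' rg gg'].
exists (fun y => f' y + g' y); first exact: regularD.
by near=> y; rewrite (near ff' y) // (near gg' y).
Unshelve. all: by end_near. Qed.

Lemma sub_regularM z f g : sub_regular_at z f -> sub_regular_at z g ->
  sub_regular_at z (fun y => f y * g y).
Proof.
move=> [f' rf ff'] [g' rg gg'].
exists (fun y => f' y * g' y); first exact: regularM.
by near=> y; rewrite (near ff' y) // (near gg' y).
Unshelve. all: by end_near. Qed.

Lemma sub_regular_neq0 z f : sub_regular_at z f -> f z != 0 ->
  \forall y \near z, f y != 0.
Proof.
move=> [g rg fg] fz; have gz : g (\val z) != 0 by rewrite -(nbhs_singleton fg).
near=> y; rewrite (near fg y) //; near: y.
by apply: (@sub_near z (fun y => g y != 0)); exact: regular_neq0.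
Unshelve. all: by end_near. Qed.

Lemma sub_regularV z f : sub_regular_at z f -> f z != 0 ->
  sub_regular_at z (fun y => (f y)^-1).
Proof.
move=> [g rg fg] fz; have gz : g (\val z) != 0 by rewrite -(nbhs_singleton fg).
exists (fun y => (g y)^-1); first exact: regularV.
by near=> y; rewrite (near fg y).
Unshelve. all: by end_near. Qed.

HB.instance Definition _ := isFunSpace.Build k (set_type Z)
  sub_regular_near sub_regular_eq_near sub_regular_cst sub_regularD
  sub_regularM sub_regular_neq0 sub_regularV.

End Subspace.

(* A copy of the cartesian product which does not carry the (too coarse)
   product topology. *)
Definition vprod (X Y : Type) : Type := (X * Y)%type.

HB.instance Definition _ (X Y : choiceType) := Choice.on (vprod X Y).

Section Product.
Variables (k : fieldType) (X Y : funSpaceType k).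
Local Notation XY := (vprod X Y).

(* The functions which near p are finite sums of products f(x) g(y), with f and
   g regular: the ring generated by the regular functions of both factors. *)
Inductive prod_ring (p : XY) : (XY -> k) -> Prop :=
| ProdRing_fst f of regular_at p.1 f : prod_ring p (fun q => f q.1)
| ProdRing_snd g of regular_at p.2 g : prod_ring p (fun q => g q.2)
| ProdRing_add P Q of prod_ring p P & prod_ring p Q :
    prod_ring p (fun q => P q + Q q)
| ProdRing_mul P Q of prod_ring p P & prod_ring p Q :
    prod_ring p (fun q => P q * Q q).

(* The sets {P != 0} in U x V, for U and V open and P in the ring above, form
   a basis of the topology. *)
Definition vprod_open : set_system XY :=
  [set W | forall p, W p -> exists P, [/\ prod_ring p P, P p != 0 &
     exists U V, [/\ nbhs p.1 U, nbhs p.2 V &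
       forall q, U q.1 -> V q.2 -> P q != 0 -> W q]]].

Lemma prod_ring_cst p c : prod_ring p (fun=> c).
Proof. by apply: (ProdRing_fst (f := fun=> c)); exact: regular_cst. Qed.

Lemma vprod_openT : vprod_open setT.
Proof.
move=> p _; exists (fun=> 1); split; [exact: prod_ring_cst|exact: oner_neq0|].
by exists setT, setT; split=> //; exact: filterT.
Qed.

Lemma vprod_openI : setI_closed vprod_open.
Proof.
move=> W W' oW oW' p [/oW[P [rP Pp [U [V [nU nV PW]]]]]].
move=> /oW'[P' [rP' Pp' [U' [V' [nU' nV' PW']]]]].
exists (fun q => P q * P' q); split; [exact: ProdRing_mul|exact: mulf_neq0|].
exists (U `&` U'), (V `&` V'); split; [exact: filterI|exact: filterI|].
move=> q [Uq Uq'] [Vq Vq']; rewrite mulf_eq0 negb_or => /andP[Pq Pq'].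
by split; [exact: PW|exact: PW'].
Qed.

Lemma vprod_open_bigU (I : Type) (f : I -> set XY) :
  (forall i, vprod_open (f i)) -> vprod_open (\bigcup_i f i).
Proof.
move=> fo p [i _ /fo[P [rP Pp [U [V [nU nV Pf]]]]]].
exists P; split=> //; exists U, V; split=> // q Uq Vq Pq.
by exists i => //; exact: Pf.
Qed.

HB.instance Definition _ :=
  isOpenTopological.Build XY vprod_openT vprod_openI vprod_open_bigU.

Lemma prod_ring_near_rect p P : prod_ring p P ->
  exists U V, [/\ open_nbhs p.1 U, open_nbhs p.2 V &
    forall q : XY, U q.1 -> V q.2 -> prod_ring q P].
Proof.
elim=> {P} [f|g|P Q _ [U [V [oU oV h]]] _ [U' [V' [oU' oV' h']]]|
  P Q _ [U [V [oU oV h]]] _ [U' [V' [oU' oV' h']]]].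
- move=> rf; have : nbhs p.1 [set x | regular_at x f] by exact: regular_near.
  rewrite nbhsE => -[U oU Uf].
  exists U, setT; split=> //; first exact: open_nbhsT.
  by move=> q /Uf ? _; exact: ProdRing_fst.
- move=> rg; have : nbhs p.2 [set y | regular_at y g] by exact: regular_near.
  rewrite nbhsE => -[V oV Vg].
  exists setT, V; split=> //; first exact: open_nbhsT.
  by move=> q _ /Vg ?; exact: ProdRing_snd.
- exists (U `&` U'), (V `&` V'); split; [exact: open_nbhsI|exact: open_nbhsI|].
  by move=> q [? ?] [? ?]; apply: ProdRing_add; [exact: h|exact: h'].
- exists (U `&` U'), (V `&` V'); split; [exact: open_nbhsI|exact: open_nbhsI|].
  by move=> q [? ?] [? ?]; apply: ProdRing_mul; [exact: h|exact: h'].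
Qed.

Lemma vprod_open_rect (U : set X) (V : set Y) : open U -> open V ->
  open ([set q | U q.1 /\ V q.2] : set XY).
Proof.
move=> oU oV; suff : vprod_open [set q | U q.1 /\ V q.2] by [].
move=> p [Up Vp]; exists (fun=> 1).
split; [exact: prod_ring_cst|exact: oner_neq0|].
by exists U, V; split=> //; exact: open_nbhs_nbhs.
Qed.

Lemma prod_ring_near p P :
  prod_ring p P -> \forall q \near p, prod_ring q P.
Proof.
move=> /prod_ring_near_rect[U [V [[oU Up] [oV Vp] h]]].
exists [set q | U q.1 /\ V q.2]; split=> //; first exact: vprod_open_rect.
by move=> q [Uq Vq]; exact: h.
Qed.

Lemma prod_ring_neq0 p P : prod_ring p P -> P p != 0 ->
  \forall q \near p, P q != 0.
Proof.
move=> rP Pp; have [U [V [[oU Up] [oV Vp] h]]] := prod_ring_near_rect rP.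
exists [set q | [/\ U q.1, V q.2 & P q != 0]]; split=> [q [Uq Vq Pq]||q []] //.
exists P; split=> //; first exact: h.
exists U, V; split=> //; exact: open_nbhs_nbhs.
Qed.

Definition vprod_fraction (p : XY) (P Q : XY -> k) :=
  prod_ring p P /\ prod_ring p Q.

Lemma vprod_fraction_near p P Q :
  vprod_fraction p P Q -> \forall q \near p, vprod_fraction q P Q.
Proof.
move=> [rP rQ]; near=> q; split; near: q; exact: prod_ring_near.
Unshelve. all: by end_near. Qed.

Lemma vprod_fraction_neq0 p P Q : vprod_fraction p P Q -> Q p != 0 ->
  \forall q \near p, Q q != 0.
Proof. by move=> [_]; exact: prod_ring_neq0. Qed.

Lemma vprod_fraction_cst p c : vprod_fraction p (fun=> c) (fun=> 1).
Proof. by split; exact: prod_ring_cst. Qed.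

Lemma vprod_fractionD p P Q P' Q' :
  vprod_fraction p P Q -> vprod_fraction p P' Q' ->
  vprod_fraction p (fun y => P y * Q' y + P' y * Q y) (fun y => Q y * Q' y).
Proof.
move=> [rP rQ] [rP' rQ']; split; last exact: ProdRing_mul.
by apply: (ProdRing_add (P := fun y => P y * Q' y)); exact: ProdRing_mul.
Qed.

Lemma vprod_fractionM p P Q P' Q' :
  vprod_fraction p P Q -> vprod_fraction p P' Q' ->
  vprod_fraction p (fun y => P y * P' y) (fun y => Q y * Q' y).
Proof. by move=> [? ?] [? ?]; split; exact: ProdRing_mul. Qed.

Lemma vprod_fractionV p P Q : vprod_fraction p P Q -> vprod_fraction p Q P.
Proof. by case. Qed.

HB.instance Definition _ := isFunSpace.Build k XY
  (fraction_near vprod_fraction_near vprod_fraction_neq0)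
  (@fraction_eq_near _ _ _)
  (fraction_cst vprod_fraction_cst)
  (fractionD vprod_fraction_neq0 vprod_fractionD)
  (fractionM vprod_fractionM)
  (fraction_neq0 vprod_fraction_neq0 vprod_fractionV)
  (fractionV vprod_fractionV).

End Product.

Definition affine_variety (k : fieldType) (X : funSpaceType k) : Prop :=
  exists (n : nat) (Z : set (affine_space k n)), closed Z /\ isomorphic X Z.

Section Variety.
Variables (k : fieldType) (X : funSpaceType k).

Definition separated : Prop := closed [set p : vprod X X | p.1 = p.2].

Definition variety : Prop :=
  separated /\
  exists (m : nat) (U : 'I_m -> set X),
    (forall i, open (U i) /\ affine_variety (U i)) /\ \bigcup_i U i = setT.

End Variety.

Section Irreducible.
Variable T : topologicalType.

Definition irreducible (Z : set T) : Prop :=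
  Z !=set0 /\
  forall F G : set T, closed F -> closed G -> Z `<=` F `|` G ->
    Z `<=` F \/ Z `<=` G.

Definition irreducible_component (Z : set T) : Prop :=
  irreducible Z /\ forall Z', irreducible Z' -> Z `<=` Z' -> Z' = Z.

End Irreducible.

(* The group Bir(X), as the quotient of the isomorphisms between dense open
   subsets of X (nonempty open subsets, when X is irreducible) by coincidence
   on a dense open subset. *)
Section Birational.
Variables (k : fieldType) (X : funSpaceType k).

Record birep : Type := BiRep {
  bdom : set X;
  bcod : set X;
  bfun : X -> X;
  binv : X -> X;
  birep_iso : open_iso bdom bcod bfun binv;
  bdom_dense : dense bdom;
  bcod_dense : dense bcod
}.

HB.instance Definition _ := gen_eqMixin birep.
HB.instance Definition _ := gen_choiceMixin birep.

Definition birep_eq (f g : birep) : Prop :=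
  exists W, [/\ open W, dense W, W `<=` bdom f `&` bdom g &
    forall x, W x -> bfun f x = bfun g x].

Lemma birep_eq_refl f : birep_eq f f.
Proof.
exists (bdom f); split=> //.
  exact: open_iso_dom (birep_iso f).
exact: bdom_dense.
Qed.

Lemma birep_eq_sym f g : birep_eq f g -> birep_eq g f.
Proof.
by move=> [W [oW dW sW fg]]; exists W; split=> // [|x /fg]//; rewrite setIC.
Qed.

Lemma birep_eq_trans g f h : birep_eq f g -> birep_eq g h -> birep_eq f h.
Proof.
move=> [W [oW dW sW fg]] [V [oV dV sV gh]]; exists (W `&` V); split.
- exact: openI.
- exact: denseI.
- by move=> x [/sW[? _] /sV[_ ?]].
- by move=> x [/fg -> /gh].
Qed.

Definition birep_eqb (f g : birep) : bool := `[< birep_eq f g >].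

Lemma birep_eqb_equiv : equiv_class_of birep_eqb.
Proof.
split=> [f|f g|g f h]; first exact/asboolP/birep_eq_refl.
  by apply/asboolP/asboolP => /birep_eq_sym.
by move=> /asboolP fg /asboolP gh; apply/asboolP; exact: birep_eq_trans gh.
Qed.

Canonical birep_equiv := EquivRelPack birep_eqb_equiv.

Definition Bir : Type := {eq_quot birep_equiv}.
HB.instance Definition _ := Choice.on Bir.
HB.instance Definition _ := EqQuotient.on Bir.

Lemma bir_eqP (f g : birep) : \pi_Bir f = \pi_Bir g <-> birep_eq f g.
Proof. by split=> [/eqmodP/asboolP|/asboolP fg]//; apply/eqmodP. Qed.

Lemma birep_preimage (f : birep) (W : set X) : open W -> dense W ->
  open (bdom f `&` bfun f @^-1` W) /\ dense (bdom f `&` bfun f @^-1` W).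
Proof.
move=> oW dW; have iso := birep_iso f; have oD := open_iso_dom iso.
have oC := open_iso_cod iso; split.
  rewrite openE => x [Dx Wx]; apply: filterI; first exact: open_nbhs_nbhs.
  have [+ _] := open_iso_reg iso Dx; apply; exact: open_nbhs_nbhs.
move=> O O0 oO; have [x [Ox Dx]] : O `&` bdom f !=set0 by exact: bdom_dense.
pose V := bcod f `&` binv f @^-1` (O `&` bdom f).
have oV : open V.
  rewrite openE => y [Cy [Oy Dy]]; apply: filterI; first exact: open_nbhs_nbhs.
  have [+ _] := open_iso_inv_reg iso Cy; apply.
  by apply: open_nbhs_nbhs; split=> //; exact: openI.
have [|y [[Cy [Oy Dy]] Wy]] := dW V _ oV.
  exists (bfun f x); split; first exact: open_iso_fun iso _ Dx.
  by rewrite /= (open_iso_funK iso).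
by exists (binv f y); split=> //; split=> //=; rewrite (open_iso_invK iso).
Qed.

Lemma birep_one_iso : open_iso [set: X] [set: X] id id.
Proof.
have idreg : regmap_on [set: X] id by move=> x _; split=> //; exact: cvg_id.
by split=> //; exact: openT.
Qed.

Lemma dense_setT : dense [set: X].
Proof. by move=> O [x Ox] _; exists x. Qed.

Definition birep_one := BiRep birep_one_iso dense_setT dense_setT.

Lemma birep_inv_iso f : open_iso (bcod f) (bdom f) (binv f) (bfun f).
Proof. by case: (birep_iso f). Qed.

Definition birep_inv f :=
  BiRep (birep_inv_iso f) (@bcod_dense f) (@bdom_dense f).

Lemma regmap_at_comp (f g : X -> X) x :
  regmap_at g x -> regmap_at f (g x) -> regmap_at (f \o g) x.
Proof.
move=> [cg rg] [cf rf]; split; first exact: continuous_comp.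
by move=> h /rf /rg.
Qed.

Definition birep_mul_dom f g := bdom g `&` bfun g @^-1` bdom f.

Lemma birep_mul_dom_open_dense f g :
  open (birep_mul_dom f g) /\ dense (birep_mul_dom f g).
Proof.
apply: birep_preimage; last exact: bdom_dense.
exact: open_iso_dom (birep_iso f).
Qed.

Lemma birep_mul_fun f g x : birep_mul_dom f g x ->
  birep_mul_dom (birep_inv g) (birep_inv f) (bfun f (bfun g x)).
Proof.
have isof := birep_iso f; have isog := birep_iso g.
move=> [Dx Dgx]; split; first exact: (open_iso_fun isof).
by rewrite /= (open_iso_funK isof) //; exact: (open_iso_fun isog).
Qed.

Lemma birep_mul_iso f g :
  open_iso (birep_mul_dom f g) (birep_mul_dom (birep_inv g) (birep_inv f))
    (bfun f \o bfun g) (binv g \o binv f).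
Proof.
have isof := birep_iso f; have isog := birep_iso g.
split.
- by have [] := birep_mul_dom_open_dense f g.
- by have [] := birep_mul_dom_open_dense (birep_inv g) (birep_inv f).
- exact: birep_mul_fun.
- by move=> y [Cy Cfy]; split; rewrite /= ?(open_iso_invK isog) //;
    [exact: (open_iso_inv isog)|exact: (open_iso_inv isof)].
- by move=> x [Dx Dgx] /=; rewrite (open_iso_funK isof) // (open_iso_funK isog).
- by move=> y [Cy Cfy] /=; rewrite (open_iso_invK isog) // (open_iso_invK isof).
- move=> x [Dx Dgx]; apply: regmap_at_comp; first exact: (open_iso_reg isog).
  exact: (open_iso_reg isof).
- move=> y [Cy Cfy]; apply: regmap_at_comp.
    exact: (open_iso_inv_reg isof).
  exact: (open_iso_inv_reg isog).
Qed.

Definition birep_mul f g := BiRep (birep_mul_iso f g)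
  (birep_mul_dom_open_dense f g).2
  (birep_mul_dom_open_dense (birep_inv g) (birep_inv f)).2.

Lemma birep_eq_mul f f' g g' :
  birep_eq f f' -> birep_eq g g' -> birep_eq (birep_mul f g) (birep_mul f' g').
Proof.
move=> [W [oW dW sW ff']] [V [oV dV sV gg']].
have [oU dU] := birep_preimage g oW dW.
exists (V `&` (bdom g `&` bfun g @^-1` W)); split.
- exact: openI.
- exact: denseI.
- move=> x [Vx [Dx Wx]]; have [_ Dx'] := sV _ Vx; have [Dfx Dfx'] := sW _ Wx.
  by split; split=> //; rewrite /= -gg'.
- by move=> x [Vx [Dx Wx]] /=; rewrite -gg' // ff'.
Qed.

Lemma birep_eq_inv f g : birep_eq f g -> birep_eq (birep_inv f) (birep_inv g).
Proof.
move=> [W [oW dW sW fg]].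
have isof := birep_iso f; have isog := birep_iso g.
have [oU dU] := birep_preimage (birep_inv f) oW dW.
have key y : bcod f y -> W (binv f y) -> y = bfun g (binv f y).
  by move=> Cy Wy; rewrite -fg // (open_iso_invK isof).
exists (bcod f `&` binv f @^-1` W); split=> // y [Cy Wy].
  split=> //=; rewrite (key _ Cy Wy); apply: (open_iso_fun isog).
  by have [] := sW _ Wy.
by rewrite /= {2}(key _ Cy Wy) (open_iso_funK isog) //; have [] := sW _ Wy.
Qed.

Definition bir_one : Bir := \pi_Bir birep_one.
Definition bir_mul (f g : Bir) : Bir :=
  \pi_Bir (birep_mul (repr f) (repr g)).
Definition bir_inv (f : Bir) : Bir := \pi_Bir (birep_inv (repr f)).

Lemma birep_repr_pi f : birep_eq (repr (\pi_Bir f)) f.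
Proof. by apply/bir_eqP; rewrite reprK. Qed.

Lemma bir_mulE f g : bir_mul (\pi_Bir f) (\pi_Bir g) = \pi_Bir (birep_mul f g).
Proof. by apply/bir_eqP/birep_eq_mul; exact: birep_repr_pi. Qed.

Lemma bir_invE f : bir_inv (\pi_Bir f) = \pi_Bir (birep_inv f).
Proof. by apply/bir_eqP/birep_eq_inv; exact: birep_repr_pi. Qed.

Lemma birep_eq_ext f g : bdom f `<=` bdom g ->
  (forall x, bdom f x -> bfun f x = bfun g x) -> birep_eq f g.
Proof.
move=> fg efg; exists (bdom f); split=> //.
- exact: open_iso_dom (birep_iso f).
- exact: bdom_dense.
- by move=> x Dx; split=> //; exact: fg.
Qed.

Lemma bir_mulA : associative bir_mul.
Proof.
elim/quotW => f; elim/quotW => g; elim/quotW => h.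
rewrite (bir_mulE g h) (bir_mulE f g) (bir_mulE f) (bir_mulE _ h); apply/bir_eqP/birep_eq_ext => //.
by move=> x [[Dx Dhx] Dghx]; split.
Qed.

Lemma bir_mul1 : left_id bir_one bir_mul.
Proof.
by elim/quotW => f; rewrite bir_mulE; apply/bir_eqP/birep_eq_ext => // x [].
Qed.

Lemma bir_mulr1 : right_id bir_one bir_mul.
Proof.
by elim/quotW => f; rewrite bir_mulE; apply/bir_eqP/birep_eq_ext => // x [].
Qed.

Lemma bir_mulV : left_inverse bir_one bir_inv bir_mul.
Proof.
elim/quotW => f; rewrite bir_invE bir_mulE.
apply/bir_eqP/birep_eq_ext => // x [Dx _] /=.
exact: open_iso_funK (birep_iso f) _ Dx.
Qed.

Lemma bir_mulrV : right_inverse bir_one bir_inv bir_mul.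
Proof.
elim/quotW => f; rewrite bir_invE bir_mulE.
apply/bir_eqP/birep_eq_ext => // x [Dx _] /=.
exact: open_iso_invK (birep_iso f) _ Dx.
Qed.

HB.instance Definition _ :=
  isGroup.Build Bir bir_mulA bir_mul1 bir_mulr1 bir_mulV bir_mulrV.

End Birational.

Section BirationalFamilies.
Variables (k : fieldType) (X : funSpaceType k).

Definition fibre (A : Type) (V : set (vprod A X)) (a : A) : set X :=
  [set x | V (a, x)].

(* For A an irreducible variety: [bir_morphism rho] says that rho is a |-> f_a,
   for f an A-birational map of A x X inducing an isomorphism F : V1 -> V2. *)
Definition bir_morphism (A : funSpaceType k) (rho : A -> Bir X) : Prop :=
  exists (V1 V2 : set (vprod A X)) (F G : vprod A X -> vprod A X),
    [/\ open_iso V1 V2 F G,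
        forall p, V1 p -> (F p).1 = p.1,
        [set p.1 | p in V1] = setT /\ [set p.1 | p in V2] = setT &
        forall a, exists r : birep X,
          [/\ \pi_(Bir X) r = rho a, bdom r = fibre V1 a &
              forall x, fibre V1 a x -> bfun r x = (F (a, x)).2]].

Definition bir_open : set_system (Bir X) :=
  [set O | forall (A : funSpaceType k) (rho : A -> Bir X), variety A ->
     irreducible [set: A] -> bir_morphism rho -> open (rho @^-1` O)].

Lemma bir_openT : bir_open setT.
Proof. by move=> A rho _ _ _; rewrite preimage_setT; exact: openT. Qed.

Lemma bir_openI : setI_closed bir_open.
Proof.
move=> O O' oO oO' A rho vA iA mrho; rewrite preimage_setI.
by apply: openI; [exact: oO|exact: oO'].
Qed.

Lemma bir_open_bigU (I : Type) (f : I -> set (Bir X)) :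
  (forall i, bir_open (f i)) -> bir_open (\bigcup_i f i).
Proof.
move=> fo A rho vA iA mrho; rewrite preimage_bigcup.
by apply: bigcup_open => i _; exact: fo.
Qed.

HB.instance Definition _ :=
  isOpenTopological.Build (Bir X) bir_openT bir_openI bir_open_bigU.

Lemma bir_closedP (F : set (Bir X)) : closed F <->
  forall (A : funSpaceType k) (rho : A -> Bir X), variety A ->
    irreducible [set: A] -> bir_morphism rho -> closed (rho @^-1` F).
Proof.
rewrite -openC; split=> [oF A rho vA iA mrho|cF].
  by rewrite -openC; exact: (oF A rho vA iA mrho).
suff : bir_open (~` F) by [].
by move=> A rho vA iA mrho; have := cF A rho vA iA mrho; rewrite -openC.
Qed.

End BirationalFamilies.

(* The two structures are unrelated here; see [algebraic_group]. *)
#[short(type="funGroupType")]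
HB.structure Definition FunGroup (k : fieldType) :=
  {G of FunSpace k G & Group G}.

Section AlgebraicGroup.
Variables (k : fieldType) (H : funGroupType k).
Local Open Scope group_scope.

Definition algebraic_group : Prop :=
  [/\ variety H,
      regmap_on [set: vprod H H] (fun p : vprod H H => (p.1 * p.2 : H)) &
      regmap_on [set: H] (fun h : H => h^-1)].

(* M is the matrix, in the basis f, of the restriction of the right translation
   rho_h : f |-> (x |-> f (x h)) to a finite-dimensional stable subspace of
   k[H]. *)
Definition translation_matrix (h : H) (m : nat) (M : 'M[k]_m) : Prop :=
  exists f : 'I_m -> H -> k,
    [/\ forall i x, regular_at x (f i),
        forall c : 'I_m -> k,
          (forall x, \sum_i c i * f i x = 0)%R -> forall i, c i = 0%R &
        forall i x, f i (x * h) = (\sum_j M i j * f j x)%R].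

(* For H affine: h is unipotent (semi-simple) if rho_h is unipotent
   (diagonalizable) on each finite-dimensional stable subspace of k[H]. *)
Definition unipotent_element (h : H) : Prop :=
  forall (m : nat) (M : 'M[k]_m), translation_matrix h M ->
    exists N : nat, ((M - 1%:M) ^+ N = 0)%R.

Definition semisimple_element (h : H) : Prop :=
  forall (m : nat) (M : 'M[k]_m), translation_matrix h M -> diagonalizable M.

End AlgebraicGroup.

Section AlgebraicSubgroup.
Variables (k : fieldType) (X : funSpaceType k).
Local Open Scope group_scope.

Definition group_hom (H : funGroupType k) (rho : H -> Bir X) : Prop :=
  forall x y : H, rho (x * y) = rho x * rho y.

Definition algebraic_subgroup (G : set (Bir X)) : Prop :=
  exists (H : funGroupType k) (rho : H -> Bir X),
    [/\ algebraic_group H, group_hom rho,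
        forall A : set H, irreducible_component A ->
          bir_morphism (fun a : A => rho (\val a)) &
        range rho = G].

(* The group G, endowed through the bijection iota : H -> G with a structure
   of algebraic group for which the morphisms A -> Bir(X) with image in G are
   the morphisms of varieties A -> G. *)
Definition algebraic_structure (G : set (Bir X)) (H : funGroupType k)
    (iota : H -> Bir X) : Prop :=
  [/\ algebraic_group H, group_hom iota, injective iota, range iota = G &
      forall A : funSpaceType k, variety A -> irreducible [set: A] ->
        forall rho : A -> H,
          regmap_on [set: A] rho <-> bir_morphism (iota \o rho)].

Definition bir_algebraic : set (Bir X) :=
  [set phi | exists G, algebraic_subgroup G /\ G phi].

Definition bir_unipotent : set (Bir X) :=
  [set phi | exists (G : set (Bir X)) (H : funGroupType k) (iota : H -> Bir X),
     [/\ algebraic_subgroup G, algebraic_structure G iota, affine_variety H &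
         exists2 h : H, iota h = phi & unipotent_element h]].

Definition bir_semisimple : set (Bir X) :=
  [set phi | exists (G : set (Bir X)) (H : funGroupType k) (iota : H -> Bir X),
     [/\ algebraic_subgroup G, algebraic_structure G iota, affine_variety H &
         exists2 h : H, iota h = phi & semisimple_element h]].

End AlgebraicSubgroup.

Definition homeomorphism_onto (T T' : topologicalType) (f : T -> T')
    (B : set T') : Prop :=
  [/\ continuous f, range f = B &
      exists g : T' -> T, cancel f g /\ {within B, continuous g}].

Definition affine_line (k : fieldType) : funSpaceType k := affine_space k 1.

Definition affine_coord (k : fieldType) (t : affine_line k) : k :=
  (t : 'rV[k]_1) ord0 ord0.

Definition punctured_line (k : fieldType) : funSpaceType k :=
  set_type [set t : affine_line k | affine_coord t != 0].

Definition line_times_punctured_line (k : fieldType) : funSpaceType k :=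
  vprod (affine_line k) (punctured_line k).

Definition punctured_coord (k : fieldType) (xi : punctured_line k) : k :=
  affine_coord (\val xi).

(* Main.v *)
(* Let c(x) = xi x + e. In the coordinates (x, y, ...) of the chart x0 = 1 put
     f_(a, xi)(x, y, ...) = (c(x), y (x + a) / (x + d), ...);
   S is the family e = 0, d = 1, and U the family e = 1, d = 0, xi = 1 with
   parameter t = a. The parameter of f_(a, xi) is a regular function of one
   generic point and of its image; evaluating a morphism A -> Bir(P^n) at such a
   point shows that the images of the closed sets of parameters are closed.
   The N-th power of f_(a, xi) multiplies y by
     prod_(i < N) (c^i(x) + a) / (c^i(x) + d).
   If no orbit of c contains both -a and -d, this fraction is reduced and of
   degree N, whereas the degrees are bounded on every algebraic subgroup: they
   are locally bounded on each irreducible component of an algebraic group, and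
   its topology is noetherian. Hence f_(a, xi) is not algebraic.
   Otherwise (a an integer for U, a power of xi for S), the product telescopes:
   (x + a) / (x + d) is, up to a constant, g(c(x)) / g(x) for a product g of
   linear factors and their inverses, and f_(a, xi) is conjugate to a translation
   or to a diagonal map.
   Finally, for a fixed a distinct from 0 and 1, the solutions xi of xi^N = a
   are dense in the line while xi = 1 is not one of them, so that the algebraic
   elements of S do not form a closed set; neither do the integers of a field of
   characteristic 0. *)

Require Import Defs.
From HB Require Import structures.
From mathcomp Require Import all_boot all_order all_algebra.
From mathcomp Require Import mpoly ring separable.
From mathcomp Require Import all_classical topology.

Set Implicit Arguments.
Unset Strict Implicit.
Unset Printing Implicit Defensive.

Import GRing.Theory.

Local Open Scope classical_set_scope.
Local Open Scope ring_scope.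

(** * Regular functions and regular maps *)

(** The test varieties [A] and the algebraic groups [H] are arbitrary, and the values of a morphism
    to [Bir(P^n)] need not be triangular, so all arguments go through evaluation at points and along
    lines. Triangular maps are handled through concrete data closed under composition, and equality
    of a birational map with one of them is tested by equations with cleared denominators ([trel]),
    which hold wherever both points have affine coordinates and not just generically. One point
    proposes the parameter and a second one refutes it; both are open conditions on [a]. For the
    degree, a local fraction [P / Q] is restricted to a line in the direction of [x1]: there its
    degree is bounded independently of [a], and a reduced denominator has to divide it. In the
    resonant case the map lies in a conjugate of [G_a] or [G_m]; as unipotent and semi-simple
    elements are defined through all finite-dimensional stable spaces of regular functions, the
    global functions on these two curves have to be determined. *)

Section RegularFunctions.
Variables (k : fieldType) (X : funSpaceType k).
Implicit Types (x : X) (f g : X -> k).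

Lemma regularN x f : regular_at x f -> regular_at x (fun y => - f y).
Proof.
move=> rf; have -> : (fun y => - f y) = (fun y => (-1) * f y).
  by apply/funext => y; rewrite mulN1r.
by apply: regularM rf; exact: regular_cst.
Qed.

Lemma regularB x f g :
  regular_at x f -> regular_at x g -> regular_at x (fun y => f y - g y).
Proof. by move=> rf rg; apply: regularD => //; exact: regularN. Qed.

Lemma regular_sum x (I : Type) (s : seq I) (P : pred I) (F : I -> X -> k) :
  (forall i, regular_at x (F i)) ->
  regular_at x (fun y => \sum_(i <- s | P i) F i y).
Proof.
move=> rF; elim: s => [|i s IH].
  under eq_fun do rewrite big_nil; exact: regular_cst.
under eq_fun do rewrite big_cons; case: (P i) => //; exact: regularD.
Qed.

Lemma regular_prod x (I : Type) (s : seq I) (P : pred I) (F : I -> X -> k) :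
  (forall i, regular_at x (F i)) ->
  regular_at x (fun y => \prod_(i <- s | P i) F i y).
Proof.
move=> rF; elim: s => [|i s IH].
  under eq_fun do rewrite big_nil; exact: regular_cst.
under eq_fun do rewrite big_cons; case: (P i) => //; exact: regularM.
Qed.

Lemma regular_exp x f n : regular_at x f -> regular_at x (fun y => f y ^+ n).
Proof.
move=> rf; elim: n => [|n IH]; first exact: regular_cst.
by under eq_fun do rewrite exprS; exact: regularM.
Qed.

Lemma regular_div x f g : regular_at x f -> regular_at x g -> g x != 0 ->
  regular_at x (fun y => f y / g y).
Proof. by move=> rf rg gx; apply: regularM => //; exact: regularV. Qed.

Lemma regular_horner x f (p : {poly k}) :
  regular_at x f -> regular_at x (fun y => p.[f y]).
Proof.
move=> rf; under eq_fun do rewrite horner_coef.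
by apply: regular_sum => i; apply: regularM; [exact: regular_cst|exact: regular_exp].
Qed.

Lemma regular_meval x m (p : {mpoly k[m]}) (F : 'I_m -> X -> k) :
  (forall i, regular_at x (F i)) ->
  regular_at x (fun y => p.@[fun i => F i y]).
Proof.
move=> rF; under eq_fun do rewrite mevalE.
apply: regular_sum => i; apply: regularM; first exact: regular_cst.
by apply: regular_prod => j; exact: regular_exp.
Qed.

Lemma regular_near_neq x f g : regular_at x f -> regular_at x g ->
  f x != g x -> \forall y \near x, f y != g y.
Proof.
move=> rf rg; rewrite -subr_eq0 => fg.
have := regular_neq0 _ _ (regularB rf rg) fg.
by apply: filterS => y; rewrite subr_eq0.
Qed.

Lemma regular_eq_dense (O D : set X) f g : open O -> dense D ->
  (forall x, O x -> regular_at x f) -> (forall x, O x -> regular_at x g) ->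
  (forall x, O x -> D x -> f x = g x) -> forall x, O x -> f x = g x.
Proof.
move=> oO dD rf rg fg x Ox; apply/eqP/negP => /negP fgx.
have /regular_near_neq /(_ (rg x Ox) fgx) := rf x Ox.
have nO : nbhs x O by exact: open_nbhs_nbhs.
move=> /(filterI nO); rewrite nbhsE => -[W [oW Wx] WO].
have [y [Wy Dy]] : W `&` D !=set0 by apply: dD => //; exists x.
by have [Oy /eqP] := WO _ Wy; apply; exact: fg.
Qed.

End RegularFunctions.

Section RegularMaps.
Variables (k : fieldType).
Implicit Types (X Y Z : funSpaceType k).

Lemma regmap_comp X Y Z (g : X -> Y) (f : Y -> Z) x :
  regmap_at g x -> regmap_at f (g x) -> regmap_at (f \o g) x.
Proof.
move=> [cg rg] [cf rf]; split; first exact: continuous_comp.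
by move=> h /rf /rg.
Qed.

Lemma regmap_id X (x : X) : regmap_at id x.
Proof. by split=> //; exact: cvg_id. Qed.

Lemma regmap_cst X Y (x : X) (y : Y) : regmap_at (fun=> y) x.
Proof. by split=> [|g _]; [exact: cvg_cst|exact: regular_cst]. Qed.

Lemma regmap_near X Y (f g : X -> Y) x :
  (\forall y \near x, f y = g y) -> regmap_at f x -> regmap_at g x.
Proof.
move=> fg [cf rf]; have fgx := nbhs_singleton fg; split.
  move=> /= W; rewrite /= -fgx => /cf /= fW.
  have fW' : nbhs x (f @^-1` W) by exact: fW.
  suff : nbhs x (g @^-1` W) by [].
  by apply: (filterS _ (filterI fg fW')) => y [/= <-].
move=> h; rewrite -fgx => /rf; apply: regular_eq_near.
by move: fg; apply: filterS => y /= ->.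
Qed.

Lemma regmap_fst X Y (p : vprod X Y) : regmap_at (fun q : vprod X Y => q.1) p.
Proof.
split=> [W|g rg] /=.
  rewrite nbhsE => -[O [oO Op] OW].
  exists [set q | O q.1 /\ setT q.2]; split=> //.
    exact: vprod_open_rect oO openT.
  by move=> q [/OW].
exists (fun q => g q.1), (fun=> 1); split; last by near=> q; rewrite divr1.
  by split; [exact: ProdRing_fst|exact: prod_ring_cst].
exact: oner_neq0.
Unshelve. all: by end_near. Qed.

Lemma regmap_snd X Y (p : vprod X Y) : regmap_at (fun q : vprod X Y => q.2) p.
Proof.
split=> [W|g rg] /=.
  rewrite nbhsE => -[O [oO Op] OW].
  exists [set q | setT q.1 /\ O q.2]; split=> //.
    exact: vprod_open_rect openT oO.
  by move=> q [_ /OW].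
exists (fun q => g q.2), (fun=> 1); split; last by near=> q; rewrite divr1.
  by split; [exact: ProdRing_snd|exact: prod_ring_cst].
exact: oner_neq0.
Unshelve. all: by end_near. Qed.

Lemma prod_ring_pullback X Y Z (f : Z -> vprod X Y) z P :
  regmap_at (fun w => (f w).1) z -> regmap_at (fun w => (f w).2) z ->
  prod_ring (f z) P -> regular_at z (P \o f).
Proof.
move=> [_ rf] [_ rg]; elim=> {P} [h /rf|h /rg|P Q _ IP _ IQ|P Q _ IP _ IQ] //.
  exact: regularD IP IQ.
exact: regularM IP IQ.
Qed.

(** The topology of [vprod] is finer than the product topology, so continuity is checked on the
    basic sets [P != 0], whose preimages are open because [P \o f] is regular. *)
Lemma regmap_pair X Y Z (f : Z -> vprod X Y) z :
  regmap_at (fun w => (f w).1) z -> regmap_at (fun w => (f w).2) z ->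
  regmap_at f z.
Proof.
move=> rf rg; have cf : {for z, continuous f}.
  move=> W; rewrite nbhsE => -[O [oO Oz] OW].
  have [P [rP Pz [U [V [nU nV h]]]]] := oO _ Oz.
  have rPf := prod_ring_pullback rf rg rP.
  have := regular_neq0 _ _ rPf Pz; have := rf.1 _ nU; have := rg.1 _ nV.
  move=> /= Vz Uz PZ; near=> w; apply: OW; apply: h.
  - by near: w.
  - by near: w.
  - by near: w.
split=> // h [P [Q [[rP rQ] Qz hPQ]]].
have rPf := prod_ring_pullback rf rg rP; have rQf := prod_ring_pullback rf rg rQ.
apply: regular_eq_near (regular_div rPf rQf Qz).
by have hf : nbhs z (f @^-1` _) := cf _ hPQ; apply: (filterS _ hf) => w /= ->.
Unshelve. all: by end_near. Qed.

Lemma regmap_slice X Y (x : X) y :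
  regmap_at (fun y' => (x, y') : vprod X Y) y.
Proof. by apply: regmap_pair; [exact: regmap_cst|exact: regmap_id]. Qed.

Lemma regmap_slicel X Y (x : X) (y : Y) :
  regmap_at (fun x' => (x', y) : vprod X Y) x.
Proof. by apply: regmap_pair; [exact: regmap_id|exact: regmap_cst]. Qed.

Lemma regmap_val X (A : set X) (a : A) : regmap_at (val : A -> X) a.
Proof.
split; first exact: (@initial_continuous _ _ (@set_val X A)).
by move=> g rg; exists g => //; near=> y.
Unshelve. all: by end_near. Qed.

Lemma regmap_sub X Y (A : set X) (f : Y -> A) y :
  regmap_at (fun w => val (f w)) y -> regmap_at f y.
Proof.
move=> [cf rf]; have cF : {for y, continuous f}.
  move=> W [O [[O' oO' <-] Oy] OW] /=.
  have : nbhs y ((fun w => val (f w)) @^-1` O').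
    by apply: cf; apply: open_nbhs_nbhs.
  by apply: filterS => w /= /OW.
split=> // h [g rg hg]; apply: regular_eq_near (rf _ rg).
by have hF : nbhs y (f @^-1` _) := cF _ hg; apply: (filterS _ hF) => w /= ->.
Qed.

Lemma regular_coord n (x : affine_space k n) (i : 'I_n) :
  regular_at x (fun y : affine_space k n => (y : 'rV[k]_n) ord0 i).
Proof.
exists (polyfun 'X_i), (fun=> 1); split; [split|exact: oner_neq0|].
- by exists 'X_i.
- exact: polyfun1.
- by near=> y; rewrite divr1 /polyfun mevalXU.
Unshelve. all: by end_near. Qed.

Lemma regmap_affine n X (f : X -> affine_space k n) x :
  (forall i, regular_at x (fun y => (f y : 'rV[k]_n) ord0 i)) -> regmap_at f x.
Proof.
move=> rf; have rP p : range (@polyfun k n) p -> regular_at x (p \o f).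
  by move=> [q _ <-]; exact: regular_meval.
have cf : {for x, continuous f}.
  move=> W; rewrite nbhsE => -[O [/zariski_openP oO Ox] OW].
  have [P [/rP rPf Px PO]] := oO _ Ox.
  by have := regular_neq0 _ _ rPf Px; apply: filterS => y /PO /OW.
split=> // h [P [Q [[/rP rPf /rP rQf] Qx hPQ]]].
apply: regular_eq_near (regular_div rPf rQf Qx).
by have hf : nbhs x (f @^-1` _) := cf _ hPQ; apply: (filterS _ hf) => w /= ->.
Qed.

Lemma regmap_regular X (f : X -> affine_space k 1) x :
  regular_at x (fun y => affine_coord (f y)) -> regmap_at f x.
Proof. by move=> rf; apply: regmap_affine => i; rewrite [i]ord1. Qed.

End RegularMaps.

Lemma regmap_nbhs (k : fieldType) (X Y : funSpaceType k) (f : X -> Y) x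
    (W : set Y) :
  regmap_at f x -> (\forall y \near f x, W y) -> \forall y \near x, W (f y).
Proof. by move=> [cf _] nW; exact: (cf W nW). Qed.

(** * Projective space *)

(** Applied to lines, this reduces non-vanishing in several variables to counting the roots of a
    univariate polynomial. *)
Lemma meval_poly (k : fieldType) m (p : {mpoly k[m]}) (r : 'I_m -> {poly k}) :
  exists q : {poly k}, forall s, q.[s] = p.@[fun i => (r i).[s]].
Proof.
exists (\sum_(e <- msupp p) p@_e *: \prod_i r i ^+ e i) => s.
rewrite mevalE horner_sum; apply: eq_bigr => e _.
rewrite hornerZ horner_prod; congr (_ * _).
by apply: eq_bigr => i _; rewrite horner_exp.
Qed.

Lemma meval_dhomogZ (k : fieldType) m d (p : {mpoly k[m]}) c (v : 'I_m -> k) :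
  p \is d.-homog -> p.@[fun i => c * v i] = c ^+ d * p.@[v].
Proof.
move=> /dhomogP hp; rewrite !mevalE mulr_sumr; apply: eq_big_seq => e /hp <-.
rewrite mulrCA; congr (_ * _).
under eq_bigr do rewrite exprMn.
rewrite big_split /=; congr (_ * _).
by rewrite prodrXr /mdeg big_tuple.
Qed.

Section ProjectivePoints.
Variables (k : closedFieldType) (n : nat).
Local Notation PP := (proj_space k n).
Implicit Types (L : PP) (v w : 'rV[k]_n.+1).

Definition hcoord L : 'rV[k]_n.+1 := vpick (val L).

Lemma hcoord_neq0 L : hcoord L != 0.
Proof.
rewrite vpick0; apply/negP => /eqP L0.
by have := valP L; rewrite /= L0 dimv0.
Qed.

Lemma vline_const1 : \dim <[const_mx 1 : 'rV[k]_n.+1]>%VS == 1%N.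
Proof.
rewrite dim_vline; suff -> : const_mx 1 != 0 :> 'rV[k]_n.+1 by [].
by apply/rV0Pn; exists ord0; rewrite mxE oner_neq0.
Qed.

(* The zero vector gets a junk value. *)
Definition proj_point v : PP :=
  insubd (exist (fun L : {vspace 'rV[k]_n.+1} => \dim L == 1%N) _ vline_const1 : PP) <[v]>%VS.

Lemma val_proj_point v : v != 0 -> val (proj_point v) = <[v]>%VS.
Proof. by move=> v0; rewrite /proj_point val_insubd dim_vline v0. Qed.

Lemma hcoord_point v : v != 0 ->
  exists2 c, c != 0 & hcoord (proj_point v) = c *: v.
Proof.
move=> v0; have := memv_pick (val (proj_point v)).
rewrite val_proj_point // => /vlineP[c hc].
have hE : hcoord (proj_point v) = c *: v by rewrite /hcoord val_proj_point.
exists c => //; apply: contraNneq (hcoord_neq0 (proj_point v)) => c0.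
by rewrite hE c0 scale0r.
Qed.

Lemma point_hcoord L : proj_point (hcoord L) = L.
Proof.
apply/val_inj; rewrite val_proj_point ?hcoord_neq0 //; apply/eqP.
rewrite eqEdim -memvE memv_pick dim_vline hcoord_neq0.
by have /eqP -> := valP L.
Qed.

Lemma proj_pointZ c v : c != 0 -> proj_point (c *: v) = proj_point v.
Proof.
move=> c0; congr (insubd _ _); apply/eqP; rewrite eqEsubv; apply/andP; split.
  by rewrite -memvE; apply/vlineP; exists c.
rewrite -memvE; apply/vlineP; exists c^-1.
by rewrite scalerA mulVf // scale1r.
Qed.

Lemma hpolyfun_point v : v != 0 ->
  exists2 c, c != 0 & forall d (q : {mpoly k[n.+1]}), q \is d.-homog ->
    hpolyfun q (proj_point v) = c ^+ d * q.@[fun i => v ord0 i].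
Proof.
move=> /hcoord_point[c c0 hc]; exists c => // d q hq.
rewrite /hpolyfun -/(hcoord _) hc -(meval_dhomogZ _ _ hq).
by apply: meval_eq => i; rewrite mxE.
Qed.

(** The coordinates chosen by [vpick] differ from [v y] by a scalar that varies with [y] without any
    regularity. This is harmless: only non-vanishing of forms and quotients of forms of equal degree
    matter. *)
Lemma regmap_proj_point (X : funSpaceType k) (v : X -> 'rV[k]_n.+1) x :
  (forall i, regular_at x (fun y => v y ord0 i)) -> v x != 0 ->
  regmap_at (fun y => proj_point (v y)) x.
Proof.
move=> rv vx.
have vn0 : \forall y \near x, v y != 0.
  have /rV0Pn[i vi] := vx; have := regular_neq0 _ _ (rv i) vi.
  by apply: filterS => y; apply: contra_neq => ->; rewrite mxE.
have rp p : regular_at x (fun y => p.@[fun i => v y ord0 i]) by exact: regular_meval.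
have cf : {for x, continuous (fun y => proj_point (v y))}.
  move=> W; rewrite nbhsE => -[O [/zariski_openP oO Ox] OW].
  have [P [[d [p hp <-]] Px PO]] := oO _ Ox.
  have [c c0 hc] := hpolyfun_point vx.
  move: Px; rewrite (hc _ _ hp) mulf_eq0 negb_or => /andP[_ px].
  suff : \forall y \near x, W (proj_point (v y)) by [].
  have pn0 := regular_neq0 _ _ (rp p) px.
  apply: (filterS _ (filterI vn0 pn0)) => y [vy py]; apply/OW/PO.
  have [c' c'0 hc'] := hpolyfun_point vy.
  by rewrite (hc' _ _ hp) mulf_neq0 // expf_neq0.
split=> // h [P [Q [[d [[p hp <-] [q hq <-]]] Qx hPQ]]].
have [c c0 hc] := hpolyfun_point vx.
move: Qx; rewrite (hc _ _ hq) mulf_eq0 negb_or => /andP[_ qx].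
apply: regular_eq_near (regular_div (rp p) (rp q) qx).
have hf : \forall y \near x, _ := cf _ hPQ.
apply: (filterS _ (filterI vn0 hf)) => y [vy /= ->].
have [c' c'0 hc'] := hpolyfun_point vy.
by rewrite !(hc' d) // -mulf_div divff ?mul1r // expf_neq0.
Qed.

Definition acoord L (i : 'I_n.+1) : k := hcoord L ord0 i / hcoord L ord0 ord0.

Definition chart : set PP := [set L | hcoord L ord0 ord0 != 0].

Lemma homogeneous_hcoord i : homogeneous 1 (fun L => hcoord L ord0 i).
Proof.
by exists 'X_i; [rewrite /= dhomogX; apply/eqP/mdeg1|apply/funext => L; rewrite /hpolyfun mevalXU].
Qed.

Lemma chart_open : open chart.
Proof.
apply/zariski_openP => L cL; exists (fun L => hcoord L ord0 ord0); split=> //.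
by exists 1%N; exact: homogeneous_hcoord.
Qed.

Lemma regular_acoord L i : chart L -> regular_at L (acoord ^~ i).
Proof.
move=> cL; exists (fun L => hcoord L ord0 i), (fun L => hcoord L ord0 ord0).
split=> //; last by near=> y.
by exists 1%N; split; exact: homogeneous_hcoord.
Unshelve. all: by end_near. Qed.

Lemma acoord0 L : chart L -> acoord L ord0 = 1.
Proof. by move=> cL; rewrite /acoord divff. Qed.

Definition apoint (e : 'I_n.+1 -> k) : PP := proj_point (\row_i e i).

Lemma row_neq0 (e : 'I_n.+1 -> k) : e ord0 != 0 -> \row_i e i != 0.
Proof. by move=> e0; apply/rV0Pn; exists ord0; rewrite mxE. Qed.

Lemma apointK (e : 'I_n.+1 -> k) : e ord0 = 1 -> acoord (apoint e) = e.
Proof.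
move=> e0; have : e ord0 != 0 by rewrite e0 oner_neq0.
move=> /row_neq0 /hcoord_point[c c0 hc].
apply/funext => i; rewrite /acoord /apoint hc !mxE e0 mulr1.
by rewrite mulrAC divff ?mul1r.
Qed.

Lemma chart_apoint (e : 'I_n.+1 -> k) : e ord0 = 1 -> chart (apoint e).
Proof.
move=> e0; have : e ord0 != 0 by rewrite e0 oner_neq0.
move=> /row_neq0 /hcoord_point[c c0 hc].
by rewrite /chart /apoint /= hc !mxE e0 mulr1.
Qed.

Lemma acoordK L : chart L -> apoint (acoord L) = L.
Proof.
move=> cL; rewrite -[RHS]point_hcoord -(@proj_pointZ (hcoord L ord0 ord0)^-1).
  by congr proj_point; apply/rowP => i; rewrite !mxE mulrC.
by rewrite invr_eq0.
Qed.

Lemma regmap_apoint (X : funSpaceType k) (e : X -> 'I_n.+1 -> k) x :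
  (forall i, regular_at x (e ^~ i)) -> e x ord0 != 0 ->
  regmap_at (fun y => apoint (e y)) x.
Proof.
move=> re e0; apply: regmap_proj_point; last exact: row_neq0.
move=> i; apply: regular_eq_near (re i); near=> y; by rewrite mxE.
Unshelve. all: by end_near. Qed.

(* Two homogeneous polynomials that do not vanish identically have a common
   non-zero on the line joining a non-zero of each. *)
Lemma open_dense (O : set PP) : open O -> O !=set0 -> dense O.
Proof.
move=> oO [L OL] O' [M OM] oO'.
have /zariski_openP/(_ _ OL)[_ [[d [p hp <-]] pL pO]] := oO.
have /zariski_openP/(_ _ OM)[_ [[d' [q hq <-]] qM qO]] := oO'.
have [ML|LM] := eqVneq M L; first by exists M; split=> //; rewrite ML.
have [r1 hr1] := meval_poly p
  (fun i => (hcoord L ord0 i)%:P + (hcoord M ord0 i - hcoord L ord0 i) *: 'X).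
have [r2 hr2] := meval_poly q
  (fun i => (hcoord L ord0 i)%:P + (hcoord M ord0 i - hcoord L ord0 i) *: 'X).
have r10 : r1 != 0.
  apply: contraNneq pL => r10; rewrite /hpolyfun; apply/eqP.
  rewrite -[RHS](horner0 0) -r10 hr1; apply: meval_eq => i.
  by rewrite !hornerE.
have r20 : r2 != 0.
  apply: contraNneq qM => r20; rewrite /hpolyfun; apply/eqP.
  rewrite -[RHS](horner0 1) -r20 hr2; apply: meval_eq => i.
  by rewrite !hornerE /=; ring.
have /closed_nonrootP[s] : r1 * r2 != 0 by exact: mulf_neq0.
rewrite rootM negb_or /root hr1 hr2 => /andP[ps qs].
pose v := hcoord L + s *: (hcoord M - hcoord L).
have vE i : v ord0 i =
    ((hcoord L ord0 i)%:P + (hcoord M ord0 i - hcoord L ord0 i) *: 'X).[s].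
  by rewrite !hornerE /= !mxE mulrC.
(* A zero on this segment would make the coordinate vectors of [L] and [M] proportional, forcing
   [M = L]. *)
have v0 : v != 0.
  apply: contra_neq LM => v0.
  have /eqP : s *: hcoord M = (s - 1) *: hcoord L.
    apply/eqP; rewrite -subr_eq0 -v0 /v; apply/eqP/rowP => i; rewrite !mxE; ring.
  have [->|s0] := eqVneq s 0.
    by rewrite scale0r sub0r scaleN1r eq_sym oppr_eq0 (negPf (hcoord_neq0 L)).
  have [->|s1] := eqVneq s 1.
    by rewrite subrr scale0r scale1r (negPf (hcoord_neq0 M)).
  move=> /eqP h; rewrite -[LHS]point_hcoord -[RHS]point_hcoord.
  by rewrite -(proj_pointZ _ s0) h proj_pointZ // subr_eq0.
have [c c0 hc] := hpolyfun_point v0.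
exists (proj_point v); split.
  apply: qO; rewrite (hc _ _ hq) mulf_neq0 ?expf_neq0 //.
  by under meval_eq do rewrite vE.
apply: pO; rewrite (hc _ _ hp) mulf_neq0 ?expf_neq0 //.
by under meval_eq do rewrite vE.
Qed.

End ProjectivePoints.

(** * Triangular birational maps *)

Section Triangular.
Variables (k : closedFieldType) (m : nat).
Local Notation PP := (proj_space k m.+2).
Local Notation vec := ('I_m.+3 -> k).
Local Open Scope quotient_scope.

Definition i1 : 'I_m.+3 := Ordinal (isT : (1 < m.+3)%N).
Definition i2 : 'I_m.+3 := Ordinal (isT : (2 < m.+3)%N).

(* The birational map (x1, x2, x3, ...) |->
   (alpha x1 + beta, x2 P(x1) / Q(x1), x3, ...) of the chart x0 = 1. *)
Record triang := Triang {
  talpha : k; tbeta : k; tnum : {poly k}; tden : {poly k};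
  talpha_neq0 : talpha != 0; tnum_neq0 : tnum != 0; tden_neq0 : tden != 0
}.

Lemma triang_eq t t' : talpha t = talpha t' -> tbeta t = tbeta t' ->
  tnum t = tnum t' -> tden t = tden t' -> t = t'.
Proof.
case: t => a b p q ha hp hq; case: t' => a' b' p' q' ha' hp' hq' /= ea eb ep eq.
by subst; congr Triang; exact: bool_irrelevance.
Qed.

Definition tlin (a b : k) : {poly k} := a *: 'X + b%:P.

Lemma horner_tlin a b x : (tlin a b).[x] = a * x + b.
Proof. by rewrite !hornerE. Qed.

Lemma comp_tlin_neq0 (p : {poly k}) a b : a != 0 -> p != 0 -> p \Po tlin a b != 0.
Proof.
move=> a0; rewrite -!size_poly_gt0 size_comp_poly2 //.
by rewrite /tlin -mul_polyC size_MXaddC polyC_eq0 size_polyC (negPf a0).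
Qed.

Lemma comp_tlin_mul_neq0 (p q : {poly k}) a b : a != 0 -> p != 0 -> q != 0 ->
  (p \Po tlin a b) * q != 0.
Proof. by move=> a0 p0 q0; rewrite mulf_neq0 // comp_tlin_neq0. Qed.

(** The map [t] after [t']: the multiplier of [t] is taken at the image of [x1] under [t']. Common
    factors are not removed, so different data may represent the same map. *)
Definition tmul t t' : triang := Triang
  (talpha t * tbeta t' + tbeta t)
  (mulf_neq0 (talpha_neq0 t) (talpha_neq0 t'))
  (comp_tlin_mul_neq0 (tbeta t') (talpha_neq0 t') (tnum_neq0 t) (tnum_neq0 t'))
  (comp_tlin_mul_neq0 (tbeta t') (talpha_neq0 t') (tden_neq0 t) (tden_neq0 t')).

Lemma invf_neq0 (a : k) : a != 0 -> a^-1 != 0.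
Proof. by rewrite invr_eq0. Qed.

Definition tinv t : triang := Triang
  (- tbeta t / talpha t)
  (invf_neq0 (talpha_neq0 t))
  (comp_tlin_neq0 (- tbeta t / talpha t) (invf_neq0 (talpha_neq0 t)) (tden_neq0 t))
  (comp_tlin_neq0 (- tbeta t / talpha t) (invf_neq0 (talpha_neq0 t)) (tnum_neq0 t)).

Lemma comp_tlin_comp (p : {poly k}) a b a' b' :
  (p \Po tlin a b) \Po tlin a' b' = p \Po tlin (a * a') (a * b' + b).
Proof.
rewrite -comp_polyA; congr (_ \Po _).
rewrite /tlin comp_polyD comp_polyZ comp_polyX comp_polyC.
by rewrite scalerDr scalerA -addrA polyCD polyCM mul_polyC.
Qed.

Lemma comp_tlin1 (p : {poly k}) : p \Po tlin 1 0 = p.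
Proof. by rewrite /tlin scale1r addr0 comp_polyXr. Qed.

Lemma tinvK t : tinv (tinv t) = t.
Proof.
have a0 := talpha_neq0 t.
apply: triang_eq => /=; first exact: invrK.
- by field; rewrite a0 oner_neq0.
- rewrite comp_tlin_comp -[RHS]comp_tlin1.
  by congr (_ \Po tlin _ _); field; rewrite ?a0 ?oner_neq0.
- rewrite comp_tlin_comp -[RHS]comp_tlin1.
  by congr (_ \Po tlin _ _); field; rewrite ?a0 ?oner_neq0.
Qed.

Definition tcoord t (e : vec) : vec := fun i =>
  match val i with
  | 1 => talpha t * e i + tbeta t
  | 2 => e i * (tnum t).[e i1] / (tden t).[e i1]
  | _ => e i
  end.

(** Equations of the graph with the denominator cleared: being polynomial in both points, they stay
    regular at the poles of the fraction. *)
Definition trelfun t (e e' : vec) : vec := fun i =>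
  match val i with
  | 1 => e' i - (talpha t * e i + tbeta t)
  | 2 => e' i * (tden t).[e i1] - e i * (tnum t).[e i1]
  | _ => e' i - e i
  end.

Definition trel t e e' : Prop := forall i, trelfun t e e' i = 0.

(** The zeros of the numerator are removed as well, so that [tmap (tinv t)] inverts [tmap t] on what
    remains. *)
Definition tdom t : set PP :=
  [set x | chart x /\ (tnum t * tden t).[acoord x i1] != 0].

Definition tmap t (x : PP) : PP := apoint (tcoord t (acoord x)).

Lemma tcoord0 t (e : vec) : tcoord t e ord0 = e ord0.
Proof. by []. Qed.

Lemma tcoord1 t (e : vec) : tcoord t e i1 = talpha t * e i1 + tbeta t.
Proof. by []. Qed.

Lemma trel_tcoord t e : (tden t).[e i1] != 0 -> trel t e (tcoord t e).
Proof.
move=> q0 [[|[|[|j]]] hj]; rewrite /trelfun /tcoord /= ?subrr //.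
by rewrite divfK // subrr.
Qed.

Lemma trelE t e e' : (tden t).[e i1] != 0 -> trel t e e' -> e' = tcoord t e.
Proof.
move=> q0 h; apply/funext => i; have := h i; rewrite /trelfun /tcoord.
case: (val i) => [|[|[|j]]] /eqP; rewrite subr_eq0 => /eqP // <-.
by rewrite mulfK.
Qed.

Lemma tdomN t x : tdom t x ->
  [/\ chart x, (tnum t).[acoord x i1] != 0 & (tden t).[acoord x i1] != 0].
Proof. by rewrite /tdom /= hornerM mulf_eq0 negb_or => -[? /andP[]]. Qed.

Lemma acoord_tmap t x : tdom t x -> acoord (tmap t x) = tcoord t (acoord x).
Proof. by move=> [cx _]; rewrite apointK // tcoord0 acoord0. Qed.

Lemma chart_tmap t x : tdom t x -> chart (tmap t x).
Proof. by move=> [cx _]; apply: chart_apoint; rewrite tcoord0 acoord0. Qed.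

Lemma tinv_lin t x :
  talpha (tinv t) * (talpha t * x + tbeta t) + tbeta (tinv t) = x.
Proof. by have := talpha_neq0 t => a0 /=; field. Qed.

Lemma tdom_tmap t x : tdom t x -> tdom (tinv t) (tmap t x).
Proof.
move=> dx; split; first exact: chart_tmap.
have [_ p0 q0] := tdomN dx.
rewrite acoord_tmap // tcoord1 hornerM [tnum _]/= [tden _]/= !horner_comp !horner_tlin.
by rewrite tinv_lin mulf_neq0.
Qed.

Lemma tmapK t x : tdom t x -> tmap (tinv t) (tmap t x) = x.
Proof.
move=> dx; have [cx p0 q0] := tdomN dx.
rewrite -[RHS]acoordK // {1}/tmap acoord_tmap //; congr apoint.
have a0 := talpha_neq0 t.
apply/funext => -[[|[|[|j]]] hj] //; rewrite /tcoord /=; first by field.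
have -> : Ordinal hj = i2 by exact/val_inj.
rewrite !horner_comp !horner_tlin.
have -> : (talpha t)^-1 * (talpha t * acoord x i1 + tbeta t) + - tbeta t / talpha t
  = acoord x i1 by field.
by field; rewrite p0.
Qed.

Section Families.

(** Regular dependence of the polynomials on [z] is expressed by their values at regular functions,
    which avoids bounding degrees and naming coefficients. *)
Definition triang_at (Y : funSpaceType k) (y : Y) (T : Y -> triang) : Prop :=
  [/\ regular_at y (fun z => talpha (T z)), regular_at y (fun z => tbeta (T z)) &
      forall g, regular_at y g ->
        regular_at y (fun z => (tnum (T z)).[g z]) /\
        regular_at y (fun z => (tden (T z)).[g z])].

(** Quantifying over all base changes [r] builds stability under pullback into the definition. *)
Definition triang_family (A : funSpaceType k) (tau : A -> triang) : Prop :=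
  forall (Y : funSpaceType k) (y : Y) (r : Y -> A),
    regmap_at r y -> triang_at y (tau \o r).

Lemma triang_at_cst (Y : funSpaceType k) (y : Y) t : triang_at y (fun=> t).
Proof.
split; [exact: regular_cst|exact: regular_cst|].
by move=> g rg; split; exact: regular_horner.
Qed.

Lemma triang_at_tinv (Y : funSpaceType k) (y : Y) T :
  triang_at y T -> triang_at y (tinv \o T).
Proof.
move=> [ra rb rpq].
have ra' : regular_at y (fun z => (talpha (T z))^-1).
  by apply: regularV => //; exact: talpha_neq0.
have rb' : regular_at y (fun z => - tbeta (T z) / talpha (T z)).
  by apply: regularM => //; exact: regularN.
split=> // g rg /=.
have /rpq [rp rq] : regular_at y
    (fun z => (tlin (talpha (T z))^-1 (- tbeta (T z) / talpha (T z))).[g z]).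
  under eq_fun do rewrite horner_tlin.
  by apply: regularD => //; exact: regularM.
by split; under eq_fun do rewrite horner_comp.
Qed.

Lemma triang_family_tinv (A : funSpaceType k) (tau : A -> triang) :
  triang_family tau -> triang_family (tinv \o tau).
Proof. by move=> ft Y y r /ft /triang_at_tinv. Qed.

Section At.
Variables (Y : funSpaceType k) (y : Y) (T : Y -> triang).
Hypothesis rT : triang_at y T.

Lemma regular_tcoord (e : Y -> vec) :
  (tden (T y)).[e y i1] != 0 -> (forall i, regular_at y (e ^~ i)) ->
  forall i, regular_at y (fun z => tcoord (T z) (e z) i).
Proof.
case: rT => ra rb rpq q0 re i; have [rp rq] := rpq _ (re i1).
rewrite /tcoord; case: (val i) => [|[|[|j]]] //.
  by apply: regularD => //; exact: regularM.
by apply: regular_div => //; exact: regularM.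
Qed.

Lemma regular_trelfun (e e' : Y -> vec) :
  (forall i, regular_at y (e ^~ i)) -> (forall i, regular_at y (e' ^~ i)) ->
  forall i, regular_at y (fun z => trelfun (T z) (e z) (e' z) i).
Proof.
case: rT => ra rb rpq re re' i; have [rp rq] := rpq _ (re i1).
rewrite /trelfun; case: (val i) => [|[|[|j]]]; try exact: regularB.
  by apply: regularB => //; apply: regularD => //; exact: regularM.
by apply: regularB; exact: regularM.
Qed.

Variable x : Y -> PP.
Hypothesis rx : regmap_at x y.

Lemma regular_acoord_comp i : chart (x y) -> regular_at y (fun z => acoord (x z) i).
Proof. move=> cx; have [_ h] := rx; exact: (h (fun L => acoord L i) (regular_acoord i cx)). Qed.

Lemma near_chart : chart (x y) -> \forall z \near y, chart (x z).
Proof.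
move=> cx; have nc : nbhs (x y) (@chart k m.+2).
  by apply: open_nbhs_nbhs; split=> //; exact: chart_open.
exact: regmap_nbhs rx nc.
Qed.

Hypothesis dx : tdom (T y) (x y).

Lemma near_tdom : \forall z \near y, tdom (T z) (x z).
Proof.
have [cx pq] := dx; case: rT => _ _ /(_ _ (regular_acoord_comp i1 cx))[rp rq].
have pq' : (fun z => (tnum (T z)).[acoord (x z) i1] *
                     (tden (T z)).[acoord (x z) i1]) y != 0.
  by rewrite -hornerM.
have := regular_neq0 _ _ (regularM _ _ _ rp rq) pq'.
move=> nz; apply: (filterS _ (filterI (near_chart cx) nz)) => z [cz pz].
by split=> //; rewrite hornerM.
Qed.

Lemma regmap_tmap : regmap_at (fun z => tmap (T z) (x z)) y.
Proof.
have [cx _ q0] := tdomN dx; apply: regmap_apoint.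
  by apply: regular_tcoord => // i; exact: regular_acoord_comp.
by rewrite tcoord0 acoord0 // oner_neq0.
Qed.

End At.

Lemma tdom_open t : open (tdom t).
Proof.
rewrite openE => x dx; apply: (@near_tdom _ x (fun=> t) _ id) => //.
  exact: triang_at_cst.
exact: regmap_id.
Qed.

Lemma tdom_nonempty t : tdom t !=set0.
Proof.
have /closed_nonrootP[s hs] : tnum t * tden t != 0.
  by rewrite mulf_neq0 ?tnum_neq0 ?tden_neq0.
exists (apoint (fun i => if val i == 0%N then 1 else s)).
by split; [exact: chart_apoint|rewrite apointK].
Qed.

Lemma tdom_dense t : dense (tdom t).
Proof. by apply: open_dense; [exact: tdom_open|exact: tdom_nonempty]. Qed.

Lemma tmap_reg t : regmap_on (tdom t) (tmap t).
Proof.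
move=> x dx; apply: (@regmap_tmap _ x (fun=> t) _ id) => //.
  exact: triang_at_cst.
exact: regmap_id.
Qed.

Lemma tmap_iso t : open_iso (tdom t) (tdom (tinv t)) (tmap t) (tmap (tinv t)).
Proof.
split.
- exact: tdom_open.
- exact: tdom_open.
- exact: tdom_tmap.
- by move=> y /tdom_tmap; rewrite tinvK.
- exact: tmapK.
- by move=> y /tmapK; rewrite tinvK.
- exact: tmap_reg.
- exact: tmap_reg.
Qed.

Definition trep t : birep PP := BiRep (tmap_iso t) (@tdom_dense t) (@tdom_dense (tinv t)).

Definition tri t : Bir PP := \pi_(Bir PP) (trep t).

Definition fmap (A : Type) (tau : A -> triang) (p : vprod A PP) : vprod A PP :=
  (p.1, tmap (tau p.1) p.2).
Definition fdom (A : Type) (tau : A -> triang) : set (vprod A PP) :=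
  [set p | tdom (tau p.1) p.2].

Lemma fdom_open (A : funSpaceType k) (tau : A -> triang) :
  triang_family tau -> open (fdom tau).
Proof.
move=> ft; rewrite openE => p dp.
apply: (@near_tdom _ p (tau \o fst) _ snd) => //.
  by apply: ft; exact: regmap_fst.
exact: regmap_snd.
Qed.

Lemma fmap_reg (A : funSpaceType k) (tau : A -> triang) :
  triang_family tau -> regmap_on (fdom tau) (fmap tau).
Proof.
move=> ft p dp; apply: regmap_pair; first exact: regmap_fst.
apply: (@regmap_tmap _ p (tau \o fst) _ snd) => //.
  by apply: ft; exact: regmap_fst.
exact: regmap_snd.
Qed.

Lemma fdom_proj (A : Type) (tau : A -> triang) : [set p.1 | p in fdom tau] = setT.
Proof.
apply/seteqP; split=> // a _; have [x dx] := tdom_nonempty (tau a).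
by exists (a, x).
Qed.

Lemma bir_morphism_tri (A : funSpaceType k) (tau : A -> triang) :
  triang_family tau -> bir_morphism (tri \o tau).
Proof.
move=> ft; have ft' := triang_family_tinv ft.
exists (fdom tau), (fdom (tinv \o tau)), (fmap tau), (fmap (tinv \o tau)); split=> //.
- split.
  + exact: fdom_open.
  + exact: fdom_open.
  + by move=> p /tdom_tmap.
  + by move=> p /tdom_tmap; rewrite /fdom /= tinvK.
  + by move=> [a x] /= dx; rewrite /fmap /= tmapK.
  + by move=> [a x] /= /tmapK; rewrite /fmap /= tinvK => ->.
  + exact: fmap_reg.
  + exact: fmap_reg.
- by split; exact: fdom_proj.
- by move=> a; exists (trep (tau a)).
Qed.

End Families.

Definition cdom (f : birep PP) : set PP :=
  (bdom f `&` bfun f @^-1` @chart k m.+2) `&` @chart k m.+2.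

Lemma chart_dense : dense (@chart k m.+2).
Proof.
apply: open_dense; first exact: chart_open.
by exists (apoint (fun=> 1)); exact: chart_apoint.
Qed.

Lemma cdom_open_dense (f : birep PP) : open (cdom f) /\ dense (cdom f).
Proof.
have [oD dD] := birep_preimage f (@chart_open k m.+2) chart_dense.
split; first by apply: openI => //; exact: chart_open.
exact: denseI chart_dense.
Qed.

(** The cleared equations are regular on [cdom f], so they extend to it from the dense set where
    both maps agree; conversely, on [tdom t] they determine the image. Hence a single point of
    [cdom f] can refute an equality in [Bir]. *)
Lemma triP (f : birep PP) t : \pi_(Bir PP) f = tri t <->
  forall x, cdom f x -> trel t (acoord x) (acoord (bfun f x)).
Proof.
have [oD dD] := cdom_open_dense f.
rewrite bir_eqP; split=> [[W [oW dW sW fW]] x Dx i|h].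
  apply: (@regular_eq_dense _ _ _ _ (fun x => trelfun t (acoord x) (acoord (bfun f x)) i)
    (fun=> 0) oD dW) => // {Dx}x.
  - move=> [[Dx cfx] cx]; apply: (regular_trelfun (triang_at_cst x t)) => j.
      exact: regular_acoord.
    apply: regular_acoord_comp => //; exact: open_iso_reg (birep_iso f) _ Dx.
  - by move=> _; exact: regular_cst.
  - move=> [[Dx cfx] cx] Wx; have [_ /= tx] := sW _ Wx.
    rewrite fW //= acoord_tmap //.
    by apply: trel_tcoord; have [] := tdomN tx.
exists (cdom f `&` tdom t); split.
- by apply: openI => //; exact: tdom_open.
- by apply: denseI => //; exact: tdom_dense.
- by move=> x [[[]]].
- move=> x [Dx tx]; have [cx _ q0] := tdomN tx; have [[_ cfx] _] := Dx.
  rewrite -[LHS]acoordK //= /tmap; congr apoint; apply: trelE => //; exact: h.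
Qed.

Lemma tri_mul t t' : tri (tmul t t') = (tri t * tri t')%g.
Proof.
symmetry; rewrite /tri [LHS]bir_mulE; apply/triP => x [[[dx dx'] _] _].
have [_ p0 q0] := tdomN dx; have [_ p0' q0'] := tdomN dx'.
move: p0' q0'; rewrite /= !acoord_tmap // !tcoord1 => p0' q0'.
rewrite /trel => -[[|[|[|j]]] hj]; rewrite /trelfun /= /tcoord /= ?subrr //.
  by ring.
rewrite !hornerM !horner_comp !horner_tlin.
by field; rewrite q0'.
Qed.

End Triangular.

(** * Recovering the parameter of a triangular map *)

Section Recovery.
Variables (k : closedFieldType) (m : nat).
Local Notation PP := (proj_space k m.+2).
Local Notation vec := ('I_m.+3 -> k).
Local Notation triang := (triang k).
Local Open Scope quotient_scope.

(** Representatives are chosen for each [a] separately, yet evaluation stays regular in [(a, x)]: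
    all of them are slices of the one isomorphism [F], whose domain is open. *)
Lemma bir_morphism_birep (A : funSpaceType k) (rho : A -> Bir PP) :
  bir_morphism rho -> exists f : A -> birep PP,
    (forall a, \pi_(Bir PP) (f a) = rho a) /\
    forall p : vprod A PP, cdom (f p.1) p.2 ->
      regmap_at (fun q : vprod A PP => bfun (f q.1) q.2) p /\
      \forall q \near p, cdom (f q.1) q.2.
Proof.
move=> [V1 [V2 [F [G [iso Fst _ hr]]]]]; have [f hf] := choice hr.
exists f; split=> [a|p [[Dp cfp] cp]]; first by have [] := hf a.
have [a [x ap]] : exists a x, p = (a, x) by case: p {Dp cfp cp} => a x; exists a, x.
have V1E q : bdom (f q.1) q.2 <-> V1 q by have [_ -> _] := hf q.1; case: q.
have fE q : V1 q -> bfun (f q.1) q.2 = (F q).2.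
  by case: q => b y Vq; have [_ _ ->] := hf b.
have nV : \forall q \near p, V1 q.
  by apply: open_nbhs_nbhs; split; [exact: open_iso_dom iso|exact/V1E].
have rf : regmap_at (fun q : vprod A PP => bfun (f q.1) q.2) p.
  apply: (@regmap_near _ _ _ (fun q => (F q).2)).
    by apply: (filterS _ nV) => q /fE.
  apply: (regmap_comp (g := F)); last exact: regmap_snd.
  by apply: open_iso_reg iso _ _; exact/V1E.
split=> //; have nc := near_chart (regmap_snd p) cp.
have nfc := near_chart rf cfp.
by apply: (filterS _ (filterI nV (filterI nfc nc))) => q [/V1E Dq [cfq cq]].
Qed.

(** Non-vanishing conditions for the recovery formulas, which divide by [x1] or [x2]; with [c] the
    translation part, the last condition keeps a recovered scale factor nonzero. *)
Definition good (c : k) (e e' : vec) : Prop :=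
  [/\ e (i1 m) != 0, e (i2 m) != 0 & e' (i1 m) != c].

(* A single generic point x and its image determine the parameter b of the
   transformation tri (tau b), and they do so regularly. *)
Definition recoverable (B : funSpaceType k) (tau : B -> triang) : Prop :=
  exists c (rec : vec -> vec -> B),
    (forall b e e', trel (tau b) e e' -> good c e e' -> rec e e' = b) /\
    (forall (A : funSpaceType k) (a : A) e (e' : A -> vec),
      (forall i, regular_at a (e' ^~ i)) -> good c e (e' a) ->
      regmap_at (fun z => rec e (e' z)) a).

Lemma acoord_neq_open_dense (i : 'I_m.+3) (c : k) : i != ord0 ->
  open ([set x : PP | chart x /\ acoord x i != c]) /\
  dense ([set x : PP | chart x /\ acoord x i != c]).
Proof.
move=> i0; have oW : open ([set x : PP | chart x /\ acoord x i != c]).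
  rewrite openE => x [cx xc].
  have nc := near_chart (regmap_id x) cx.
  have nx := regular_near_neq (regular_acoord i cx) (regular_cst x c) xc.
  exact: filterI nc nx.
split=> //; apply: open_dense oW _.
exists (apoint (fun j => if j == ord0 then 1 else c + 1)).
rewrite /= apointK ?eqxx // (negPf i0) -subr_eq0 addrAC subrr add0r oner_neq0.
by split=> //; apply: chart_apoint; rewrite eqxx.
Qed.

Lemma good_point (f : birep PP) c :
  exists2 x, cdom f x & good c (acoord x) (acoord (bfun f x)).
Proof.
have [oD dD] := cdom_open_dense f.
have [o1 d1] := @acoord_neq_open_dense (i1 m) 0 isT.
have [o2 d2] := @acoord_neq_open_dense (i2 m) 0 isT.
have [oc dc] := @acoord_neq_open_dense (i1 m) c isT.
have [oF dF] := birep_preimage f oc dc.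
have [x []] : cdom f `&` (([set x | chart x /\ acoord x (i1 m) != 0]
    `&` [set x | chart x /\ acoord x (i2 m) != 0])
    `&` (bdom f `&` bfun f @^-1` [set x | chart x /\ acoord x (i1 m) != c])) !=set0.
  have dI : dense (([set x : PP | chart x /\ acoord x (i1 m) != 0]
    `&` [set x | chart x /\ acoord x (i2 m) != 0])
    `&` (bdom f `&` bfun f @^-1` [set x | chart x /\ acoord x (i1 m) != c])).
    by apply: denseI => //; [exact: openI|exact: denseI].
  apply: dI => //; have [x [_ ?]] := dD setT (ex_intro _ (apoint (fun=> 1)) I) openT.
  by exists x.
by move=> Dx [[[_ x1] [_ x2]] [_ [_ xc]]]; exists x.
Qed.

Lemma near_good (A : funSpaceType k) (a : A) c e (e' : A -> vec) :
  regular_at a (e' ^~ (i1 m)) -> good c e (e' a) ->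
  \forall z \near a, good c e (e' z).
Proof.
move=> re [e1 e2 ec].
have := regular_near_neq re (regular_cst a c) ec.
by move=> n; apply: (filterS _ n) => z.
Qed.

Section Family.
Variables (B : funSpaceType k) (tau : B -> triang).
Hypotheses (tauF : triang_family tau) (tauR : recoverable tau).

Lemma tri_family_inj : injective (tri m \o tau).
Proof.
have [c [rec [h _]]] := tauR.
move=> b b' /= bb'; have [x Dx gx] := good_point (trep m (tau b)) c.
have /triP/(_ _ Dx) e := erefl (tri m (tau b)).
have : \pi_(Bir PP) (trep m (tau b)) = tri m (tau b') by rewrite -bb'.
move=> /triP/(_ _ Dx) e'.
by rewrite -(h _ _ _ e gx) (h _ _ _ e' gx).
Qed.

Section Point.
Variables (A : funSpaceType k) (f : A -> birep PP) (a0 : A) (x : PP).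
Hypothesis hf : forall p : vprod A PP, cdom (f p.1) p.2 ->
  regmap_at (fun q : vprod A PP => bfun (f q.1) q.2) p /\
  \forall q \near p, cdom (f q.1) q.2.
Hypothesis Dx : cdom (f a0) x.

Lemma regular_orbit i : regular_at a0 (fun a => acoord (bfun (f a) x) i).
Proof.
have [rf _] := hf (p := (a0, x)) Dx; have [[_ cfx] _] := Dx.
apply: regular_acoord_comp => //.
exact: (regmap_comp (regmap_slicel a0 x) rf).
Qed.

Lemma near_cdom : \forall a \near a0, cdom (f a) x.
Proof.
have [_ nD] := hf (p := (a0, x)) Dx.
exact: regmap_nbhs (regmap_slicel a0 x) nD.
Qed.

End Point.

(** Openness of the complement at [a0]: a good point [x0] yields a candidate [b a], regular near
    [a0], and [rho a] can be in the image only with parameter [b a]. If [rho a0] is not in the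
    image, either [b a0] is outside the closed set [Z], or some point [x1] violates the equations
    for [b a0]; both persist near [a0]. *)
Lemma closed_tri_image (Z : set B) : closed Z -> closed ((tri m \o tau) @` Z).
Proof.
move=> cZ; have [c [rec [hrec rrec]]] := tauR.
apply/bir_closedP => A rho _ _ mrho; rewrite -openC openE => a0 Na0.
have [f [fE hf]] := bir_morphism_birep mrho.
have [x0 Dx0 gx0] := good_point (f a0) c.
pose b a := rec (acoord x0) (acoord (bfun (f a) x0)).
have rb : regmap_at b a0.
  apply: rrec => // i; exact: regular_orbit.
have hb a b' : cdom (f a) x0 -> good c (acoord x0) (acoord (bfun (f a) x0)) ->
    rho a = tri m (tau b') -> b' = b a.
  by move=> Da ga; rewrite -fE => /triP/(_ _ Da)/hrec/(_ ga).
have nD := near_cdom hf Dx0.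
have ng : \forall a \near a0, good c (acoord x0) (acoord (bfun (f a) x0)).
  by apply: (near_good (e' := fun a => acoord (bfun (f a) x0))) => //; exact: regular_orbit.
have [Zb|NZb] := pselect (Z (b a0)); last first.
  have nZ : \forall a \near a0, ~ Z (b a).
    apply: (regmap_nbhs (W := ~` Z) rb); apply: open_nbhs_nbhs; split=> //.
    exact: closed_openC.
  apply: (filterS _ (filterI nD (filterI ng nZ))) => a [Da [ga NZa]] /= [b' Zb' /= e].
  by apply: NZa; rewrite -(hb _ _ Da ga (esym e)).
have /existsNP[x1 /not_implyP[Dx1 /existsNP[i /eqP ri]]] :
    ~ forall x, cdom (f a0) x -> trel (tau (b a0)) (acoord x) (acoord (bfun (f a0) x)).
  by move=> /triP e; apply: Na0; exists (b a0) => //=; rewrite -fE e.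
have nD1 := near_cdom hf Dx1.
have rr : regular_at a0 (fun a => trelfun (tau (b a)) (acoord x1) (acoord (bfun (f a) x1)) i).
  apply: (regular_trelfun (tauF rb) (e := fun=> acoord x1)).
    by move=> j; exact: regular_cst.
  by move=> j; exact: regular_orbit.
have nr := regular_neq0 _ _ rr ri.
apply: (filterS _ (filterI nD (filterI ng (filterI nD1 nr)))).
move=> a [Da [ga [Da1 /eqP ra]]] /= [b' Zb' /= e]; apply: ra.
rewrite -(hb _ _ Da ga (esym e)).
by move: e; rewrite -fE => /esym /triP/(_ _ Da1).
Qed.

(** Near [a0] the map [rho] coincides with the recovery formula at one fixed point. This supplies
    the harder direction of the last condition in [algebraic_structure]. *)
Lemma regmap_of_bir_morphism (A : funSpaceType k) (rho : A -> B) :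
  bir_morphism (tri m \o tau \o rho) -> regmap_on setT rho.
Proof.
move=> mrho a0 _; have [c [rec [hrec rrec]]] := tauR.
have [f [fE hf]] := bir_morphism_birep mrho.
have [x0 Dx0 gx0] := good_point (f a0) c.
have rb : regmap_at (fun a => rec (acoord x0) (acoord (bfun (f a) x0))) a0.
  apply: rrec => // i; exact: regular_orbit.
apply: regmap_near rb.
have nD := near_cdom hf Dx0.
have ng : \forall a \near a0, good c (acoord x0) (acoord (bfun (f a) x0)).
  by apply: (near_good (e' := fun a => acoord (bfun (f a) x0))) => //; exact: regular_orbit.
apply: (filterS _ (filterI nD ng)) => a [Da ga].
by have /triP/(_ _ Da)/hrec/(_ ga) := fE a.
Qed.

Lemma triang_family_comp (A : funSpaceType k) (rho : A -> B) :
  regmap_on setT rho -> triang_family (tau \o rho).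
Proof.
move=> rrho Y y r rr.
exact: (tauF (regmap_comp rr (rrho _ I))).
Qed.

End Family.

Lemma tri_algebraic_structure (H : funGroupType k) (tau : H -> triang) :
  algebraic_group H -> triang_family tau -> recoverable tau ->
  (forall x y : H, tri m (tau (x * y)%g) = (tri m (tau x) * tri m (tau y))%g) ->
  algebraic_subgroup (range (tri m \o tau)) /\
  algebraic_structure (range (tri m \o tau)) (tri m \o tau).
Proof.
move=> aH tF tR tM; split.
  exists H, (tri m \o tau); split=> // A _.
  apply: (@bir_morphism_tri k m _ (fun a : A => tau (val a))).
  by apply: (triang_family_comp tF) => a _; exact: regmap_val.
split=> //; first exact: tri_family_inj.
move=> A _ _ rho; split=> [rrho|]; last exact: regmap_of_bir_morphism.
by apply: (@bir_morphism_tri k m _ (tau \o rho)); exact: triang_family_comp.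
Qed.

End Recovery.

(** * Noetherian induction and irreducible components *)

Section Noetherian.
Import Order.TTheory.

(** [g N] is an index beyond [N] where [v] takes its minimum on the tail; iterating [g] past the
    previous index gives the subsequence. *)
Lemma increasing_subsequence (v : nat -> nat) : exists phi : nat -> nat,
  {homo phi : i j / (i < j)%N} /\ {homo v \o phi : i j / (i <= j)%N}.
Proof.
have hg N : exists i, (N <= i)%N /\ forall j, (N <= j)%N -> (v i <= v j)%N.
  have ex : exists w, `[< exists2 i, (N <= i)%N & v i = w >].
    by exists (v N); apply/asboolP; exists N.
  case: (ex_minnP ex) => w /asboolP[i' Ni' <-] hmin.
  by exists i'; split=> // j Nj; apply: hmin; apply/asboolP; exists j.
have [g hg'] := choice hg.
pose phi := fix phi n := if n is n'.+1 then g (phi n').+1 else g 0%N.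
have phiS n : (phi n < phi n.+1)%N by have [] := hg' (phi n).+1.
exists phi; split; first exact: (homo_ltn ltn_trans).
apply: homo_leq => //; first exact: leq_trans.
case=> [|n] /=; first by have [_ h] := hg' 0%N; exact: h.
have [_] := hg' (phi n).+1; apply.
have [h _] := hg' (g (phi n).+1).+1; apply: ltnW; apply: leq_trans h.
by rewrite ltnS; have [] := hg' (phi n).+1.
Qed.

(** Subsequences are extracted for one exponent after the other, until all exponents are
    non-decreasing. *)
Lemma dickson n (u : nat -> 'X_{1..n}) :
  exists i j, (i < j)%N /\ (u i <= u j)%MM.
Proof.
have [phi [hphi hu]] : exists phi : nat -> nat,
    {homo phi : i j / (i < j)%N} /\
    forall c, c \in enum 'I_n -> {homo (fun i => u (phi i) c) : i j / (i <= j)%N}.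
  elim: (enum 'I_n) => [|c s [phi [hphi IH]]]; first by
    exists id; split=> [i j|c]; rewrite ?in_nil.
  have [psi [hpsi hc]] := increasing_subsequence (fun i => u (phi i) c).
  exists (phi \o psi); split=> [i j /hpsi /hphi //|c'].
  rewrite inE => /predU1P[->//|/IH h] i j ij; apply: h.
  by move: ij; rewrite leq_eqVlt => /predU1P[->//|/hpsi /ltnW].
exists (phi 0%N), (phi 1%N); split; first exact: hphi.
by apply/mnm_lepP => c; apply: hu => //; rewrite mem_enum.
Qed.

Lemma mlead_minimal (k : fieldType) n (S : set {mpoly k[n]}) : S !=set0 ->
  exists2 p, S p & forall q, S q -> ~~ (mlead q < mlead p)%O.
Proof.
move=> [p0 Sp0]; apply: contrapT => h.
suff : forall p, ~ S p by move/(_ p0).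
elim/mleadrect => p IH Sp; apply: h; exists p => // q Sq.
by apply/negP => /IH.
Qed.

Variables (k : fieldType) (n : nat).
Local Notation AA := (affine_space k n).

(** Hilbert's basis theorem in the style of Groebner bases. [f i] vanishes on [Z i.+1] but not on
    [Z i] and has minimal leading monomial. By Dickson's lemma [mlead (f i)] divides [mlead (f j)]
    for some [i < j]; subtracting a multiple of [f i], which vanishes on [Z j], contradicts the
    minimality of [f j]. *)
Lemma affine_noetherian (Z : nat -> set AA) : (forall i, closed (Z i)) ->
  (forall i, Z i.+1 `<` Z i) -> False.
Proof.
move=> cZ dZ.
have Zle i j : (i <= j)%N -> Z j `<=` Z i.
  elim: j => [|j IH]; first by rewrite leqn0 => /eqP ->.
  rewrite leq_eqVlt => /predU1P[->//|/IH ij]; apply: subset_trans ij.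
  by have [] := dZ j.
pose I i : set {mpoly k[n]} := [set p | forall z, Z i z -> polyfun p z = 0].
have hS i : (I i.+1 `\` I i) !=set0.
  have [_ /existsNP[z /not_implyP[zi zi1]]] := dZ i.
  have := closed_openC (cZ i.+1); move=> /zariski_openP/(_ _ zi1)[_ [[p _ <-] pz pZ]].
  exists p; split=> [y Zy|/(_ _ zi)]; last exact/eqP.
  by apply/eqP; apply/negPn/negP => /pZ.
have /choice[f hf] : forall i, exists p, (I i.+1 `\` I i) p /\
    forall q, (I i.+1 `\` I i) q -> ~~ (mlead q < mlead p)%O.
  by move=> i; have [p Sp hp] := mlead_minimal (hS i); exists p.
have [i [j [ij lij]]] := dickson (fun i => mlead (f i)).
have [[fi1 fi] _] := hf i; have [[fj1 fj] hj] := hf j.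
have f0 p l : ~ I l p -> p != 0.
  move=> Np; apply/eqP => p0; apply: Np => z _; rewrite p0.
  exact: meval0.
have fi0 := f0 _ _ fi; have fj0 := f0 _ _ fj.
pose c := mleadc (f j) / mleadc (f i).
have ci0 : mleadc (f i) != 0 by rewrite mleadc_eq0.
have c0 : c != 0 by rewrite mulf_neq0 ?invr_eq0 ?mleadc_eq0.
pose h := c *: ('X_[mlead (f j) - mlead (f i)] * f i).
have X0 : 'X_[mlead (f j) - mlead (f i)] != 0 :> {mpoly k[n]}.
  by rewrite -mleadc_eq0 mleadXm mcoeffX eqxx oner_neq0.
pose g := f j - h.
have hI z : Z j z -> polyfun h z = 0.
  by move=> /(Zle _ _ ij)/fi1; rewrite /polyfun mevalZ mevalM => ->; rewrite !mulr0.
have gS : (I j.+1 `\` I j) g.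
  split=> [z Zz|Ig].
    rewrite /polyfun mevalB -/(polyfun _ _) fj1 // -/(polyfun _ _) hI ?subr0 //.
    exact: Zle Zz.
  apply: fj => z Zz; have := Ig z Zz; rewrite /polyfun mevalB -!/(polyfun _ _).
  by rewrite hI // subr0.
have hl : mlead h = mlead (f j).
  by rewrite mleadZ // mleadM // mleadXm submK.
have /negP := hj _ gS; apply; rewrite lt_neqAle.
have g0 : g != 0 by case: gS => _ /f0.
apply/andP; split.
  apply: contraNneq g0 => gl; rewrite -mleadc_eq0 gl mcoeffB -{2}hl /h mleadcZE.
  rewrite mleadM // mleadcM mleadXm mcoeffX eqxx mul1r /c divfK // subrr //.
by have := mleadB_le (f j) h; rewrite hl joinxx.
Qed.

Lemma noetherian_ind (P : set AA -> Prop) :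
  (forall C, closed C -> (forall C', closed C' -> C' `<` C -> P C') -> P C) ->
  forall C, closed C -> P C.
Proof.
move=> IH C cC; apply: contrapT => NC.
have /choice[next hnext] : forall C, exists C', closed C -> ~ P C ->
    [/\ closed C', ~ P C' & C' `<` C].
  move=> {NC cC}C; case: (pselect (closed C /\ ~ P C)) => [[cC NC]|h]; last first.
    by exists set0 => cC NC; case: h.
  apply: contrapT => h; apply/NC/IH => // C' cC' CC'; apply: contrapT => NC'.
  by apply: h; exists C'.
have hZ i : closed (iter i next C) /\ ~ P (iter i next C).
  by elim: i => [//|i [ci Ni]] /=; have [] := hnext _ ci Ni.
apply: (@affine_noetherian (fun i => iter i next C)) => i.
  by have [] := hZ i.
by have [ci Ni] := hZ i; have [] := hnext _ ci Ni.
Qed.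

End Noetherian.

(** Zorn's lemma for the sets whose union with [Z] is irreducible; adding [Z] takes care of the
    empty chain. In a chain, if one member is not inside [C], neither is any larger one, so all
    members lie in [D]. *)
Lemma irreducible_sub_component (T : topologicalType) (Z : set T) :
  irreducible Z -> exists2 A, irreducible_component A & Z `<=` A.
Proof.
move=> iZ; pose P := [set A | irreducible (Z `|` A)].
have [F FP Ftot|A [PA Amax]] := @Zorn_bigcup T P.
  split; first by have [[z Zz] _] := iZ; exists z; left.
  move=> C D cC cD CD.
  have ZC X : F X -> Z `|` X `<=` C \/ Z `|` X `<=` D.
    move=> FX; have [_ iX] := FP X FX; apply: iX => //.
    by apply: subset_trans CD; apply: setUS; exact: bigcup_sup.
  have [_ iZ'] := iZ.
  have [allC|/existsNP[X /not_implyP[FX NX]]] :=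
    pselect (forall X, F X -> Z `|` X `<=` C).
    have [sC|sD] := iZ' C D cC cD (subset_trans (@subsetUl _ _ _) CD).
      by left=> z [/sC//|[X FX Xz]]; apply: (allC X FX); right.
    have [NF|/existsNP[X FX]] := pselect (forall X, ~ F X).
      by right=> z [/sD//|[X FX]]; case: (NF X).
    left=> z [Zz|[Y FY Yz]].
      by apply: (allC X); [exact: contrapT FX|left].
    by apply: (allC Y FY); right.
  right=> z [Zz|[Y FY Yz]].
    by case: (ZC X FX) => // h; apply: h; left.
  have [sXY|sYX] := Ftot X Y FX FY; last first.
    by case: (ZC X FX) => // h; apply: h; right; exact: sYX.
  case: (ZC Y FY) => h; last by apply: h; right.
  by case: NX; apply: subset_trans h; exact: setUS.
exists (Z `|` A); last exact: subsetUl.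
split=> // B iB AB; apply: contrapT => BA.
apply: (Amax (Z `|` B)).
  split; first by move=> z Az; right; apply: AB; right.
  move=> sB; apply: BA; apply/seteqP; split=> // z Bz.
  by right; apply: sB; right.
rewrite /P /= setUA setUid; have -> // : Z `|` B = B.
by apply/setUidPr => z Zz; apply: AB; left.
Qed.

(** * Bounded degrees *)

Lemma poly_eq_generic (k : closedFieldType) (r p q : {poly k}) : r != 0 ->
  (forall s, r.[s] != 0 -> p.[s] = q.[s]) -> p = q.
Proof.
move=> r0 h; apply/eqP; rewrite -subr_eq0; apply: contraT => pq0.
have /closed_nonrootP[s] : (p - q) * r != 0 by rewrite mulf_neq0.
rewrite rootM negb_or /root => /andP[+ /h pqs].
by rewrite hornerD hornerN pqs subrr eqxx.
Qed.

Lemma size_polyM_leqD (k : fieldType) (p q : {poly k}) D D' :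
  (size p <= D)%N -> (size q <= D')%N -> (size (p * q)%R <= D + D')%N.
Proof.
move=> hp hq; apply: leq_trans (size_polyMleq _ _) _.
by apply: leq_trans (leq_pred _) _; exact: leq_add.
Qed.

Lemma horner_neq0 (k : fieldType) (p : {poly k}) s : p.[s] != 0 -> p != 0.
Proof. by apply: contraNneq => ->; rewrite horner0. Qed.

Section DegreeBound.
Variables (k : closedFieldType) (m : nat).
Local Notation PP := (proj_space k m.+2).
Local Notation vec := ('I_m.+3 -> k).
Local Notation triang := (triang k).
Local Open Scope quotient_scope.

Section Line.
Variable x0 : PP.
Hypothesis cx0 : chart x0.

(** The line through [x0] parallel to the [x1]-axis: along it [x2] is constant and the multiplier of
    a triangular map is a fraction in the parameter [s]. *)
Definition line_coord (s : k) : vec := fun i => if i == i1 m then s else acoord x0 i.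
Definition line (s : k) : PP := apoint (line_coord s).
Let s0 := acoord x0 (i1 m).

Lemma line_coord0 s : line_coord s ord0 = 1.
Proof. by rewrite /line_coord /= acoord0. Qed.

Lemma acoord_line s : acoord (line s) = line_coord s.
Proof. by rewrite /line apointK // line_coord0. Qed.

Lemma line0 : line s0 = x0.
Proof.
rewrite -[RHS](acoordK cx0); congr apoint; apply/funext => i.
by rewrite /line_coord; case: eqP => [->|].
Qed.

Definition lpoly (p : {mpoly k[m.+3]}) : {poly k} :=
  sval (cid (meval_poly p
    (fun i => if i == i1 m then 'X else (acoord x0 i)%:P))).

Lemma lpolyE p s : (lpoly p).[s] = p.@[line_coord s].
Proof.
rewrite /lpoly; case: cid => q /= ->; apply: meval_eq => i.
by rewrite /line_coord; case: eqP => _; rewrite hornerE.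
Qed.

Lemma hpolyfun_line s : exists2 c, c != 0 &
  forall d (p : {mpoly k[m.+3]}), p \is d.-homog ->
    hpolyfun p (line s) = c ^+ d * (lpoly p).[s].
Proof.
have v0 : \row_i line_coord s i != 0.
  by apply: row_neq0; rewrite line_coord0 oner_neq0.
have [c c0 hc] := hpolyfun_point v0; exists c => // d p hp.
rewrite /line /apoint (hc _ _ hp) lpolyE; congr (_ * _); apply: meval_eq => i.
by rewrite mxE.
Qed.

Lemma near_line (O : set PP) : nbhs x0 O ->
  exists2 r : {poly k}, r.[s0] != 0 & forall s, r.[s] != 0 -> O (line s).
Proof.
rewrite nbhsE => -[O' [/zariski_openP oO' O'x] O'O].
have [_ [[d [p hp <-]] px pO]] := oO' _ O'x.
exists (lpoly p) => [|s ps].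
  have [c c0 hc] := hpolyfun_line s0.
  by move: px; rewrite -{1}line0 (hc _ _ hp) mulf_eq0 negb_or => /andP[].
apply/O'O/pO; have [c c0 hc] := hpolyfun_line s.
by rewrite (hc _ _ hp) mulf_neq0 // expf_neq0.
Qed.

(** Uniformity in [a] is the point: a function of [a] is constant along the line, and a function of
    [x] does not see [a]. So one denominator [q] serves all [a], and sums and products keep the
    numerators bounded. *)
Lemma prod_ring_line (A : funSpaceType k) (a0 : A) (P : vprod A PP -> k) :
  prod_ring (a0, x0) P -> exists (D : nat) (q : {poly k}), q.[s0] != 0 /\
    forall a, exists p : {poly k}, (size p <= D)%N /\
      forall s, q.[s] != 0 -> P (a, line s) = p.[s] / q.[s].
Proof.
elim=> {P} [f _|g rg|P P' _ [D [q [q0 h]]] _ [D' [q' [q'0 h']]]|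
  P P' _ [D [q [q0 h]]] _ [D' [q' [q'0 h']]]].
- exists 1%N, 1; split=> [|a]; first by rewrite hornerE oner_neq0.
  exists (f a)%:P; split=> [|s _]; first exact: size_polyC_leq1.
  by rewrite !hornerE divr1.
- have [N [M [[d [[n hn nN] [n' hn' nM]]] Mx gE]]] := rg.
  have [r r0 hr] := near_line gE.
  have [c c0 hc] := hpolyfun_line s0.
  move: Mx; rewrite -nM -line0 (hc _ _ hn') mulf_eq0 negb_or => /andP[_ n'0].
  (* The factor [r] on both sides makes non-vanishing of the denominator also imply that the local
     expression of [g] is valid at [line s]. *)
  exists (size (lpoly n * r)), (lpoly n' * r); split.
    by rewrite hornerM mulf_neq0.
  move=> a; exists (lpoly n * r); split=> [//|s /=].
  rewrite !hornerM mulf_eq0 negb_or => /andP[n's rs].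
  rewrite (hr _ rs) -nM -nN; have [c' c'0 hc'] := hpolyfun_line s.
  rewrite (hc' _ _ hn) (hc' _ _ hn') -!mulf_div.
  by rewrite !divff ?expf_neq0 // mul1r mulr1.
- exists (maxn (D + size q') (D' + size q)), (q * q'); split.
    by rewrite hornerM mulf_neq0.
  move=> a; have [p [Dp hp]] := h a; have [p' [Dp' hp']] := h' a.
  exists (p * q' + p' * q); split=> [|s].
    apply: leq_trans (size_polyD _ _) _; rewrite geq_max !leq_max.
    by apply/andP; split; apply/orP; [left|right]; exact: size_polyM_leqD.
  rewrite !(hornerM, hornerD) mulf_eq0 negb_or => /andP[qs q's].
  by rewrite hp // hp' // addf_div.
- exists (D + D')%N, (q * q'); split.
    by rewrite hornerM mulf_neq0.
  move=> a; have [p [Dp hp]] := h a; have [p' [Dp' hp']] := h' a.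
  exists (p * p'); split=> [|s].
    exact: size_polyM_leqD.
  rewrite !hornerM mulf_eq0 negb_or => /andP[qs q's].
  by rewrite hp // hp' // mulf_div.
Qed.
End Line.

(** Stated for arbitrary elements of [Bir], vacuously for the non-triangular ones, since the other
    elements of an algebraic group are unknown. Reduced fractions exclude common factors of
    arbitrary degree. *)
Definition degree_bounded (D : nat) (phi : Bir PP) : Prop :=
  forall t : triang, phi = tri m t -> coprimep (tnum t) (tden t) ->
    (size (tden t) <= D)%N.

Lemma degree_bounded_leq D D' phi :
  (D <= D')%N -> degree_bounded D phi -> degree_bounded D' phi.
Proof. by move=> DD' h t /h/[apply] /leq_trans; apply. Qed.

(** Along the line through [x0], the [x2]-coordinate of the image is both the fraction [P / Q], of
    bounded degree, and a nonzero constant times [tnum t / tden t]. As the latter is reduced,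
    [tden t] divides [q * p']. *)
Lemma local_degree_bound (A : funSpaceType k) (rho : A -> Bir PP) (a0 : A) :
  bir_morphism rho -> exists D, \forall a \near a0, degree_bounded D (rho a).
Proof.
move=> mrho; have [f [fE hf]] := bir_morphism_birep mrho.
have [x0 Dx0 [_ y0 _]] := good_point (f a0) 0.
have [rf nD] := hf (a0, x0) Dx0; have [[_ /= cfx] cx0] := Dx0.
have [P [Q [[rP rQ] Qx PQ]]] := regular_acoord_comp rf (i2 m) cfx.
pose W : set (vprod A PP) := [set p | cdom (f p.1) p.2 /\
    (acoord (bfun (f p.1) p.2) (i2 m) = P p / Q p /\ Q p != 0)].
have nW : nbhs ((a0, x0) : vprod A PP) W.
  exact: (filterI nD (filterI PQ (prod_ring_neq0 rQ Qx))).
have [D [q [q0 hq]]] := prod_ring_line cx0 rP.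
have [D' [q' [q'0 hq']]] := prod_ring_line cx0 rQ.
exists (size q + D')%N.
(* The neighbourhood of [x0] where the formula holds may shrink with [a]; it only serves to identify
   polynomials, so the bound is unaffected. *)
have nA : \forall a \near a0, nbhs ((a, x0) : vprod A PP) W.
  exact: (regmap_nbhs (W := fun p => nbhs p W) (regmap_slicel a0 x0) (near_join nW)).
apply: (filterS _ nA) => a nWa t rhoE cop.
have [_ [_ /= Qa]] := nbhs_singleton nWa.
have nX : nbhs x0 [set x | W (a, x)] := regmap_nbhs (regmap_slice a x0) nWa.
have [r r0 hr] := near_line cx0 nX.
have [p [Dp pE]] := hq a; have [p' [Dp' p'E]] := hq' a.
have polyE : p * q' * tden t = (acoord x0 (i2 m))%:P * tnum t * (q * p').
  apply: (@poly_eq_generic _ (r * (q * q'))) => [|s].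
    by rewrite !mulf_neq0 // ?(horner_neq0 r0) ?(horner_neq0 q0) ?(horner_neq0 q'0).
  rewrite !hornerM !mulf_eq0 !negb_or => /and3P[rs qs q's].
  have [Ds [fs Qs]] := hr _ rs.
  have /triP/(_ _ Ds (i2 m)) : \pi_(Bir PP) (f a) = tri m t by rewrite fE.
  rewrite /trelfun /= acoord_line // fs pE // p'E //.
  rewrite /line_coord /= => /eqP; rewrite subr_eq0 => /eqP.
  rewrite hornerC => e.
  move: Qs; rewrite p'E // mulf_eq0 negb_or => /andP[p's _].
  have -> : p.[s] * q'.[s] * (tden t).[s] =
    p.[s] / q.[s] / (p'.[s] / q'.[s]) * (tden t).[s] * (q.[s] * p'.[s]).
    by field; rewrite p's q's.
  by rewrite e.
have p'0 : p' != 0.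
  apply: contraNneq Qa => p'0; have := p'E (acoord x0 (i1 m)) q'0.
  by rewrite line0 // p'0 horner0 mul0r => ->.
have qn0 := horner_neq0 q0.
have : tden t %| (acoord x0 (i2 m))%:P * tnum t * (q * p').
  by rewrite -polyE dvdp_mulIr.
rewrite mul_polyC -scalerAl dvdpZr // Gauss_dvdpr 1?coprimep_sym // => /dvdp_leq.
rewrite mulf_neq0 // => /(_ isT) h.
by apply: (leq_trans h); exact: size_polyM_leqD.
Qed.

End DegreeBound.

(** * Degree bounds on algebraic groups and non-algebraic maps *)

Lemma closed_val_image (T : topologicalType) (Z : set T) (F : set Z) :
  closed Z -> closed F -> closed ((val : Z -> T) @` F).
Proof.
move=> cZ /closed_openC[O oO OF].
have -> : val @` F = Z `&` ~` O.
  apply/seteqP; split=> [_ [z Fz <-]|w [Zw NOw]].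
    split; first exact: set_valP.
    move=> Oz; have : (~` F) z by rewrite -OF.
    exact.
  exists (SigSub (mem_set Zw)) => //; apply: contrapT => NF.
  have : (val @^-1` O) (SigSub (mem_set Zw) : Z) by rewrite OF.
  exact: NOw.
by apply: closedI => //; exact: open_closedC.
Qed.

Section NonAlgebraic.
Variables (k : closedFieldType) (m : nat).
Local Notation PP := (proj_space k m.+2).
Local Notation triang := (triang k).
Local Open Scope quotient_scope.

Section Group.
Variables (H : funSpaceType k) (rho : H -> Bir PP).
Hypothesis rho_comp : forall A : set H, irreducible_component A ->
  bir_morphism (fun a : A => rho (\val a)).

(** [rho] is a morphism only on irreducible components, so [C] is split if its part in [Z] is
    reducible; otherwise the image of this part lies in a single component [A]. There the local
    bound holds on a nonempty open part, and the induction treats the remaining closed part. *)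
Lemma chart_degree_bound n (Z : set (affine_space k n)) (gam : Z -> H) :
  closed Z -> continuous gam -> exists D, forall z : Z, degree_bounded D (rho (gam z)).
Proof.
move=> cZ cgam.
have closed_pre (F : set H) : closed F -> closed (val @` (gam @^-1` F)).
  move=> cF; apply: closed_val_image => //; exact: closed_comp.
pose P (C : set (affine_space k n)) :=
  exists D, forall z : Z, C (val z) -> degree_bounded D (rho (gam z)).
suff /(_ _ cZ)[D hD] : forall C, closed C -> P C.
  by exists D => z; apply: hD; exact: set_valP.
apply: noetherian_ind => C cC IH.
pose C0 := C `&` Z.
have cC0 : closed C0 by exact: closedI.
have [iC|] := pselect (irreducible C0); last first.
  move=> /not_andP[/set0P/negP/negPn/eqP C00|].
    exists 0%N => z Cz; have : C0 (val z) by split=> //; exact: set_valP.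
    by rewrite C00.
  move=> /existsNP[F /existsNP[G /not_implyP[cF /not_implyP[cG]]]].
  move=> /not_implyP[CFG /not_orP[NF NG]].
  have [D hD] : P (C0 `&` F).
    apply: IH; first exact: closedI.
    split=> [w [[]]//|CF]; apply: NF => w [Cw _].
    by have [] := CF w Cw.
  have [D' hD'] : P (C0 `&` G).
    apply: IH; first exact: closedI.
    split=> [w [[]]//|CG]; apply: NG => w [Cw _].
    by have [] := CG w Cw.
  exists (maxn D D') => z Cz; have C0z : C0 (val z) by split=> //; exact: set_valP.
  have [Fz|Gz] := CFG _ C0z.
    by apply: degree_bounded_leq (leq_maxl _ _) _; exact: hD.
  by apply: degree_bounded_leq (leq_maxr _ _) _; exact: hD'.
have [A cA IA] : exists2 A, irreducible_component A & gam @` [set z | C (val z)] `<=` A.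
  apply: irreducible_sub_component; split.
    have [[w [Cw Zw]] _] := iC.
    by exists (gam (SigSub (mem_set Zw))); exists (SigSub (mem_set Zw)).
  move=> F G cF cG IFG; have [_ iC0] := iC.
  have [|CF|CG] := iC0 _ _ (closed_pre _ cF) (closed_pre _ cG).
  - move=> w [Cw Zw]; have [Fz|Gz] := IFG (gam (SigSub (mem_set Zw)))
      (ex_intro2 _ _ (SigSub (mem_set Zw)) Cw erefl).
      by left; exists (SigSub (mem_set Zw)).
    by right; exists (SigSub (mem_set Zw)).
  - left=> _ [z Cz <-]; by have [z' + /val_inj <-] := CF (val z) (conj Cz (set_valP z)).
  - right=> _ [z Cz <-]; by have [z' + /val_inj <-] := CG (val z) (conj Cz (set_valP z)).
have [[w0 [Cw0 Zw0]] _] := iC.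
pose z0 : Z := SigSub (mem_set Zw0).
have Az z : C (val z) -> A (gam z) by move=> Cz; apply: IA; exists z.
pose el z (Cz : C (val z)) : A := SigSub (mem_set (Az z Cz)).
have [D nD] := local_degree_bound (el z0 Cw0) (rho_comp cA).
have : nbhs (el z0 Cw0) [set a | degree_bounded D (rho (val a))] := nD.
rewrite nbhsE => -[_ [[O oO <-] /= Oz0] OD].
have : nbhs z0 (gam @^-1` O) by apply: cgam; exact: open_nbhs_nbhs.
rewrite nbhsE => -[_ [[O2 oO2 <-] /= O2z0] O2O].
have [D' hD'] : P (C `&` ~` O2).
  apply: IH; first by apply: closedI => //; exact: open_closedC.
  by split=> [w []//|CO2]; have [_] := CO2 _ Cw0; apply.
exists (maxn D D') => z Cz; have [O2z|NO2z] := pselect (O2 (val z)).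
  apply: degree_bounded_leq (leq_maxl _ _) _.
  by apply: (OD (el z Cz)); exact: O2O.
by apply: degree_bounded_leq (leq_maxr _ _) _; exact: hD'.
Qed.

Lemma group_degree_bound : variety H ->
  exists D, forall h, degree_bounded D (rho h).
Proof.
move=> [_ [N [U [hU UT]]]].
have /choice[D hD] : forall i, exists D, forall h, U i h -> degree_bounded D (rho h).
  move=> i; have [oU [n [Z [cZ [f [g iso]]]]]] := hU i.
  have cg : continuous (fun z => val (g z)).
    move=> z; have rg := open_iso_inv_reg iso (I : [set: Z] z).
    by have [] := regmap_comp rg (regmap_val (g z)).
  have [D hD] := chart_degree_bound cZ cg; exists D => h Uh.
  by have := hD (f (SigSub (mem_set Uh))); rewrite (open_iso_funK iso).
exists (\max_i D i)%N => h; have [i _ Ui] : (\bigcup_i U i) h by rewrite UT.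
by apply: degree_bounded_leq (hD i h Ui); exact: leq_bigmax.
Qed.

End Group.

(** The recursion starts at [t], so [tpow t N] is the power of exponent [N.+1]. *)
Fixpoint tpow (t : triang) (N : nat) : triang :=
  if N is N'.+1 then tmul t (tpow t N') else t.

Lemma algebraic_degree_bound (t : triang) : bir_algebraic (tri m t) ->
  exists D, forall N, coprimep (tnum (tpow t N)) (tden (tpow t N)) ->
    (size (tden (tpow t N)) <= D)%N.
Proof.
move=> [G [[H [rho [[vH _ _] hom comp GE]]] Gt]].
have [D hD] := group_degree_bound comp vH; exists D => N.
have [h] : exists h, rho h = tri m (tpow t N).
  rewrite -GE in Gt; have [h _ ht] := Gt.
  elim: N => [|N [h' h't]]; first by exists h.
  by exists (h * h')%g; rewrite hom ht h't -tri_mul.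
exact: hD.
Qed.

(* The y-multiplier of the N-th power is the product of the multipliers along
   the orbit of x; without a resonance between the orbits of its zero and of its
   pole nothing cancels, so that the degree grows linearly. *)
Lemma nonresonant_not_algebraic (t : triang) : size (tden t) = 2%N ->
  (forall x i j, (tnum t).[iter i (fun y => talpha t * y + tbeta t) x] = 0 ->
     (tden t).[iter j (fun y => talpha t * y + tbeta t) x] = 0 -> False) ->
  ~ bir_algebraic (tri m t).
Proof.
move=> s2 nres /algebraic_degree_bound[D hD].
set c := fun y => _ in nres.
have lin N x : talpha (tpow t N) * x + tbeta (tpow t N) = iter N.+1 c x.
  elim: N => [//|N IH]; rewrite [LHS]/= iterS -IH /c; ring.
have numE N x : (tnum (tpow t N)).[x] = \prod_(i < N.+1) (tnum t).[iter i c x].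
  elim: N => [|N IH]; first by rewrite big_ord1.
  by rewrite [LHS]/= hornerM horner_comp horner_tlin lin IH [RHS]big_ord_recr /= mulrC.
have denE N x : (tden (tpow t N)).[x] = \prod_(i < N.+1) (tden t).[iter i c x].
  elim: N => [|N IH]; first by rewrite big_ord1.
  by rewrite [LHS]/= hornerM horner_comp horner_tlin lin IH [RHS]big_ord_recr /= mulrC.
have cop N : coprimep (tnum (tpow t N)) (tden (tpow t N)).
  apply/Pdiv.ClosedField.coprimepP => x; rewrite /root numE denE.
  move=> /prodf_eq0[i _ /eqP ni]; apply/prodf_neq0 => j _.
  by apply/eqP => dj; exact: nres ni dj.
(* One factor of degree 1 for each of the [N.+1] points of the orbit. *)
have sz N : size (tden (tpow t N)) = N.+2.
  elim: N => [//|N IH]; rewrite [tden _]/= size_mul ?tden_neq0 //; last first.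
    by rewrite comp_tlin_neq0 ?talpha_neq0 ?tden_neq0.
  rewrite size_comp_poly2 ?s2 ?IH //.
  by rewrite /tlin -mul_polyC size_MXaddC polyC_eq0 size_polyC (negPf (talpha_neq0 _)).
by have := hD D (cop D); rewrite sz ltnNge leqnSn.
Qed.

End NonAlgebraic.

(** * The affine line and the punctured line *)

Section AffineVarieties.
Variables (k : fieldType).

Lemma closed_eq_regular (X : funSpaceType k) (f g : X -> k) :
  (forall x, regular_at x f) -> (forall x, regular_at x g) ->
  closed [set x | f x = g x].
Proof.
move=> rf rg; rewrite -openC openE => x /eqP fg.
by have := regular_near_neq (rf x) (rg x) fg; apply: filterS => y /eqP.
Qed.

Section Embedding.
Variables (X : funSpaceType k) (n : nat) (Z : set (affine_space k n)).
Variables (c : X -> affine_space k n) (g : affine_space k n -> X).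
Hypotheses (cZ : closed Z) (rc : regmap_on setT c) (Zc : forall x, Z (c x)).
Hypotheses (cK : cancel c g) (gK : forall z, Z z -> c (g z) = z).
Hypothesis rg : regmap_on Z g.

Lemma embedded_affine_variety : affine_variety X.
Proof.
exists n, Z; split=> //.
exists (fun x => SigSub (mem_set (Zc x))), (fun z => g (val z)); split=> //.
- exact: openT.
- exact: openT.
- by move=> x _; exact: cK.
- by move=> z _; apply/val_inj => /=; apply: gK; exact: set_valP.
- by move=> x _; apply: regmap_sub => /=; exact: rc.
- move=> z _; apply: regmap_comp; first exact: regmap_val.
  by apply: rg; exact: set_valP.
Qed.

End Embedding.

(** Distinct points differ in some coordinate of [c], an open condition on pairs, whence
    separatedness; the whole space is a single affine chart. *)
Lemma embedded_variety (X : funSpaceType k) (n : nat) (Z : set (affine_space k n))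
    (c : X -> affine_space k n) (g : affine_space k n -> X) :
  closed Z -> regmap_on setT c -> (forall x, Z (c x)) -> cancel c g ->
  (forall z, Z z -> c (g z) = z) -> regmap_on Z g -> variety X.
Proof.
move=> cZ rc Zc cK gK rg; split.
  rewrite /Defs.separated -[X in closed X]setCK; apply: open_closedC.
  rewrite openE => p pne.
  have /eqP/rV0Pn[i] : (c p.1 : 'rV[k]_n) - c p.2 <> 0.
    by move/eqP; rewrite subr_eq0 => /eqP /(can_inj cK).
  rewrite !mxE subr_eq0 => ci.
  have rci (r : vprod X X -> X) q : regmap_at r q ->
      regular_at q (fun q => (c (r q) : 'rV[k]_n) ord0 i).
    move=> rr; have [_ h] := regmap_comp rr (rc (r q) I).
    by apply: (h (fun v : affine_space k n => (v : 'rV[k]_n) ord0 i)); exact: regular_coord.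
  have := regular_near_neq (rci _ _ (regmap_fst p)) (rci _ _ (regmap_snd p)) ci.
  by apply: filterS => q /eqP qc /= e; apply: qc; rewrite e.
exists 1%N, (fun=> setT); split; last by apply/seteqP; split=> // x _; exists ord0.
move=> _; split; first exact: openT.
apply: (@embedded_affine_variety (set_type [set: X]) n Z (fun x => c (val x))
  (fun z => SigSub (mem_set (I : [set: X] (g z))))) => //.
- by move=> x _; apply: (regmap_comp (regmap_val x)); exact: rc.
- by move=> x; apply/val_inj => /=; exact: cK.
- by move=> z /rg rz; apply: regmap_sub.
Qed.

(** Every slice over [x] is inside [F] or inside [G] by irreducibility of [Y]; the two corresponding
    sets of [x] are closed, as intersections of preimages under the slices at fixed [y], and cover
    [X]. *)
Lemma irreducible_product (X Y : funSpaceType k) :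
  irreducible [set: X] -> irreducible [set: Y] -> irreducible [set: vprod X Y].
Proof.
move=> [[x0 _] iX] [[y0 _] iY]; split; first by exists (x0, y0).
move=> F G cF cG FG.
have cX (E : set (vprod X Y)) : closed E -> closed [set x | forall y, E (x, y)].
  move=> cE; have -> : [set x | forall y, E (x, y)] =
      \bigcap_(y in setT) ((fun x => (x, y) : vprod X Y) @^-1` E).
    by apply/seteqP; split=> x /= h y; [move=> _; exact: h|exact: h].
  apply: closed_bigI => y _; apply: closed_comp => // x _.
  by have [] := regmap_slicel x y.
have [x _|XF|XG] := iX _ _ (cX _ cF) (cX _ cG).
- have cY (E : set (vprod X Y)) : closed E -> closed [set y | E (x, y)].
    move=> cE; apply: (@closed_comp _ _ (fun y => (x, y) : vprod X Y) E) => // y _.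
    by have [] := regmap_slice x y.
  have [y _|YF|YG] := iY _ _ (cY _ cF) (cY _ cG).
  + exact: FG.
  + by left=> y; exact: YF.
  + by right=> y; exact: YG.
- by left=> -[x y] _; exact: XF.
- by right=> -[x y] _; exact: XG.
Qed.

End AffineVarieties.

Section Lines.
Variable k : closedFieldType.

Definition line_point (x : k) : affine_line k := const_mx x : 'rV[k]_1.

Lemma line_pointK : cancel line_point (@affine_coord k).
Proof. by move=> x; rewrite /affine_coord mxE. Qed.

Lemma affine_coordK : cancel (@affine_coord k) line_point.
Proof. by move=> x; apply/rowP => i; rewrite mxE [i]ord1. Qed.

Lemma regular_affine_coord (x : affine_line k) : regular_at x (@affine_coord k).
Proof. exact: regular_coord. Qed.

Lemma regmap_line_point (Y : funSpaceType k) (f : Y -> k) y :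
  regular_at y f -> regmap_at (fun z => line_point (f z)) y.
Proof. by move=> rf; apply: regmap_regular; under eq_fun do rewrite line_pointK. Qed.

Lemma line_point_neq0 (x : k) : x != 0 ->
  line_point x \in [set t : affine_line k | affine_coord t != 0].
Proof. by move=> x0; rewrite inE /= line_pointK. Qed.

(* The junk value at 0 is 1. *)
Definition punctured_point (x : k) : punctured_line k :=
  if pselect (x != 0) is left x0 then SigSub (line_point_neq0 x0)
  else SigSub (line_point_neq0 (oner_neq0 k)).

Lemma punctured_pointK x : x != 0 -> punctured_coord (punctured_point x) = x.
Proof.
rewrite /punctured_point; case: pselect => // x0 _.
by rewrite /punctured_coord /= line_pointK.
Qed.

Lemma punctured_coord_neq0 (x : punctured_line k) : punctured_coord x != 0.
Proof. exact: (set_valP x). Qed.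

Lemma punctured_coordK : cancel (@punctured_coord k) punctured_point.
Proof.
move=> x; apply/val_inj; apply: (can_inj affine_coordK).
exact: punctured_pointK (punctured_coord_neq0 x).
Qed.

Lemma regular_punctured_coord (x : punctured_line k) :
  regular_at x (@punctured_coord k).
Proof.
have [_ h] := regmap_val x.
by apply: (h (@affine_coord k)); exact: regular_affine_coord.
Qed.

Lemma regmap_punctured_point (Y : funSpaceType k) (f : Y -> k) y :
  regular_at y f -> f y != 0 -> regmap_at (fun z => punctured_point (f z)) y.
Proof.
move=> rf fy; apply: regmap_sub; apply: regmap_regular.
have := regular_neq0 _ _ rf fy => nf; apply: regular_eq_near rf; move: nf.
by apply: filterS => z fz; rewrite -[RHS]/(punctured_coord _) punctured_pointK.
Qed.

Lemma regular_comp_at (X Y : funSpaceType k) (f : X -> Y) (g : Y -> k) x :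
  regmap_at f x -> (forall y, regular_at y g) -> regular_at x (fun z => g (f z)).
Proof. by move=> [_ h] rg; exact: h. Qed.

Lemma line_variety : affine_variety (affine_line k) /\ variety (affine_line k).
Proof.
by split; [apply: (@embedded_affine_variety _ _ 1 setT id id)
          |apply: (@embedded_variety _ _ 1 setT id id)] => //;
   try exact: closedT; move=> x _; exact: regmap_id.
Qed.

Lemma nonempty_open_line (O : set (affine_line k)) x : open O -> O x ->
  exists2 q : {poly k}, q.[affine_coord x] != 0 &
    forall s, q.[s] != 0 -> O (line_point s).
Proof.
move=> /zariski_openP/[apply] -[_ [[p _ <-] px pO]].
have [q qE] := meval_poly p (fun=> 'X).
have qP y : q.[affine_coord y] = polyfun p y.
  by rewrite qE; apply: meval_eq => i; rewrite hornerX [i]ord1.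
exists q; first by rewrite qP.
by move=> s qs; apply: pO; rewrite -qP line_pointK.
Qed.

Lemma line_irreducible : irreducible [set: affine_line k].
Proof.
split; first by exists (line_point 0).
move=> F G cF cG FG; apply: contrapT => /not_orP[NF NG].
have [x Fx] : exists x, ~ F x by apply/existsNP => h; apply: NF.
have [y Gy] : exists y, ~ G y by apply/existsNP => h; apply: NG.
have [p px pF] := nonempty_open_line (closed_openC cF) Fx.
have [q qy qG] := nonempty_open_line (closed_openC cG) Gy.
have /closed_nonrootP[s] : p * q != 0 by rewrite mulf_neq0 ?(horner_neq0 px) ?(horner_neq0 qy).
by rewrite rootM negb_or => /andP[/pF Fs /qG Gs]; case: (FG (line_point s)).
Qed.

Lemma nonempty_open_punctured (O : set (punctured_line k)) x : open O -> O x ->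
  exists2 q : {poly k}, q.[punctured_coord x] != 0 &
    forall s, s != 0 -> q.[s] != 0 -> O (punctured_point s).
Proof.
move=> [O' oO' <-] O'x; have [q qx qO] := nonempty_open_line oO' O'x.
exists q => // s s0 /qO /=.
by rewrite /punctured_point; case: pselect.
Qed.

Lemma punctured_irreducible : irreducible [set: punctured_line k].
Proof.
split; first by exists (punctured_point 1).
move=> F G cF cG FG; apply: contrapT => /not_orP[NF NG].
have [x Fx] : exists x, ~ F x by apply/existsNP => h; apply: NF.
have [y Gy] : exists y, ~ G y by apply/existsNP => h; apply: NG.
have [p px pF] := nonempty_open_punctured (closed_openC cF) Fx.
have [q qy qG] := nonempty_open_punctured (closed_openC cG) Gy.
have /closed_nonrootP[s] : 'X * (p * q) != 0.
  by rewrite !mulf_neq0 ?polyX_eq0 ?(horner_neq0 px) ?(horner_neq0 qy).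
rewrite !rootM !negb_or rootX => /and3P[s0 /(pF _ s0) Fs /(qG _ s0) Gs].
by case: (FG (punctured_point s)).
Qed.

End Lines.

Section PuncturedVarieties.
Variable k : closedFieldType.
Local Notation AA n := (affine_space k n).

Definition hyperbola : set (AA 2) :=
  [set v | (v : 'rV[k]_2) ord0 ord0 * (v : 'rV[k]_2) ord0 ord_max = 1].

Lemma hyperbola_closed : closed hyperbola.
Proof.
apply: closed_eq_regular => x; last exact: regular_cst.
by apply: regularM; exact: regular_coord.
Qed.

Lemma unit_left (a b : k) : a * b = 1 -> a != 0.
Proof.
move=> ab; apply: contraTneq isT => a0; move: ab.
by rewrite a0 mul0r => /eqP; rewrite eq_sym oner_eq0.
Qed.

Definition hyperbola_coord (x : punctured_line k) : AA 2 :=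
  \row_(i < 2) (if i == ord0 then punctured_coord x else (punctured_coord x)^-1).

Lemma punctured_variety :
  affine_variety (punctured_line k) /\ variety (punctured_line k).
Proof.
have rc : regmap_on setT hyperbola_coord.
  move=> x _; apply: regmap_affine => i; under eq_fun do rewrite mxE.
  case: (i == ord0); first exact: regular_punctured_coord.
  apply: regularV; first exact: regular_punctured_coord.
  exact: punctured_coord_neq0.
have Zc x : hyperbola (hyperbola_coord x).
  by rewrite /hyperbola /hyperbola_coord /= !mxE /= divff // punctured_coord_neq0.
have cK : cancel hyperbola_coord
    (fun v : AA 2 => punctured_point ((v : 'rV[k]_2) ord0 ord0)).
  by move=> x; rewrite mxE eqxx punctured_coordK.
have gK v : hyperbola v -> hyperbola_coord (punctured_point ((v : 'rV[k]_2) ord0 ord0)) = v.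
  move=> vZ; have v0 := unit_left vZ; apply/rowP => i; rewrite mxE punctured_pointK //.
  case: (unliftP ord0 i) => [j ->|-> //]; rewrite [j]ord1 /=.
  have -> : lift ord0 ord0 = ord_max :> 'I_2 by exact/val_inj.
  by apply: (mulfI v0); rewrite divff // vZ.
have rg : regmap_on hyperbola (fun v : AA 2 => punctured_point ((v : 'rV[k]_2) ord0 ord0)).
  move=> v vZ; apply: regmap_punctured_point; first exact: regular_coord.
  exact: unit_left vZ.
by split; [exact: embedded_affine_variety hyperbola_closed rc Zc cK gK rg
          |exact: embedded_variety hyperbola_closed rc Zc cK gK rg].
Qed.

Local Notation BB := (line_times_punctured_line k).

Definition cylinder : set (AA 3) :=
  [set v | (v : 'rV[k]_3) ord0 (@Ordinal 3 1 isT) * (v : 'rV[k]_3) ord0 (@Ordinal 3 2 isT) = 1].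

Definition cylinder_coord (p : BB) : AA 3 := \row_(i < 3)
  (match val i with 0 => affine_coord p.1 | 1 => punctured_coord p.2
                  | _ => (punctured_coord p.2)^-1 end).

Definition cylinder_point (v : AA 3) : BB :=
  (line_point ((v : 'rV[k]_3) ord0 (@Ordinal 3 0 isT)),
   punctured_point ((v : 'rV[k]_3) ord0 (@Ordinal 3 1 isT))).

Lemma regular_BB1 (p : BB) : regular_at p (fun q : BB => affine_coord q.1).
Proof. exact: regular_comp_at (regmap_fst p) (@regular_affine_coord k). Qed.

Lemma regular_BB2 (p : BB) : regular_at p (fun q : BB => punctured_coord q.2).
Proof. exact: regular_comp_at (regmap_snd p) (@regular_punctured_coord k). Qed.

Lemma line_times_punctured_variety : variety BB.
Proof.
apply: (@embedded_variety _ _ 3 cylinder cylinder_coord cylinder_point).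
- apply: closed_eq_regular => x; last exact: regular_cst.
  by apply: regularM; exact: regular_coord.
- move=> p _; apply: regmap_affine => i; under eq_fun do rewrite mxE.
  case: (val i) => [|[|j]].
  + exact: regular_BB1.
  + exact: regular_BB2.
  + by apply: regularV; [exact: regular_BB2|exact: punctured_coord_neq0].
- move=> p; rewrite /cylinder /cylinder_coord /= !mxE /= divff //.
  exact: punctured_coord_neq0.
- move=> [x y]; rewrite /cylinder_point !mxE /=.
  by rewrite affine_coordK punctured_coordK.
- move=> v vZ; have v0 := unit_left vZ; apply/rowP => i; rewrite mxE /=.
  rewrite line_pointK punctured_pointK //.
  case: i => -[|[|[|//]]] hi /=.
  + by congr (v _ _); apply/val_inj.
  + by congr (v _ _); apply/val_inj.
  + have -> : Ordinal hi = @Ordinal 3 2 isT by exact/val_inj.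
    by apply: (mulfI v0); rewrite divff // vZ.
- move=> v vZ; apply: regmap_pair.
    by apply: regmap_line_point; exact: regular_coord.
  apply: regmap_punctured_point; first exact: regular_coord.
  exact: unit_left vZ.
Qed.

Lemma line_times_punctured_irreducible : irreducible [set: BB].
Proof.
by apply: irreducible_product; [exact: line_irreducible|exact: punctured_irreducible].
Qed.

End PuncturedVarieties.

(** * The additive and the multiplicative group *)

Section Groups.
Variable k : closedFieldType.

Definition additive_group : Type := affine_line k.
HB.instance Definition _ := FunSpace.copy additive_group (affine_line k).

Definition ga_mul (x y : additive_group) : additive_group :=
  line_point (affine_coord x + affine_coord y).
Definition ga_inv (x : additive_group) : additive_group :=
  line_point (- affine_coord x).
Definition ga_one : additive_group := line_point 0.

Lemma ga_mulA : associative ga_mul.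
Proof. by move=> x y z; rewrite /ga_mul !line_pointK addrA. Qed.
Lemma ga_mul1 : left_id ga_one ga_mul.
Proof. by move=> x; rewrite /ga_mul line_pointK add0r affine_coordK. Qed.
Lemma ga_mulr1 : right_id ga_one ga_mul.
Proof. by move=> x; rewrite /ga_mul line_pointK addr0 affine_coordK. Qed.
Lemma ga_mulV : left_inverse ga_one ga_inv ga_mul.
Proof. by move=> x; rewrite /ga_mul line_pointK addNr. Qed.
Lemma ga_mulrV : right_inverse ga_one ga_inv ga_mul.
Proof. by move=> x; rewrite /ga_mul line_pointK addrN. Qed.

HB.instance Definition _ :=
  isGroup.Build additive_group ga_mulA ga_mul1 ga_mulr1 ga_mulV ga_mulrV.

Definition multiplicative_group : Type := punctured_line k.
HB.instance Definition _ := FunSpace.copy multiplicative_group (punctured_line k).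

Definition gm_mul (x y : multiplicative_group) : multiplicative_group :=
  punctured_point (punctured_coord x * punctured_coord y).
Definition gm_inv (x : multiplicative_group) : multiplicative_group :=
  punctured_point (punctured_coord x)^-1.
Definition gm_one : multiplicative_group := punctured_point 1.

Lemma gm_coordM (x y : multiplicative_group) :
  punctured_coord (gm_mul x y) = punctured_coord x * punctured_coord y.
Proof. by rewrite punctured_pointK // mulf_neq0 // punctured_coord_neq0. Qed.
Lemma gm_coordV (x : multiplicative_group) :
  punctured_coord (gm_inv x) = (punctured_coord x)^-1.
Proof. by rewrite punctured_pointK // invr_eq0 punctured_coord_neq0. Qed.
Lemma gm_coord1 : punctured_coord gm_one = 1.
Proof. by rewrite punctured_pointK // oner_neq0. Qed.

Let coord_inj := can_inj (@punctured_coordK k).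

Lemma gm_mulA : associative gm_mul.
Proof. by move=> x y z; apply: coord_inj; rewrite !gm_coordM mulrA. Qed.
Lemma gm_mul1 : left_id gm_one gm_mul.
Proof. by move=> x; apply: coord_inj; rewrite gm_coordM gm_coord1 mul1r. Qed.
Lemma gm_mulr1 : right_id gm_one gm_mul.
Proof. by move=> x; apply: coord_inj; rewrite gm_coordM gm_coord1 mulr1. Qed.
Lemma gm_mulV : left_inverse gm_one gm_inv gm_mul.
Proof.
move=> x; apply: coord_inj; rewrite gm_coordM gm_coord1 gm_coordV mulVf //.
exact: punctured_coord_neq0.
Qed.
Lemma gm_mulrV : right_inverse gm_one gm_inv gm_mul.
Proof.
move=> x; apply: coord_inj; rewrite gm_coordM gm_coord1 gm_coordV divff //.
exact: punctured_coord_neq0.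
Qed.

HB.instance Definition _ :=
  isGroup.Build multiplicative_group gm_mulA gm_mul1 gm_mulr1 gm_mulV gm_mulrV.

Lemma additive_algebraic : algebraic_group additive_group.
Proof.
split; first by have [] := line_variety k.
  move=> p _; apply: regmap_line_point; apply: regularD.
    exact: regular_comp_at (regmap_fst p) (@regular_affine_coord k).
  exact: regular_comp_at (regmap_snd p) (@regular_affine_coord k).
move=> x _; apply: regmap_line_point; apply: regularN.
exact: regular_affine_coord.
Qed.

Lemma multiplicative_algebraic : algebraic_group multiplicative_group.
Proof.
split; first by have [] := punctured_variety k.
  move=> p _; apply: regmap_punctured_point; last first.
    by rewrite mulf_neq0 // punctured_coord_neq0.
  apply: regularM.
    exact: regular_comp_at (regmap_fst p) (@regular_punctured_coord k).
  exact: regular_comp_at (regmap_snd p) (@regular_punctured_coord k).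
move=> x _; apply: regmap_punctured_point.
  by apply: regularV; [exact: regular_punctured_coord|exact: punctured_coord_neq0].
by rewrite invr_eq0 punctured_coord_neq0.
Qed.

End Groups.

(** * Unipotent and semi-simple elements *)

Section GlobalFunctions.
Variable k : closedFieldType.

(** [E] is cofinite, so the fraction near the base point 1 and one near [s] are equal as rational
    functions. In lowest terms the first has no pole at [s]: a zero of [Q2] there would also be a
    zero of [P1]. *)
Lemma reduced_fraction (E : set k) (e : {poly k}) (f : k -> k) :
  e != 0 -> (forall s, e.[s] != 0 -> E s) -> E 1 ->
  (forall s, E s -> exists P Q R : {poly k}, [/\ Q.[s] != 0, R.[s] != 0 &
     forall s', E s' -> R.[s'] != 0 -> f s' = P.[s'] / Q.[s']]) ->
  exists P Q : {poly k}, forall s, E s -> Q.[s] != 0 /\ f s = P.[s] / Q.[s].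
Proof.
move=> e0 eE E1 floc; have [P [Q [R [Q1 R1 fPQ]]]] := floc 1 E1.
have Q0 := horner_neq0 Q1; have R0 := horner_neq0 R1.
pose g := gcdp P Q; pose P1 := P %/ g; pose Q2 := Q %/ g.
have g0 : g != 0 by rewrite gcdp_eq0 negb_and Q0 orbT.
have PE : P = P1 * g by rewrite divpK // dvdp_gcdl.
have QE : Q = Q2 * g by rewrite divpK // dvdp_gcdr.
have cop : coprimep P1 Q2 by apply: coprimep_div_gcd; rewrite Q0 orbT.
exists P1, Q2 => s Es; have [P' [Q' [R' [Q's R's fPQ']]]] := floc s Es.
have Q'0 := horner_neq0 Q's; have R'0 := horner_neq0 R's.
have crossE : P1 * Q' = P' * Q2.
  apply: (@poly_eq_generic _ (e * (R * (R' * (Q * Q'))))) => [|t].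
    by rewrite !mulf_neq0.
  rewrite !hornerM !mulf_eq0 !negb_or => /and5P[/eE Et Rt R't Qt Q't].
  have := fPQ t Et Rt; rewrite fPQ' // PE.
  move: Qt; rewrite {1}QE hornerM mulf_eq0 negb_or => /andP[Q2t gt].
  rewrite QE !hornerM -mulf_div divff // mulr1 => /eqP.
  by rewrite eqr_div // => /eqP ->.
have crossS : P1.[s] * Q'.[s] = P'.[s] * Q2.[s] by rewrite -!hornerM crossE.
have Q2s : Q2.[s] != 0.
  apply/negP => /eqP Q2s; move: crossS; rewrite Q2s mulr0 => /eqP.
  rewrite mulf_eq0 (negPf Q's) orbF => P1s.
  move/Pdiv.ClosedField.coprimepP: cop => /(_ s); rewrite /root Q2s P1s eqxx.
  by move=> /(_ isT).
split=> //; rewrite fPQ' //; apply/eqP; rewrite eqr_div //; exact/eqP/esym.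
Qed.

Lemma polyfun_line (p : {mpoly k[1]}) :
  exists q : {poly k}, forall s, polyfun p (line_point s) = q.[s].
Proof.
have [q qE] := meval_poly p (fun=> 'X); exists q => s.
by rewrite qE; apply: meval_eq => i; rewrite hornerX mxE.
Qed.

Lemma regular_line_local (f : affine_line k -> k) s :
  regular_at (line_point s) f -> exists P Q R : {poly k},
    [/\ Q.[s] != 0, R.[s] != 0 &
        forall s', R.[s'] != 0 -> f (line_point s') = P.[s'] / Q.[s']].
Proof.
move=> [_ [_ [[[p _ <-] [q _ <-]] qs]]].
rewrite /prop_near1 nbhsE => -[O [oO Os] OW].
have [R] := nonempty_open_line oO Os; rewrite line_pointK => Rs RO.
have [P PE] := polyfun_line p; have [Q QE] := polyfun_line q.
exists P, Q, R; split=> //; first by rewrite -QE.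
by move=> s' /RO /OW /= ->; rewrite PE QE.
Qed.

Lemma regular_line_poly (f : affine_line k -> k) :
  (forall x, regular_at x f) -> exists p : {poly k}, forall x, f x = p.[affine_coord x].
Proof.
move=> rf; have [|//|//|s _|P [Q PQ]] :=
    @reduced_fraction setT 1 (f \o @line_point k).
- exact: oner_neq0.
- have [P [Q [R [Qs Rs fE]]]] := regular_line_local (rf (line_point s)).
  by exists P, Q, R; split=> // s' _ /fE.
have sQ : size Q == 1%N.
  apply: contraT => /closed_rootP[s /eqP Qs].
  by have [] := PQ s I; rewrite Qs eqxx.
have /size_poly1P[c c0 Qc] := sQ.
exists (c^-1 *: P) => x; have [_] := PQ (affine_coord x) I.
by rewrite /= affine_coordK Qc hornerC hornerZ mulrC.
Qed.

Lemma roots_only_zero (Q : {poly k}) : Q != 0 -> (forall s, s != 0 -> Q.[s] != 0) ->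
  exists2 c, c != 0 & Q = c *: 'X^((size Q).-1).
Proof.
move=> Q0 hQ; have [r QE] := closed_field_poly_normal Q.
have r0 x : x \in r -> x = 0.
  move=> xr; apply/eqP; apply: contraT => /hQ; rewrite QE hornerZ.
  rewrite mulf_eq0 negb_or => /andP[_ /negP[]].
  by rewrite -/(root _ _) root_prod_XsubC.
have lQ : lead_coef Q != 0 by rewrite lead_coef_eq0.
exists (lead_coef Q) => //; rewrite {1}QE; congr (_ *: _).
have -> : (size Q).-1 = size r.
  by rewrite QE size_scale // size_prod_XsubC.
elim: r r0 {QE} => [|x r IH] h; first by rewrite big_nil expr0.
rewrite big_cons exprS IH => [|y yr]; last by apply: h; rewrite inE yr orbT.
by rewrite (h x) ?mem_head // subr0.
Qed.

(** The denominator of the global fraction can vanish only at 0, so it is a monomial. *)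
Lemma regular_punctured_laurent (f : punctured_line k -> k) :
  (forall x, regular_at x f) -> exists (p : {poly k}) (j : nat),
    forall x, f x = p.[punctured_coord x] / punctured_coord x ^+ j.
Proof.
move=> rf; have [|s||s s0|P [Q PQ]] :=
    @reduced_fraction [set s | s != 0] 'X (f \o @punctured_point k).
- by rewrite polyX_eq0.
- by rewrite hornerX.
- exact: oner_neq0.
- have [g rg] := rf (punctured_point s).
  rewrite /prop_near1 nbhsE => -[O [oO Os] OW].
  have [T] := nonempty_open_punctured oO Os; rewrite punctured_pointK // => Ts TO.
  have valE t : t != 0 -> val (punctured_point t) = line_point t.
    by move=> t0; rewrite -[LHS]affine_coordK -/(punctured_coord _) punctured_pointK.
  rewrite valE // in rg.
  have [P [Q [R [Qs Rs gE]]]] := regular_line_local rg.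
  exists P, Q, (T * R); split=> [//||t t0]; first by rewrite hornerM mulf_neq0.
  rewrite hornerM mulf_eq0 negb_or => /andP[Tt Rt].
  by rewrite /= (OW _ (TO t t0 Tt)) valE // gE.
have Q0 : Q != 0 by apply: (@horner_neq0 _ _ 1); have [] := PQ 1 (oner_neq0 k).
have [|c c0 QE] := roots_only_zero Q0; first by move=> s /PQ[].
exists (c^-1 *: P), (size Q).-1 => x.
have x0 := punctured_coord_neq0 x.
have [_] := PQ (punctured_coord x) x0.
rewrite /= punctured_coordK => ->; rewrite {1}QE !hornerZ hornerXn.
by field; rewrite c0 expf_neq0.
Qed.

End GlobalFunctions.

Section Elements.
Variable k : closedFieldType.

(** A translation keeps the leading coefficient, so the difference operator lowers the degree, in
    every characteristic. *)
Lemma size_shift_diff (p : {poly k}) h :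
  (size (p \Po tlin 1 h - p)%R <= (size p).-1)%N.
Proof.
have s2 : size (tlin 1 h) = 2%N by rewrite /tlin scale1r size_XaddC.
have [->|p0] := eqVneq p 0; first by rewrite comp_poly0 subr0 size_poly0.
have sz : size (p \Po tlin 1 h) = size p by rewrite size_comp_poly2.
apply/leq_sizeP => j; rewrite leq_eqVlt => /predU1P[<-|pj].
  have : lead_coef (p \Po tlin 1 h) = lead_coef p.
    rewrite lead_coef_comp ?s2 // /tlin scale1r lead_coefDl ?lead_coefX.
      by rewrite expr1n mulr1.
    by rewrite size_polyX ltnS size_polyC leq_b1.
  by rewrite !lead_coefE sz coefB => ->; rewrite subrr.
have hp : (size p <= j)%N by move: pj; case: (size p).
by rewrite coefB !nth_default ?subrr ?sz.
Qed.

(** [M - 1] acts on the polynomials [p i] as the difference operator. A power at least as large as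
    all their sizes kills them, and linear independence turns this into the vanishing of the
    matrix. *)
Lemma additive_unipotent (h : additive_group k) : unipotent_element h.
Proof.
move=> m M [f [rf free fM]].
have /choice[p hp] i := regular_line_poly (rf i).
pose c := affine_coord (h : affine_line k).
have pM i : p i \Po tlin 1 c = \sum_j M i j *: p j.
  apply: (@poly_eq_generic _ 1) => [|s _]; first exact: oner_neq0.
  have := fM i (line_point s : additive_group k); rewrite hp /=.
  rewrite /mul /= /ga_mul !line_pointK => e.
  rewrite horner_comp horner_tlin mul1r e horner_sum.
  by apply: eq_bigr => j _; rewrite hornerZ hp line_pointK.
pose d (q : {poly k}) := q \Po tlin 1 c - q.
have dsum (a : 'I_m -> k) : d (\sum_j a j *: p j) = \sum_j a j *: d (p j).
  rewrite /d raddf_sum -sumrB; apply: eq_bigr => j _.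
  by rewrite /= comp_polyZ scalerBr.
have dp i : d (p i) = \sum_j (M - 1%:M) i j *: p j.
  rewrite /d pM; under [RHS]eq_bigr do rewrite !mxE scalerBl.
  rewrite sumrB; congr (_ - _); rewrite (bigD1 i) //= eqxx scale1r big1 ?addr0 // => j ji.
  by rewrite eq_sym (negPf ji) scale0r.
have powE N i : \sum_j ((M - 1%:M) ^+ N) i j *: p j = iter N d (p i).
  elim: N => [|N IH].
    rewrite (bigD1 i) //= !mxE eqxx scale1r big1 ?addr0 // => j ji.
    by rewrite mxE eq_sym (negPf ji) scale0r.
  rewrite iterS -IH dsum; under [RHS]eq_bigr do rewrite dp scaler_sumr.
  rewrite exchange_big /=; apply: eq_bigr => j _.
  rewrite exprSr -mulmxE mxE scaler_suml; apply: eq_bigr => l _.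
  by rewrite scalerA.
have szd N i : (size (iter N d (p i)) <= size (p i) - N)%N.
  elim: N => [|N IH]; first by rewrite subn0.
  rewrite iterS subnS; apply: leq_trans (size_shift_diff _ _) _.
  by rewrite -!subn1 leq_sub2r.
exists (\max_i size (p i))%N; apply/matrixP => i j; rewrite [RHS]mxE.
apply: (free (fun j => ((M - 1%:M) ^+ \max_i size (p i)) i j)) => x.
have -> : \sum_l ((M - 1%:M) ^+ \max_i size (p i)) i l * f l x =
    (\sum_l ((M - 1%:M) ^+ \max_i size (p i)) i l *: p l).[affine_coord (x : affine_line k)].
  by rewrite horner_sum; apply: eq_bigr => l _; rewrite hornerZ [f l x]hp.
rewrite powE.
suff /eqP -> : iter (\max_i size (p i)) d (p i) == 0 by rewrite horner0.
rewrite -size_poly_leq0; apply: leq_trans (szd _ _) _.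
by rewrite leqn0 subn_eq0 leq_bigmax.
Qed.

Lemma coef_comp_scale (q : {poly k}) c e : (q \Po tlin c 0)`_e = c ^+ e * q`_e.
Proof.
have -> : q \Po tlin c 0 = \poly_(i < size q) (c ^+ i * q`_i).
  apply: (@poly_eq_generic _ 1) => [|s _]; first exact: oner_neq0.
  rewrite horner_comp horner_tlin addr0 horner_coef horner_poly.
  by apply: eq_bigr => i _; rewrite exprMn; ring.
by rewrite coef_poly; case: ltnP => // h; rewrite nth_default // mulr0.
Qed.

(** Multiplying by a common power [J] of the coordinate turns the basis into polynomials [q i], and
    dilation by [c] scales their coefficients: the column of coefficients of degree [e] is
    multiplied by [c^(e - J)] under [M]. The product of the [M - c^(e - J)] therefore kills all
    [q i], hence is zero by independence. *)
Lemma multiplicative_semisimple (h : multiplicative_group k) : semisimple_element h.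
Proof.
move=> [|m] M [f [rf free fM]].
  by rewrite [M]flatmx0; exact: diagonalizable0.
have /choice[q0 /choice[j0 hq0]] i := regular_punctured_laurent (rf i).
pose J := (\max_i j0 i)%N.
pose q i := q0 i * 'X^(J - j0 i).
have hq i x : f i x * punctured_coord (x : punctured_line k) ^+ J =
    (q i).[punctured_coord (x : punctured_line k)].
  have x0 := punctured_coord_neq0 (x : punctured_line k).
  rewrite [f i x]hq0 hornerM hornerXn -{1}(subnK (leq_bigmax i : (j0 i <= J)%N)) exprD.
  by field; rewrite expf_neq0.
pose c := punctured_coord (h : punctured_line k).
have c0 : c != 0 := punctured_coord_neq0 _.
have qM i : q i \Po tlin c 0 = c ^+ J *: \sum_j M i j *: q j.
  apply: (@poly_eq_generic _ 'X) => [|s]; first by rewrite polyX_eq0.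
  rewrite hornerX => s0.
  pose x : multiplicative_group k := punctured_point s.
  have xs : punctured_coord (x : punctured_line k) = s by exact: punctured_pointK.
  have xh : punctured_coord ((x * h)%g : punctured_line k) = s * c.
    by rewrite [LHS]gm_coordM xs.
  rewrite horner_comp horner_tlin addr0 mulrC -xh -hq fM xh exprMn.
  rewrite hornerZ horner_sum mulrA mulrC; congr (_ * _).
  rewrite mulr_suml; apply: eq_bigr => j _.
  by rewrite hornerZ -xs -hq mulrA.
pose S := (\max_i size (q i))%N.
pose C : 'M[k]_(m.+1, S) := \matrix_(i, e) (q i)`_e.
have Sq i : (size (q i) <= S)%N by exact: leq_bigmax.
have colE e : M *m col e C = (c ^+ (e : 'I_S) / c ^+ J) *: col e C.
  apply/colP => i; rewrite !mxE.
  have cJ : c ^+ J != 0 by rewrite expf_neq0.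
  apply: (mulfI cJ); have /(congr1 (fun r : {poly k} => r`_e)) := qM i.
  rewrite coefZ coef_sum => e1.
  have -> : c ^+ J * \sum_j M i j * col e C j ord0 = c ^+ J * \sum_i0 (M i i0 *: q i0)`_e.
    by congr (_ * _); apply: eq_bigr => j _; rewrite coefZ !mxE.
  by rewrite -e1 coef_comp_scale; field.
have hornE r e : horner_mx M r *m col e C = r.[c ^+ (e : 'I_S) / c ^+ J] *: col e C.
  elim/poly_ind: r => [|r a IH].
    by rewrite rmorph0 horner0 mul0mx scale0r.
  rewrite rmorphD rmorphM /= horner_mx_X horner_mx_C hornerMXaddC.
  rewrite mulmxDl mul_scalar_mx scalerDl; congr (_ + _).
  by rewrite -mulmxE -mulmxA colE -scalemxAr IH scalerA mulrC.
(* Distinct exponents can give equal values when [c] is a root of unity; [undup] keeps the roots of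
   the annihilating polynomial simple. *)
pose L := undup [seq c ^+ (e : 'I_S) / c ^+ J | e : 'I_S].
apply/diagonalizableP; exists L; first exact: undup_uniq.
apply/mxminpoly_minP/matrixP => i j; rewrite [RHS]mxE.
set r := \prod_(x <- L) _.
apply: (free (fun j => horner_mx M r i j)) => x.
have x0 := punctured_coord_neq0 (x : punctured_line k).
apply: (mulIf (expf_neq0 J x0)); rewrite mul0r mulr_suml.
have -> : \sum_j horner_mx M r i j * f j x * punctured_coord (x : punctured_line k) ^+ J =
    (\sum_j horner_mx M r i j *: q j).[punctured_coord (x : punctured_line k)].
  by rewrite horner_sum; apply: eq_bigr => l _; rewrite hornerZ -hq mulrA.
suff -> : \sum_j (horner_mx M r i j *: q j) = 0 by rewrite horner0.
apply/polyP => e; rewrite coef0 coef_sum.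
have [eS|Se] := ltnP e S; last first.
  rewrite big1 // => l _; rewrite coefZ nth_default ?mulr0 //.
  exact: leq_trans (Sq l) Se.
have /colP/(_ i) := hornE r (Ordinal eS); rewrite !mxE => e1.
under eq_bigr do rewrite coefZ.
have -> : \sum_j (horner_mx M r i j * (q j)`_e) =
    \sum_j (horner_mx M r i j * col (Ordinal eS) C j ord0).
  by apply: eq_bigr => l _; rewrite !mxE.
rewrite e1; suff /eqP -> : r.[c ^+ e / c ^+ J] == 0 by rewrite mul0r.
rewrite -/(root _ _) root_prod_XsubC mem_undup; apply/mapP.
by exists (Ordinal eS) => //; rewrite mem_enum.
Qed.
End Elements.

(** * Resonant parameters *)

Section Conjugates.
Variables (k : closedFieldType) (m : nat).
Local Notation PP := (proj_space k m.+2).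
Local Notation vec := ('I_m.+3 -> k).
Local Open Scope quotient_scope.

Lemma tri_eq (t t' : triang k) : talpha t = talpha t' -> tbeta t = tbeta t' ->
  tnum t * tden t' = tnum t' * tden t -> tri m t = tri m t'.
Proof.
move=> ea eb epq; apply/triP => x [[dx _] _]; have [cx p0 q0] := tdomN dx.
rewrite /= acoord_tmap // => -[[|[|[|j]]] hj]; rewrite /trelfun /tcoord /= ?subrr //.
  by rewrite ea eb subrr.
have := congr1 (fun r : {poly k} => r.[acoord x (i1 m)]) epq.
rewrite !hornerM => e; apply: (mulIf q0); rewrite mul0r mulrBl.
rewrite -[_ * _.[_] * _]mulrA -[_ * _ * (tden t).[_] in X in _ - X]mulrA -e.
by field.
Qed.

Lemma conj_neq0 (x b c : k) (g1 g2 : {poly k}) :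
  c != 0 -> x != 0 -> g1 != 0 -> g2 != 0 ->
  c *: (g1 * (g2 \Po tlin x b)) != 0.
Proof. by move=> c0 x0 g10 g20; rewrite scaler_eq0 negb_or c0 mulf_neq0 // comp_tlin_neq0. Qed.

(* The conjugate of (x, y) |-> (alpha x + beta, chi y) by
   (x, y) |-> (x, y g1(x) / g2(x)). *)
Definition tconj (x b c : k) (g1 g2 : {poly k}) (x0 : x != 0) (c0 : c != 0)
    (g10 : g1 != 0) (g20 : g2 != 0) : triang k :=
  Triang b x0 (conj_neq0 b c0 x0 g10 g20)
    (conj_neq0 b (oner_neq0 k) x0 g20 g10).

(** The factors of [g1] and [g2] at the intermediate point occur in both numerator and denominator,
    so the two sides agree in [Bir] although their data may differ. *)
Lemma tri_conj_mul (x b c x' b' c' x'' b'' c'' : k) (g1 g2 : {poly k})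
    (x0 : x != 0) (c0 : c != 0) (x0' : x' != 0) (c0' : c' != 0)
    (x0'' : x'' != 0) (c0'' : c'' != 0) (g10 : g1 != 0) (g20 : g2 != 0) :
  x'' = x * x' -> b'' = x * b' + b -> c'' = c * c' ->
  tri m (tconj b'' x0'' c0'' g10 g20) =
  (tri m (tconj b x0 c0 g10 g20) * tri m (tconj b' x0' c0' g10 g20))%g.
Proof.
move=> ex eb ec; rewrite -tri_mul; apply: tri_eq => //=.
rewrite !comp_polyZ !comp_polyM !comp_tlin_comp -ex -eb ec !scale1r -!mul_polyC polyCM.
by ring.
Qed.

Lemma conj_family (H : funSpaceType k) (x b c : H -> k) (g1 g2 : {poly k})
    (x0 : forall h, x h != 0) (c0 : forall h, c h != 0)
    (g10 : g1 != 0) (g20 : g2 != 0) :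
  (forall h, regular_at h x) -> (forall h, regular_at h b) ->
  (forall h, regular_at h c) ->
  triang_family (fun h => tconj (b h) (x0 h) (c0 h) g10 g20).
Proof.
move=> rx rb rc Y y r rr.
have rx' := regular_comp_at rr rx; have rb' := regular_comp_at rr rb.
have rc' := regular_comp_at rr rc.
split=> // g rg; have rl : regular_at y (fun z => (tlin (x (r z)) (b (r z))).[g z]).
  by under eq_fun do rewrite horner_tlin; apply: regularD => //; exact: regularM.
by split; under eq_fun do rewrite /= hornerZ hornerM horner_comp;
  apply: regularM; try (exact: regular_cst || exact: rc');
  apply: regularM; exact: regular_horner.
Qed.

End Conjugates.

Section Telescoping.
Variable k : closedFieldType.

Lemma XaddC_neq0 (c : k) : 'X + c%:P != 0.
Proof. by rewrite -size_poly_gt0 size_XaddC. Qed.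

Definition linprod (w : nat -> k) (l : nat) : {poly k} := \prod_(i < l) ('X + (w i)%:P).

Lemma linprod_neq0 w l : linprod w l != 0.
Proof. by apply/prodf_neq0 => i _; exact: XaddC_neq0. Qed.

(** Both sides are [linprod w l.+1], with the last or the first factor split off. *)
Lemma linprod_telescope w l :
  ('X + (w l)%:P) * linprod w l = ('X + (w 0%N)%:P) * linprod (fun i => w i.+1) l.
Proof.
have : linprod w l.+1 = linprod w l.+1 by [].
by rewrite {1}/linprod big_ord_recr {1}/linprod big_ord_recl /= mulrC.
Qed.

Lemma linprod_comp w w' a b l : (forall i, a * w' i = b + w i) ->
  linprod w l \Po tlin a b = a ^+ l *: linprod w' l.
Proof.
move=> h; rewrite /linprod rmorph_prod /= -mul_polyC.
rewrite -[l in a ^+ l]card_ord rmorphXn /= -prodr_const -big_split /=.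
apply: eq_bigr => i _; rewrite comp_polyD comp_polyX comp_polyC /tlin.
by rewrite -addrA -polyCD -h polyCM mulrDr !mul_polyC.
Qed.

End Telescoping.

Section Families.
Variables (k : closedFieldType) (m : nat).
Local Notation BB := (line_times_punctured_line k).
Local Notation PP := (proj_space k m.+2).

(** Conjugating all translations by the same map embeds [G_a] in [Bir]; the given element is the
    image of 1. *)
Lemma additive_unipotent_conj (g1 g2 : {poly k}) (g10 : g1 != 0) (g20 : g2 != 0) :
  bir_unipotent (tri m (tconj 1 (oner_neq0 k) (oner_neq0 k) g10 g20)).
Proof.
pose tau (h : additive_group k) :=
  tconj (affine_coord (h : affine_line k)) (oner_neq0 k) (oner_neq0 k) g10 g20.
have tF : triang_family tau.
  apply: (@conj_family _ (additive_group k) (fun=> 1) _ (fun=> 1)).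
  - by move=> h; exact: regular_cst.
  - by move=> h; exact: regular_affine_coord.
  - by move=> h; exact: regular_cst.
have tR : recoverable m tau.
  exists 0, (fun e e' => line_point (e' (i1 m) - e (i1 m)) : additive_group k); split.
    move=> b e e' /(_ (i1 m)); rewrite /trelfun /= mul1r => /eqP.
    rewrite subr_eq0 => /eqP -> _; rewrite addrAC subrr add0r.
    exact: affine_coordK.
  move=> A a e e' re' _; apply: regmap_line_point; apply: regularB => //.
  exact: regular_cst.
have tM (x y : additive_group k) : tri m (tau (x * y)%g) = (tri m (tau x) * tri m (tau y))%g.
  apply: tri_conj_mul; rewrite ?mulr1 // mul1r.
  by rewrite [LHS]line_pointK addrC.
have [sG aG] := tri_algebraic_structure (additive_algebraic k) tF tR tM.
exists (range (tri m \o tau)), (additive_group k), (tri m \o tau); split=> //.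
  by have [] := line_variety k.
exists (line_point 1 : additive_group k); last exact: additive_unipotent.
by apply: tri_eq => //=; rewrite line_pointK.
Qed.

(** The conjugates of the maps [(h x, h^z y)] form a one-dimensional torus with parameter [h], and
    the given element has parameter [xi]; its constant [xi ^ z] is the value of a character. *)
Lemma multiplicative_semisimple_conj (xi : k) (z : int) (g1 g2 : {poly k})
    (xi0 : xi != 0) (xiz0 : xi ^ z != 0) (g10 : g1 != 0) (g20 : g2 != 0) :
  bir_semisimple (tri m (tconj 0 xi0 xiz0 g10 g20)).
Proof.
pose c (h : multiplicative_group k) := punctured_coord (h : punctured_line k).
have c0 h : c h != 0 := punctured_coord_neq0 _.
have cz0 h : c h ^ z != 0 by rewrite expfz_neq0.
pose tau (h : multiplicative_group k) := tconj 0 (c0 h) (cz0 h) g10 g20.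
have rc h : regular_at h c by exact: regular_punctured_coord.
have tF : triang_family tau.
  apply: conj_family => // h; first exact: regular_cst.
  case: z {xiz0 cz0 tau} => l; first exact: regular_exp.
  apply: regularV; first exact: regular_exp.
  by rewrite expf_neq0.
have tR : recoverable m tau.
  exists 0, (fun e e' => punctured_point (e' (i1 m) / e (i1 m)) : multiplicative_group k).
  split=> [b e e' /(_ (i1 m)) + [e0 _ _]|].
    rewrite /trelfun /= addr0 => /eqP; rewrite subr_eq0 => /eqP ->.
    by rewrite mulfK //; exact: punctured_coordK.
  move=> A a e e' re' [e0 _ e'0]; apply: regmap_punctured_point.
    by apply: regularM => //; exact: regular_cst.
  by rewrite mulf_neq0 // invr_eq0.
have tM (x y : multiplicative_group k) : tri m (tau (x * y)%g) = (tri m (tau x) * tri m (tau y))%g.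
  apply: tri_conj_mul; rewrite ?mulr0 ?addr0 // /c [punctured_coord _]gm_coordM //.
  by rewrite expfzMl.
have [sG aG] := tri_algebraic_structure (multiplicative_algebraic k) tF tR tM.
exists (range (tri m \o tau)), (multiplicative_group k), (tri m \o tau); split=> //.
  by have [] := punctured_variety k.
exists (punctured_point xi : multiplicative_group k); last exact: multiplicative_semisimple.
by apply: tri_eq => /=; rewrite /c ?punctured_pointK.
Qed.

End Families.

(** * The two families *)

Lemma homeomorphism_onto_range (T T' : topologicalType) (f : T -> T') (x0 : T) :
  continuous f -> injective f -> (forall Z, closed Z -> closed (f @` Z)) ->
  homeomorphism_onto f (range f).
Proof.
move=> cf fI fcl; split=> //.
have /choice[g gP] : forall y, exists x, range f y -> f x = y.
  move=> y; have [[x _ <-]|Ny] := pselect (range f y); first by exists x.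
  by exists x0.
have fK : cancel f g by move=> x; apply: fI; apply: gP; exists x.
exists g; split=> //; apply/continuous_closedP => Z cZ.
apply/closed_subspaceP; exists (f @` Z); first exact: fcl.
apply/seteqP; split=> y [].
  by move=> [x Zx <-] Rfx; split=> //; rewrite -[x]fK in Zx.
by move=> /= Zgy Ry; split=> //; exists (g y) => //; exact: gP.
Qed.

Lemma bir_morphism_continuous (k : fieldType) (X A : funSpaceType k)
    (rho : A -> Bir X) :
  variety A -> irreducible [set: A] -> bir_morphism rho -> continuous rho.
Proof. move=> vA iA mrho; apply/continuousP => O oO.
have oO' : bir_open O := oO.
exact: oO' vA iA mrho. Qed.

Section Examples.
Variables (k : closedFieldType) (m : nat).
Local Notation PP := (proj_space k m.+2).
Local Notation BB := (line_times_punctured_line k).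

(* (x1, x2) |-> (xi x1 + e, x2 (x1 + a) / (x1 + d)) with p = (a, xi). *)
Definition sigma (e d : k) (p : BB) : triang k :=
  Triang e (punctured_coord_neq0 p.2) (XaddC_neq0 (affine_coord p.1)) (XaddC_neq0 d).

Lemma sigma_family e d : triang_family (sigma e d).
Proof.
move=> Y y r rr.
have ra := regular_comp_at rr (@regular_BB1 k).
have rx := regular_comp_at rr (@regular_BB2 k).
split=> //; first exact: regular_cst.
move=> g rg; split.
  by under eq_fun do rewrite /= hornerD hornerX hornerC; exact: regularD.
under eq_fun do rewrite /= hornerD hornerX hornerC.
by apply: regularD => //; exact: regular_cst.
Qed.

(** The equations [x' = xi x + e] and [y' (x + d) = y (x + a)] are solved for [xi] and [a];
    [x' != e] makes [xi] nonzero. *)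
Lemma sigma_recoverable e d : recoverable m (sigma e d).
Proof.
exists e, (fun v v' => (line_point (v' (i2 m) * (v (i1 m) + d) / v (i2 m) - v (i1 m)),
  punctured_point ((v' (i1 m) - e) / v (i1 m))) : BB); split.
  move=> [a x] v v' h [v1 v2 _].
  have /eqP := h (i1 m); rewrite /trelfun /= subr_eq0 => /eqP ->.
  have /eqP := h (i2 m); rewrite /trelfun /= subr_eq0 !hornerD !hornerX !hornerC.
  move=> /eqP ->; rewrite addrK mulfK // punctured_coordK.
  by rewrite [_ * (_ + _)]mulrC mulfK // addrAC subrr add0r affine_coordK.
move=> A a v v' rv [v1 v2 v'1]; apply: regmap_pair => /=.
  apply: regmap_line_point; apply: regularB; last exact: regular_cst.
  by do 2!(apply: regularM; last exact: regular_cst).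
apply: regmap_punctured_point; last by rewrite mulf_neq0 ?invr_eq0 ?subr_eq0.
by apply: regularM; [apply: regularB => //|]; exact: regular_cst.
Qed.

Lemma sigma_morphism e d : bir_morphism (tri m \o sigma e d).
Proof. exact/bir_morphism_tri/sigma_family. Qed.

Lemma sigma_closed e d (Z : set BB) :
  closed Z -> closed ((tri m \o sigma e d) @` Z).
Proof. exact: closed_tri_image (@sigma_family e d) (@sigma_recoverable e d) Z. Qed.

Lemma sigma_inj e d : injective (tri m \o sigma e d).
Proof. exact: tri_family_inj (@sigma_recoverable e d). Qed.

Lemma unipotent_algebraic (X : funSpaceType k) :
  @bir_unipotent _ X `<=` @bir_algebraic _ X.
Proof.
move=> phi [G [H [iota [sG [_ _ _ GE _] _ [h <- _]]]]].
by exists G; split=> //; rewrite -GE; exists h.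
Qed.

Lemma semisimple_algebraic (X : funSpaceType k) :
  @bir_semisimple _ X `<=` @bir_algebraic _ X.
Proof.
move=> phi [G [H [iota [sG [_ _ _ GE _] _ [h <- _]]]]].
by exists G; split=> //; rewrite -GE; exists h.
Qed.

Definition s_map (p : BB) : Bir PP := tri m (sigma 0 1 p).

Definition u_map (t : affine_line k) : Bir PP :=
  tri m (sigma 1 0 (t, punctured_point 1)).

Lemma s_algebraic_resonant (p : BB) : bir_algebraic (s_map p) ->
  exists z : int, affine_coord p.1 = punctured_coord p.2 ^ z.
Proof.
move=> alg; apply: contrapT => nz; move: alg.
apply: nonresonant_not_algebraic; first exact: size_XaddC.
move=> x i j; set c := fun y => _.
have iterE l : iter l c x = punctured_coord p.2 ^+ l * x.
  elim: l => [|l IH]; first by rewrite mul1r.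
  by rewrite iterS IH /c /= addr0 exprS mulrA.
rewrite /= !hornerD !hornerX !hornerC !iterE => /eqP.
rewrite addrC addr_eq0 => /eqP aE /eqP; rewrite addr_eq0 => /eqP xE.
(* [xi^i x = - a] and [xi^j x = - 1] give [a = xi^(i - j)]. *)
apply: nz; exists (i%:Z - j%:Z).
have p0 := punctured_coord_neq0 p.2.
rewrite expfzDr // -exprz_inv -!exprnP exprVn aE.
have -> : x = - (punctured_coord p.2 ^- j).
  by apply: (mulfI (expf_neq0 j p0)); rewrite xE mulrN divff // expf_neq0.
by rewrite mulrN opprK.
Qed.

Lemma s_resonant_semisimple (p : BB) (z : int) :
  affine_coord p.1 = punctured_coord p.2 ^ z -> bir_semisimple (s_map p).
Proof.
have x0 := punctured_coord_neq0 p.2.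
set x := punctured_coord p.2 in x0 *.
have xz0 : x ^ z != 0 by rewrite expfz_neq0.
case: z xz0 => l xz0 aE.
  (* [xi^l h(x) / h(xi x)] is the product of the [x + xi^(i+1)] over that of the [x + xi^i], for
     [i < l], and collapses to [(x + xi^l) / (x + 1)]. *)
  pose h := linprod (fun i => x ^+ i.+1) l.
  have hE : h \Po tlin x 0 = x ^+ l *: linprod (fun i => x ^+ i) l.
    by apply: linprod_comp => i; rewrite add0r exprS.
  have h0 : h != 0 := linprod_neq0 _ _.
  have := multiplicative_semisimple_conj m x0 xz0 h0 (oner_neq0 _).
  congr (bir_semisimple _); apply: tri_eq => //=.
  rewrite aE hE comp_polyC !scale1r !mulr1 mul1r -scalerAl -scalerAr.
  have := linprod_telescope (fun i => x ^+ i) l; rewrite expr0 -/h => e.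
  by rewrite -[x ^ l]/(x ^+ l) e mulrC polyC1.
(* For the exponent [-(l+1)] the factors descend and [h] changes sides: the multiplier is
   [xi^-(l+1) h(xi x) / h(x)]. *)
pose w i := x ^- i.
pose h := linprod w l.+1.
have hE : h \Po tlin x 0 = x ^+ l.+1 *: linprod (fun i => w i.+1) l.+1.
  apply: linprod_comp => i; rewrite add0r /w exprS invfM mulrA divff // mul1r //.
have h0 : h != 0 := linprod_neq0 _ _.
have := multiplicative_semisimple_conj m x0 xz0 (oner_neq0 _) h0.
congr (bir_semisimple _); apply: tri_eq => //=.
rewrite aE hE comp_polyC !scale1r !mulr1 mul1r.
have := linprod_telescope w l.+1; rewrite -/h /w expr0 invr1 => e.
rewrite -[x ^ _]/(x ^- l.+1) scalerA mulVf ?expf_neq0 // scale1r.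
by rewrite e mulrC.
Qed.

Lemma u_algebraic_integer (t : affine_line k) : bir_algebraic (u_map t) ->
  exists z : int, affine_coord t = z%:~R.
Proof.
move=> alg; apply: contrapT => nz; move: alg.
apply: nonresonant_not_algebraic; first exact: size_XaddC.
move=> x i j; set c := fun y => _.
have iterE l : iter l c x = x + l%:R.
  elim: l => [|l IH]; first by rewrite addr0.
  by rewrite iterS IH /c /= punctured_pointK ?oner_neq0 // mul1r -natr1 addrA.
rewrite /= !hornerD !hornerX !hornerC !iterE addr0 => /eqP.
rewrite addrC addr_eq0 => /eqP aE /eqP; rewrite addr_eq0 => /eqP xE.
(* [x + i = - a] and [x + j = 0] give [a = j - i]. *)
apply: nz; exists (j%:Z - i%:Z).
by rewrite rmorphB /= -!pmulrn aE xE opprD opprK.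
Qed.

Lemma u_integer_unipotent (t : affine_line k) (z : int) :
  affine_coord t = z%:~R -> bir_unipotent (u_map t).
Proof.
case: z => l tE.
  (* With [h = x (x + 1) ... (x + l - 1)], the quotient [h(x + 1) / h(x)] collapses to
     [(x + l) / x]. *)
  pose h := linprod (fun i => i%:R : k) l.
  have hE : h \Po tlin 1 1 = linprod (fun i => i.+1%:R) l.
    rewrite (@linprod_comp _ _ (fun i => i.+1%:R)) ?expr1n ?scale1r // => i.
    by rewrite mul1r -natr1 addrC.
  have := additive_unipotent_conj m (oner_neq0 _) (linprod_neq0 _ _ : h != 0).
  congr (bir_unipotent _); apply: tri_eq => //=.
    by rewrite punctured_pointK ?oner_neq0.
  rewrite tE hE comp_polyC !scale1r !mulr1 mul1r.
  have := linprod_telescope (fun i => i%:R : k) l; rewrite -/h => e.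
  by rewrite -[l%:~R]/(l%:R) e mulrC.
(* For [-(l+1)], the multiplier is [h(x) / h(x + 1)] with [h = (x - 1) ... (x - l - 1)]. *)
pose w i : k := - i%:R.
pose h := linprod (fun i => w i.+1) l.+1.
have hE : h \Po tlin 1 1 = linprod w l.+1.
  rewrite (@linprod_comp _ _ w) ?expr1n ?scale1r // => i.
  by rewrite mul1r /w -natr1 opprD addrCA subrr addr0.
have := additive_unipotent_conj m (linprod_neq0 _ _ : h != 0) (oner_neq0 _).
congr (bir_unipotent _); apply: tri_eq => //=.
  by rewrite punctured_pointK ?oner_neq0.
rewrite tE hE comp_polyC !scale1r !mulr1 mul1r.
have := linprod_telescope w l.+1; rewrite -/h => e.
by rewrite -[(Negz l)%:~R]/(w l.+1) e mulrC /w oppr0.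
Qed.

Lemma s_mapP (p : BB) : bir_algebraic (s_map p) <->
  exists z : int, affine_coord p.1 = punctured_coord p.2 ^ z.
Proof.
split; first exact: s_algebraic_resonant.
by move=> [z /s_resonant_semisimple /semisimple_algebraic].
Qed.

Lemma u_mapP (t : affine_line k) : bir_algebraic (u_map t) <->
  exists z : int, affine_coord t = z%:~R.
Proof.
split; first exact: u_algebraic_integer.
by move=> [z /u_integer_unipotent /unipotent_algebraic].
Qed.

Lemma u_closed (Z : set (affine_line k)) : closed Z -> closed (u_map @` Z).
Proof.
move=> cZ; pose Z' : set BB := [set p | Z p.1 /\ punctured_coord p.2 = 1].
have -> : u_map @` Z = (tri m \o sigma 1 0) @` Z'.
  apply/seteqP; split=> [_ [t Zt <-]|_ [[t x] [/= Zt x1] <-]].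
    exists (t, punctured_point 1) => //; split=> //=.
    by rewrite punctured_pointK // oner_neq0.
  by exists t => //; rewrite /u_map /= -x1 punctured_coordK.
apply: sigma_closed; apply: closedI.
  apply: (@closed_comp _ _ (fun p : BB => p.1) Z) => // p _.
  by have [] := regmap_fst p.
apply: closed_eq_regular => p; [exact: regular_BB2|exact: regular_cst].
Qed.

Lemma u_morphism : bir_morphism u_map.
Proof.
apply: (@bir_morphism_tri k m _ (fun t => sigma 1 0 (t, punctured_point 1))).
apply: (triang_family_comp (rho := fun t => (t, punctured_point 1) : BB) (@sigma_family 1 0)).
by move=> t _; exact: regmap_slicel.
Qed.

Lemma u_continuous : continuous u_map.
Proof.
apply: bir_morphism_continuous u_morphism; last exact: line_irreducible.
by have [] := line_variety k.
Qed.

Lemma s_continuous : continuous s_map.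
Proof.
apply: bir_morphism_continuous (@sigma_morphism 0 1).
  exact: line_times_punctured_variety.
exact: line_times_punctured_irreducible.
Qed.

(** * Failure of closedness *)

(** [X^N - a] is separable: its derivative [N X^(N-1)] can vanish only at 0, which is not a root as
    [a != 0]. *)
Lemma uniq_roots_Xn_sub (N : nat) (a : k) : N%:R != 0 :> k -> a != 0 ->
  exists2 r : seq k, size r = N & uniq r /\ forall z, z \in r -> z ^+ N = a.
Proof.
move=> N0 a0; have Npos : (0 < N)%N by case: N N0 => //; rewrite eqxx.
pose p : {poly k} := 'X^N - a%:P.
have sp : size p = N.+1 by rewrite size_XnsubC.
have [r pE] := closed_field_poly_normal p.
have lp : lead_coef p = 1 by apply/eqP/monicXnsubC.
rewrite lp scale1r in pE.
have rp z : z \in r -> z ^+ N = a.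
  rewrite -root_prod_XsubC -pE /root !hornerE subr_eq0 => /eqP //.
exists r; first by apply: succn_inj; rewrite -sp pE size_prod_XsubC.
split=> //; rewrite -separable_prod_XsubC -pE.
rewrite unlock; apply/Pdiv.ClosedField.coprimepP => z; rewrite pE root_prod_XsubC -pE => /rp zN.
rewrite derivB derivXn derivC subr0 hornerMn hornerXn -mulr_natr mulf_neq0 //.
apply: expf_neq0; apply: contraNneq a0 => z0.
by rewrite -zN z0 expr0n (gtn_eqF Npos).
Qed.

Lemma exists_neq01 : exists2 a : k, a != 0 & a != 1.
Proof.
have /closed_nonrootP[a] : 'X * ('X - 1%:P) != 0 :> {poly k}.
  by rewrite mulf_neq0 ?polyX_eq0 ?polyXsubC_eq0.
rewrite rootM negb_or rootX root_XsubC => /andP[a0 a1].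
by exists a.
Qed.

Lemma bir_algebraic_not_closed : ~ closed (@bir_algebraic _ PP).
Proof.
move=> calg; have [a a0 a1] := exists_neq01.
pose slice (x : punctured_line k) : BB := (line_point a, x).
have cC : closed ((s_map \o slice) @^-1` @bir_algebraic _ PP).
  apply: closed_comp => // x _; apply: continuous_comp; last exact: s_continuous.
  by have [] := regmap_slice (line_point a) x.
have N1 : (~` ((s_map \o slice) @^-1` @bir_algebraic _ PP)) (punctured_point 1).
  move=> /= /s_mapP[z]; rewrite /= line_pointK punctured_pointK ?oner_neq0 //.
  by rewrite exp1rz => /eqP; rewrite (negPf a1).
have [q q1 qC] := nonempty_open_punctured (closed_openC cC) N1.
have q0 := horner_neq0 q1.
(* One of two consecutive integers is nonzero in [k], so in every characteristic some [X^N - a] has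
   [N] distinct roots, more than [q] can have. *)
have [N sN N0] : exists2 N, (size q <= N)%N & N%:R != 0 :> k.
  have [e|?] := eqVneq ((size q)%:R : k) 0; last by exists (size q).
  by exists (size q).+1 => //; rewrite -natr1 e add0r oner_neq0.
have [r sr [ur rP]] := uniq_roots_Xn_sub N0 a0.
suff rq : all (root q) r by have := max_poly_roots q0 rq ur; rewrite sr ltnNge sN.
apply/allP => z /rP zN.
have z0 : z != 0.
  apply: contraNneq a0 => z0; rewrite -zN z0 expr0n.
  by rewrite gtn_eqF // lt0n; apply: contraNneq N0 => ->.
apply/negP => /negP /(qC _ z0); apply; apply/s_mapP; exists N%:Z.
by rewrite /= line_pointK punctured_pointK.
Qed.

Lemma bir_unipotent_not_closed :
  [pchar k] =i pred0 -> ~ closed (@bir_unipotent _ PP).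
Proof.
move=> /pcharf0P ch0 cunip.
have cC : closed (u_map @^-1` @bir_unipotent _ PP).
  by apply: closed_comp => // t _; exact: u_continuous.
have n20 : 2%:R != 0 :> k by rewrite ch0.
(* In characteristic 0, one half is not the image of an integer [z], because [2 z - 1] is odd and
   hence nonzero. *)
have Nh : (~` (u_map @^-1` @bir_unipotent _ PP)) (line_point 2%:R^-1).
  move=> /= /unipotent_algebraic/u_mapP[z]; rewrite line_pointK => e.
  have : (2 * z - 1)%:~R = 0 :> k.
    by rewrite rmorphB rmorphM /= -e divff // subrr.
  have : 2 * z - 1 != 0.
    by rewrite subr_eq0; apply/eqP => /(congr1 (fun w => odd `|w|%N)); rewrite abszM oddM.
  case: (2 * z - 1) => w w0; first by
    rewrite -pmulrn => /eqP; rewrite ch0 => /eqP w00; rewrite w00 in w0.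
  by rewrite NegzE rmorphN /= -pmulrn => /eqP; rewrite oppr_eq0 ch0.
have [q qh qC] := nonempty_open_line (closed_openC cC) Nh.
have q0 := horner_neq0 qh.
pose r : seq k := [seq i%:R | i <- iota 0 (size q)].
have ur : uniq r.
  rewrite map_inj_uniq ?iota_uniq // => i j e.
  wlog ij : i j e / (i <= j)%N.
    by move=> h; case/orP: (leq_total i j) => /h; [apply|move=> ->].
  have : (j - i)%:R == 0 :> k by rewrite natrB // e subrr.
  by rewrite ch0 subn_eq0 => ji; apply/eqP; rewrite eqn_leq ij.
suff rq : all (root q) r.
  by have := max_poly_roots q0 rq ur; rewrite size_map size_iota ltnn.
apply/allP => _ /mapP[i _ ->].
apply/negP => /negP /qC; apply; apply: (@u_integer_unipotent _ i).
by rewrite line_pointK.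
Qed.

End Examples.

Theorem theorem1 (k : closedFieldType) (n : nat) (hn : (2 <= n)%N) :
  (exists (U S : set (Bir (proj_space k n)))
          (u : affine_line k -> Bir (proj_space k n))
          (s : line_times_punctured_line k -> Bir (proj_space k n)),
     [/\ closed U /\ closed S,
         bir_morphism u /\ homeomorphism_onto u U,
         bir_morphism s /\ homeomorphism_onto s S,
         U `&` @bir_algebraic _ (proj_space k n) =
           U `&` @bir_unipotent _ (proj_space k n) /\
         (forall t : affine_line k, bir_algebraic (u t) <->
            exists m : int, affine_coord t = m%:~R) &
         S `&` @bir_algebraic _ (proj_space k n) =
           S `&` @bir_semisimple _ (proj_space k n) /\
         (forall p : line_times_punctured_line k, bir_algebraic (s p) <->
            exists m : int, affine_coord p.1 = punctured_coord p.2 ^ m)]) /\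
  ~ closed (@bir_algebraic _ (proj_space k n)) /\
  ([pchar k] =i pred0 -> ~ closed (@bir_unipotent _ (proj_space k n))).
Proof.
case: n hn => [|[|m]] // _.
split; last by split; [exact: bir_algebraic_not_closed|exact: bir_unipotent_not_closed].
exists (range (u_map m)), (range (@s_map k m)), (u_map m), (@s_map k m); split.
- by split; [apply: u_closed|apply: sigma_closed]; exact: closedT.
- split; first exact: u_morphism.
  apply: homeomorphism_onto_range (u_closed (m := m)); first exact: line_point 0.
    exact: u_continuous.
  by move=> t t' /(@sigma_inj _ _ 1 0)[].
- split; first exact: sigma_morphism.
  apply: homeomorphism_onto_range (@sigma_closed _ _ 0 1).
  + exact: (line_point 0, punctured_point 1).
  + exact: s_continuous.
  + exact: sigma_inj.
- split; last exact: u_mapP.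
  apply/seteqP; split=> phi [Up alg]; split=> //; last exact: unipotent_algebraic.
  by case: Up alg => t _ <- /u_mapP[z]; exact: u_integer_unipotent.
- split; last exact: s_mapP.
  apply/seteqP; split=> phi [Sp alg]; split=> //; last exact: semisimple_algebraic.
  by case: Sp alg => p _ <- /s_mapP[z]; exact: s_resonant_semisimple.
Qed.
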